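(* For every integer $d\geq 3$ there exists a balanced simplicial complex with exactly $4d$ vertices whose geometric realization is homeomorphic to $\mathbb{S}^2\times \mathbb{S}^{d-3}$.
   Context: A $(d-1)$-dimensional simplicial complex is balanced if its graph ($1$-skeleton) is properly $d$-colorable, i.e. there is a map $\kappa:V\to\{1,\dots,d\}$ with $\kappa(x)\neq\kappa(y)$ for every edge $\{x,y\}$. For $d=3$, $\mathbb{S}^2\times\mathbb{S}^0$ is two disjoint $2$-spheres. *)

(* Defs.v *)
From HB Require Import structures.
From mathcomp Require Import all_boot all_order all_algebra.
From mathcomp Require Import all_classical all_reals all_analysis.

Set Implicit Arguments.
Unset Strict Implicit.
Unset Printing Implicit Defensive.

Import Order.TTheory GRing.Theory Num.Theory.
Import numFieldNormedType.Exports.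

Local Open Scope classical_set_scope.
Local Open Scope ring_scope.

Section SimplicialComplex.
Variable V : finType.
Implicit Types (K : {set {set V}}) (s t : {set V}).

(* The empty face is included, and elements of V need not be vertices. *)
Definition simplicial_complex K : Prop :=
  finset.set0 \in K /\
  (forall s t, s \in K -> t \subset s -> t \in K).

Definition vertices K : {set V} := [set v | [set v]%SET \in K]%SET.

Definition edge K (x y : V) : bool := (x != y) && ([set x; y]%SET \in K).

(* The complex {set0}, of dimension -1, also gets the value 0. *)
Definition complex_dim K : nat := (\max_(s in K) #|s|)%N.-1.

Definition balanced (d : nat) K : Prop :=
  (complex_dim K).+1 = d /\
  exists kappa : V -> 'I_d, forall x y, edge K x y -> kappa x != kappa y.

(* Barycentric coordinates, with the product topology on R^V. *)
Definition realization (R : realType) K : set {ptws V -> R} :=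
  [set x | [/\ forall v, 0 <= x v,
               \sum_v x v = 1
             & [set v | x v != 0]%SET \in K]].

End SimplicialComplex.

Arguments realization {V} R K.

(* The library norm on row vectors is the sup norm, hence the explicit sum. *)
Definition sphere (R : realType) (n : nat) : set 'rV[R]_n.+1 :=
  [set x | \sum_i x ord0 i ^+ 2 = 1].

Arguments sphere R n : clear implicits.

Definition homeomorphic (X Y : topologicalType) : Prop :=
  exists (f : X -> Y) (g : Y -> X),
    [/\ cancel f g, cancel g f, continuous f & continuous g].

(* Main.v *)
(** A vertex is a colour [i] in [{0, ..., n}] with two signs [(sigma, tau)], and
    the facets are certain sign words over the colours.  A point of the complex
    has a vector [y], its masses signed by [sigma], and a vector [v], its masses
    signed by [tau].  In Krawtchouk coordinates the components of [y] of index at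
    least 2 vanish exactly when [y] is affine in the colour; normalised, they are
    the coordinate in [S^(n-2)].

    Over a fixed value of this coordinate the fibre is a 2-sphere, made of a
    collar and two discs.  In the collar, [sigma * tau] is one of the [2 (n+1)]
    cyclically arranged patterns with at most one sign change: this gives the
    angle, and the height is the sum of [v] divided by the l1-norm of [y], which
    is strictly monotone along the lines of affine perturbations of [y].  In the
    discs, [tau] is constant and [sigma] has at least two sign changes.  The flow
    multiplying the [j]-th Krawtchouk coordinate by [r ^ j] strictly diminishes
    variation, so that it carries [y] into the vectors with at most one sign
    change at a unique boundary time [r], which is the radius.

    Both spaces are then quotients of one finite union of compact parameter
    spaces, with the same fibres. *)

Require Import Defs.
From HB Require Import structures.
From mathcomp Require Import all_boot all_order all_algebra.
From mathcomp Require Import all_classical all_reals all_analysis.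
From mathcomp Require Import zify ring lra.
Import numFieldNormedType.Exports.

Set Implicit Arguments.
Unset Strict Implicit.
Unset Printing Implicit Defensive.

Import Order.TTheory GRing.Theory Num.Theory.

Local Open Scope ring_scope.

(** * Sign patterns *)

(** Over one value of the coordinate in [S^(n-2)] the vectors [y] fill a plane, a coset of the
    affine vectors. Each disc is a copy of the part of this plane in [inB], and its rim is where
    [inB] meets [inA]. The collar is a circle of segments in the same plane, one for each direction
    of an affine vector; one end of each segment lies on the rim of one disc, the other end on the
    rim of the other disc.

    The part in [inB] is a union of pieces, one for each sign word, which by themselves show neither
    a centre nor a radius. This is what the flow is for. Krawtchouk coordinates refer to products of
    powers of [1 + X] and [1 - X], which are preserved up to scale by the substitutions fixing 1 and
    -1; hence scaling by [r ^ j] is such a substitution, and sign changes of coefficients can be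
    counted. As [r] tends to 0 a vector approaches its affine part, which has at most one change.
    The one vector of the plane without affine part never reaches [inA] and is the centre.

    Two places are degenerate: the centre, where the angle is undefined, and slots in which the
    point of given height does not move. *)

Section Patterns.
Variable n : nat.
Notation d := n.+1.
Local Open Scope nat_scope.
Implicit Types (k : nat) (i : 'I_d) (s : 'I_d -> bool).

(* [true] stands for a minus sign, and slots [k] count modulo [2 d]: from [k] to
   [k.+1] the pattern [rho k] changes only at [kap k.+1]. *)
Definition kap k : 'I_d := inZp k.

Definition rho k i : bool := odd (k %/ d) (+) (i <= k %% d).

Definition alt s : bool :=
  [exists i : 'I_d, exists j : 'I_d, exists l : 'I_d, [&& i < j, j < l, s i != s j & s j != s l]].

Lemma altP s (i j l : 'I_d) : i < j -> j < l -> s i != s j -> s j != s l -> alt s.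
Proof.
move=> ij jl sij sjl; apply/existsP; exists i; apply/existsP; exists j.
by apply/existsP; exists l; rewrite ij jl sij sjl.
Qed.

Lemma eq_alt s s' : s =1 s' -> alt s = alt s'.
Proof.
move=> e; apply: eq_existsb => i; apply: eq_existsb => j.
by apply: eq_existsb => l; rewrite !e.
Qed.

Lemma alt_addb b s : alt (fun i => b (+) s i) = alt s.
Proof.
apply: eq_existsb => i; apply: eq_existsb => j; apply: eq_existsb => l.
by case: b (s i) (s j) (s l) => [] [] [] [].
Qed.

Variant succ_spec k : nat -> nat -> Type :=
| SuccIn of k %% d < n : succ_spec k (k %% d).+1 (k %/ d)
| SuccWrap of k %% d = n : succ_spec k 0 (k %/ d).+1.

Lemma succP k : succ_spec k (k.+1 %% d) (k.+1 %/ d).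
Proof.
have kd : k %% d < d by rewrite ltn_mod.
have -> : k.+1 %% d = if k %% d == n then 0 else (k %% d).+1.
  rewrite {1}(divn_eq k d) -addnS modnMDl.
  by case: eqP => [->|ne]; [rewrite modnn | rewrite modn_small//; lia].
have -> : k.+1 %/ d = (k %% d == n) + k %/ d.
  rewrite {1}(divn_eq k d) -addnS divnMDl// addnC; congr addn.
  by case: eqP => [->|ne]; [rewrite divnn | rewrite divn_small//; lia].
by case: eqP => [e|ne]; [right | left; lia].
Qed.

Lemma kapD k : kap (k + d) = kap k.
Proof. by apply: val_inj; rewrite /= modnDr. Qed.

Lemma kapD2 k : kap (k + d.*2) = kap k.
Proof. by rewrite -addnn addnA !kapD. Qed.

Lemma kap_succ_neq k : 0 < n -> kap k.+1 != kap k.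
Proof. by move=> n0; rewrite -val_eqE /=; case: succP; lia. Qed.

Lemma rhoD k i : rho (k + d) i = ~~ rho k i.
Proof. by rewrite /rho modnDr divnDr// divnn /= addn1 /= addNb. Qed.

Lemma rhoD2 k i : rho (k + d.*2) i = rho k i.
Proof. by rewrite -addnn addnA !rhoD negbK. Qed.

Lemma rho_succ k i : rho k.+1 i = rho k i (+) (i == kap k.+1).
Proof.
rewrite /rho -val_eqE /=; have := ltn_ord i; case: succP => kn id.
  by rewrite -addbA; congr addb; case: ltngtP; lia.
have -> : i <= k %% d by lia.
by rewrite /= addbT leqn0; case: (odd _); case: (_ == _).
Qed.

Lemma kap_inj_range k j j' : 0 < j <= d -> 0 < j' <= d ->
  kap (k + j) = kap (k + j') -> j = j'.
Proof.
move=> jd jd' /(congr1 val) /= /eqP; rewrite eqn_modDl => /eqP.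
have [->|jd1] := eqVneq j d; have [->|jd2] := eqVneq j' d; rewrite ?modnn//.
- by rewrite modn_small//; lia.
- by rewrite modn_small//; lia.
by rewrite !modn_small//; lia.
Qed.

(** Half a turn flips each colour exactly once, so up to [e = d] the colour of step [j] has changed
    precisely when that step has been made; later it would change back. *)
Lemma rho_between k e j : e <= d -> 0 < j <= d ->
  rho (k + e) (kap (k + j)) = rho k (kap (k + j)) (+) (j <= e).
Proof.
elim: e => [|e IH] ed jd; first by rewrite addn0 leqNgt; case/andP: jd => ->; rewrite addbF.
rewrite addnS rho_succ IH ?(ltnW ed)// -addbA; congr addb; rewrite -addnS.
case: eqP => [/kap_inj_range-> //|ne]; first by rewrite ltnn leqnn.
have : j <> e.+1 by move=> je; apply: ne; rewrite je.
by rewrite addbF => ?; lia.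
Qed.

Lemma rho_noalt k : ~~ alt (rho k).
Proof.
apply/existsP => -[i /existsP[j /existsP[l /and4P[ij jl]]]]; rewrite /rho.
case: (odd _); case: (leqP i _) => ?; case: (leqP j _) => ?;
  case: (leqP l _) => ? //=; lia.
Qed.

(** Such a pattern is determined by its value at 0 and by the first index that differs from it; a
    constant pattern has its step after the last index. The value at 0 selects the half turn. *)
Lemma noalt_rho s : ~~ alt s -> exists2 k, k < d.*2 & s =1 rho k.
Proof.
move=> nalt.
have [k kd sk] : exists2 k, k < d & forall i, s i = ~~ s ord0 (+) (i <= k).
  have [/existsP[j0 sj0]|/existsPn sc] := boolP [exists j, s j != s ord0]; last first.
    exists n => // i; have /negbNE/eqP-> := sc i.
    by rewrite -ltnS ltn_ord addbT negbK.
  case: (@arg_minnP _ j0 (fun j => s j != s ord0) (@nat_of_ord d)) => // j sj jmin.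
  have j1 : 0 < j by rewrite lt0n; apply: contra sj => /eqP j1; apply/eqP; congr s; apply: val_inj.
  exists j.-1 => [|i]; first by have := ltn_ord j; lia.
  have -> : (i <= j.-1) = (i < j) by lia.
  case: (ltnP i j) => ij.
    apply/eqP; rewrite addbT negbK; apply: contraLR ij => si.
    by rewrite -leqNgt; apply: jmin.
  have sij : s i = s j.
    apply/eqP; apply: contraR nalt => sij; rewrite eq_sym in sij.
    apply: (@altP s ord0 j i); rewrite ?sij// 1?eq_sym//.
    rewrite ltn_neqAle ij andbT; apply: contra sij => /eqP/val_inj ->//.
  by rewrite sij addbF; move: sj; case: (s j); case: (s ord0).
exists (k + (~~ s ord0) * d) => [|i].
  by case: (s ord0); rewrite /= ?mul0n ?mul1n -addnn; lia.
rewrite sk; case: (s ord0) => /=; rewrite ?mul0n ?addn0 ?mul1n ?rhoD /rho;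
  by rewrite divn_small// modn_small//.
Qed.

(** Flipping only [kap k] or only [kap k.+1] leads to a neighbouring slot. Any other single flip,
    and by [alt_flip2] the flip of both, creates a second change; this is why these two colours act
    as one block in the collar. *)
Lemma alt_flip1 k i0 s : 1 < n -> i0 != kap k -> i0 != kap k.+1 ->
  (forall i, s i = rho k i (+) (i == i0)) -> alt s.
Proof.
move=> n1; rewrite -!val_eqE /= => ik ik1 sE.
rewrite (@eq_alt _ (fun i => odd (k %/ d) (+) ((i <= k %% d) (+) (i == i0)))); last first.
  by move=> i; rewrite sE /rho addbA.
rewrite alt_addb; have := ltn_ord i0; move: ik ik1; have := @ltn_pmod k d isT.
set K := k %% d => Kd ik; case: succP; rewrite -/K => Kn ik1 i0d.
- have [iK|Ki] := ltnP i0 K.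
    have [i00|i0p] := posnP i0.
      apply: (@altP _ ord0 (inord K) (inord K.+1)); rewrite -?val_eqE /= ?inordK//; lia.
    apply: (@altP _ ord0 i0 (inord K)); rewrite -?val_eqE /= ?inordK//; lia.
  have [i0n|i0n] := ltnP i0 n.
    apply: (@altP _ (inord K.+1) i0 ord_max); rewrite -?val_eqE /= ?inordK//; lia.
  apply: (@altP _ (inord K) (inord K.+1) i0); rewrite -?val_eqE /= ?inordK//; lia.
- apply: (@altP _ ord0 i0 ord_max); rewrite -?val_eqE /=; lia.
Qed.

Lemma alt_flip2 k s : 1 < n ->
  (forall i, s i = rho k i (+) ((i == kap k) || (i == kap k.+1))) -> alt s.
Proof.
move=> n1; rewrite /kap => sE.
rewrite (@eq_alt _ (fun i => odd (k %/ d) (+) ((i <= k %% d) (+)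
   ((i == k %% d :> nat) || (i == k.+1 %% d :> nat))))); last first.
  by move=> i; rewrite sE /rho addbA.
rewrite alt_addb; have := @ltn_pmod k d isT; set K := k %% d => Kd.
case: succP; rewrite -/K => Kn.
- have [K0|K0] := posnP K.
    apply: (@altP _ ord0 (inord 1) (inord 2)); rewrite /= ?inordK//; lia.
  apply: (@altP _ ord0 (inord K) (inord K.+1)); rewrite /= ?inordK//; lia.
- apply: (@altP _ ord0 (inord 1) ord_max); rewrite /= ?inordK//; lia.
Qed.

End Patterns.

(** * Variation diminution *)

Section TaylorShift.
Variables (R : realFieldType) (s : R).
Hypothesis s0 : 0 < s.
Implicit Types p q : {poly R}.

Notation shift p := (p \Po ('X + s%:P)).

(** Horner's rule: appending the constant term [c] multiplies the shifted polynomial by [X + s] and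
    adds [c]. *)
Lemma coef_shiftMXaddC q c i : (shift (q * 'X + c%:P))`_i =
  (if i is j.+1 then (shift q)`_j else c) + s * (shift q)`_i.
Proof.
rewrite comp_polyD comp_polyM comp_polyX comp_polyC mulrDr !coefD coefMX coefMC coefC.
by case: i => [|i] /=; ring.
Qed.

Lemma size_shift p : size (shift p) = size p.
Proof. by rewrite size_comp_poly2// size_XaddC. Qed.

Lemma lead_shift p : (shift p)`_(size p).-1 = lead_coef p.
Proof.
have := @lead_coef_comp _ p ('X + s%:P); rewrite size_XaddC => /(_ isT).
by rewrite lead_coefXaddC expr1n mulr1 lead_coefE size_shift.
Qed.

Lemma shift_nonneg p : (forall i, 0 <= p`_i) ->
  (forall i, 0 <= (shift p)`_i) /\ (forall i, (i < size p)%N -> 0 < (shift p)`_i).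
Proof.
elim/poly_ind: p => [|q c IH] pos.
  by rewrite comp_poly0 size_poly0; split => // i; rewrite coef0.
have qpos i : 0 <= q`_i by have := pos i.+1; rewrite coefD coefMX coefC addr0.
have cpos : 0 <= c by have := pos 0%N; rewrite coefD coefMX coefC add0r.
have [nn pp] := IH qpos; split => i; rewrite coef_shiftMXaddC.
  by apply: addr_ge0; [case: i => // i|apply: mulr_ge0; rewrite ?(ltW s0)].
rewrite size_MXaddC; case: ifP => // qc; case: i => [_|i iq].
  have [q0|q0] := eqVneq q 0; last first.
    by rewrite ltr_wpDl// mulr_gt0// pp// size_poly_gt0.
  by rewrite q0 comp_poly0 coef0 mulr0 addr0 lt0r cpos andbT; move: qc; rewrite q0 eqxx /= => ->.
by rewrite ltr_pwDl ?pp// mulr_ge0 ?(ltW s0).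
Qed.

(** In Horner's rule each new coefficient is the old left neighbour plus [s] times the old
    coefficient. Strict signs on both sides of the change persist, and the undetermined entry at the
    change decides by its own sign whether the change stays or moves one place to the right. *)
Lemma shift_one_change p k : 0 < lead_coef p ->
  (forall i, (i < k)%N -> p`_i <= 0) -> (forall i, (k <= i)%N -> 0 <= p`_i) ->
  exists k', (forall i, (i < k')%N -> (shift p)`_i < 0) /\
    (forall i, (k' < i < size p)%N -> 0 < (shift p)`_i).
Proof.
elim/poly_ind: p k => [|q c IH] k lp neg pos; first by rewrite lead_coef0 ltxx in lp.
have [q0|q0] := eqVneq q 0.
  exists 0%N; split => // i; rewrite q0 size_MXaddC eqxx /= size_poly0; case: ifP => //; lia.
have sp : size (q * 'X + c%:P) = (size q).+1 by rewrite size_MXaddC (negbTE q0).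
have qE i : q`_i = (q * 'X + c%:P)`_i.+1 by rewrite coefD coefMX coefC addr0.
have lq : 0 < lead_coef q.
  move: lp; rewrite !lead_coefE sp /= qE prednK//; by rewrite size_poly_gt0.
(* A positive constant term excludes any change, and [shift_nonneg] applies. *)
have [c0|c0] := leP c 0; last first.
  have k0 : k = 0%N.
    case: k neg {pos} => // k neg; have := neg 0%N isT.
    by rewrite coefD coefMX coefC add0r => /(lt_le_trans c0); rewrite ltxx.
  have [|_ pp] := @shift_nonneg (q * 'X + c%:P); first by move=> i; apply: pos; rewrite k0.
  by exists 0%N; split => // i /andP[_ /pp].
have [||k1 [kn kp]] := IH k.-1 lq.
- by move=> i ik; rewrite qE; apply: neg; lia.
- by move=> i ik; rewrite qE; apply: pos; lia.
have big i : (size q <= i)%N -> (shift q)`_i = 0 by move=> h; rewrite nth_default ?size_shift.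
have top : 0 < (shift q)`_(size q).-1 by rewrite lead_shift.
have kps i : (k1 < i)%N -> 0 <= (shift q)`_i.
  move=> ki; have [h|h] := ltnP i (size q); first by rewrite ltW// kp ?ki.
  by rewrite big.
have sneg i : (shift q)`_i < 0 -> s * (shift q)`_i < 0 by rewrite pmulr_rlt0.
have spos i : (k1 < i)%N -> 0 <= s * (shift q)`_i.
  by move=> /kps; rewrite pmulr_rge0.
have [qk|qk] := leP 0 ((shift q)`_k1).
  exists k1; split => i ik; rewrite coef_shiftMXaddC.
    have h := sneg _ (kn _ ik); case: i ik h => [|i] ik h /=; first by lra.
    have := kn i (ltnW ik); lra.
  case: i ik => // i; rewrite sp ltnS => /andP[ik isz].
  have h2 := spos i.+1 ik.
  have qi : 0 <= (shift q)`_i.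
    have [->//|nk] := eqVneq i k1; apply: kps; lia.
  (* At the top degree strictness comes from the leading coefficient, below it from the next
     coefficient. *)
  have [e|ne] := eqVneq i (size q).-1; first by move: top; rewrite -e; lra.
  suff : 0 < s * (shift q)`_i.+1 by lra.
  by rewrite mulr_gt0//; apply: kp; lia.
exists k1.+1; split => i ik; rewrite coef_shiftMXaddC.
  have h : s * (shift q)`_i < 0.
    by apply: sneg; have [->//|nk] := eqVneq i k1; apply: kn; lia.
  case: i ik h => [|i] ik h /=; first by lra.
  have := kn i ik; lra.
case: i ik => // i; rewrite sp !ltnS => /andP[ik isz].
have := spos i.+1 (leqW ik); have : 0 < (shift q)`_i by apply: kp; lia.
lra.
Qed.

End TaylorShift.

(** * Homogeneous substitution in polynomials *)

Section Homogeneous.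
Variable R : realFieldType.
Implicit Types X Y p q : {poly R}.

(* Coefficients of [p] above degree [N] are dropped. *)
Definition hom N X Y p := \sum_(i < N.+1) p`_i *: (X ^+ i * Y ^+ (N - i)).

Lemma homD N X Y p q : hom N X Y (p + q) = hom N X Y p + hom N X Y q.
Proof. by rewrite -big_split; apply: eq_bigr => i _; rewrite coefD scalerDl. Qed.

Lemma homZ N X Y a p : hom N X Y (a *: p) = a *: hom N X Y p.
Proof. by rewrite scaler_sumr; apply: eq_bigr => i _; rewrite coefZ scalerA. Qed.

Lemma hom_sum N X Y m (F : 'I_m -> {poly R}) :
  hom N X Y (\sum_i F i) = \sum_i hom N X Y (F i).
Proof.
elim/big_rec2: _ => [|i a b _ <-]; last by rewrite homD.
by rewrite /hom big1// => i _; rewrite coef0 scale0r.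
Qed.

Lemma hom_Xn N X Y i : (i <= N)%N -> hom N X Y 'X^i = X ^+ i * Y ^+ (N - i).
Proof.
rewrite -ltnS => iN; rewrite /hom (bigD1 (Ordinal iN))//= coefXn eqxx scale1r big1 ?addr0//.
by move=> j /negbTE; rewrite -val_eqE /= coefXn => ->; rewrite scale0r.
Qed.

Definition lin (a b : R) : {poly R} := a%:P + b *: 'X.

Lemma size_lin a b : (size (lin a b) <= 2)%N.
Proof.
apply: (leq_trans (size_polyD _ _)); rewrite geq_max.
rewrite (leq_trans (size_polyC_leq1 _))//=.
by rewrite (leq_trans (size_scale_leq _ _))// size_polyX.
Qed.

Lemma size_lin_exp a b m : (size (lin a b ^+ m)%R <= m.+1)%N.
Proof.
apply: leq_trans (size_poly_exp_leq _ _) _; rewrite ltnS -{2}(mul1n m) leq_mul2r.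
by rewrite -subn1 leq_subLR addn1 size_lin orbT.
Qed.

Lemma hom_step N X Y a b q : (size q <= N.+1)%N ->
  hom N.+1 X Y (lin a b * q) = (a *: Y + b *: X) * hom N X Y q.
Proof.
move=> sq; rewrite mulrDl mul_polyC -scalerAl homD !homZ mulrDl -!scalerAl.
congr (_ *: _ + _ *: _).
  rewrite {1}/hom big_ord_recr /= nth_default// scale0r addr0 mulr_sumr.
  apply: eq_bigr => i _; rewrite -scalerAr subSn -1?ltnS//.
  by congr (_ *: _); rewrite exprS; ring.
rewrite {1}/hom big_ord_recl /= coefXM eqxx scale0r add0r mulr_sumr.
apply: eq_bigr => i _; rewrite coefXM /= -scalerAr subSS; congr (_ *: _).
by rewrite exprS; ring.
Qed.

Lemma size_lin_prod a b c e i j :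
  (size (lin a b ^+ i * lin c e ^+ j)%R <= (i + j).+1)%N.
Proof.
apply: leq_trans (size_polyMleq _ _) _; rewrite -subn1 leq_subLR add1n.
by rewrite (leq_trans (leq_add (size_lin_exp a b i) (size_lin_exp c e j)))// addSn addnS.
Qed.

(** Homogenisation is multiplicative as long as the degrees add up, so linear factors can be
    substituted one at a time. *)
Lemma hom_lin X Y a b c e i j :
  hom (i + j) X Y (lin a b ^+ i * lin c e ^+ j) =
  (a *: Y + b *: X) ^+ i * (c *: Y + e *: X) ^+ j.
Proof.
elim: i => [|i IH].
  rewrite add0n !expr0 !mul1r; elim: j => [|j IH].
    by rewrite /hom big_ord1 !expr0 coef1 eqxx scale1r mulr1.
  by rewrite !exprS hom_step ?IH// size_lin_exp.
by rewrite addSn !exprS -!mulrA hom_step ?IH// size_lin_prod.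
Qed.

Lemma coef_hom1X N p j : (j <= N)%N -> (hom N 1 'X p)`_j = p`_(N - j).
Proof.
move=> jN; have jN' : (N - j < N.+1)%N by lia.
rewrite /hom coef_sum (bigD1 (Ordinal jN'))//= expr1n mul1r coefZ coefXn subKn// eqxx mulr1.
rewrite big1 ?addr0// => i ij; rewrite expr1n mul1r coefZ coefXn.
case: eqP => [jE|_]; rewrite ?mulr0//; case/eqP: ij; apply: val_inj => /=.
have := ltn_ord i; lia.
Qed.

Lemma coef_homcX N (a : R) p j : (j <= N)%N ->
  (hom N a%:P 'X p)`_j = a ^+ (N - j) * p`_(N - j).
Proof.
move=> jN; have jN' : (N - j < N.+1)%N by lia.
rewrite /hom coef_sum (bigD1 (Ordinal jN'))//= -polyC_exp mul_polyC !coefZ coefXn subKn// eqxx mulr1.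
rewrite mulrC big1 ?addr0// => i ij; rewrite -polyC_exp mul_polyC !coefZ coefXn.
case: eqP => [jE|_]; rewrite ?mulr0//; case/eqP: ij; apply: val_inj => /=.
have := ltn_ord i; lia.
Qed.

Lemma coef_scale_sum m (F : 'I_m -> R) (P : 'I_m -> {poly R}) j :
  (\sum_i F i *: P i)`_j = \sum_i F i * (P i)`_j.
Proof. by rewrite coef_sum; apply: eq_bigr => i _; rewrite coefZ. Qed.

End Homogeneous.

(** * Sign changes under a Moebius substitution *)

Section Moebius.
Variables (R : realFieldType) (n : nat) (s : R).
Hypotheses (s0 : 0 < s) (s1 : s < 1).
Implicit Type p : {poly R}.
Notation shift p := (p \Po ('X + s%:P)).

Lemma poly_sum_Xn p : (size p <= n.+1)%N -> p = \sum_(i < n.+1) p`_i *: 'X^i.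
Proof.
move=> sp; rewrite -[LHS]coefK poly_def (big_ord_widen _ (fun i => p`_i *: 'X^i) sp).
rewrite big_mkcond /=; apply: eq_bigr => i _; case: ltnP => // ?.
by rewrite nth_default// scale0r.
Qed.

(* The substitution (x, y) -> (x + s y, s x + y) factors as the shift x -> x + s y,
   a positive rescaling of x, and the shift y -> y + s x. *)
Lemma coef_moebius p l : (size p <= n.+1)%N -> (l <= n)%N ->
  (hom n (lin s 1) (lin 1 s) p)`_l =
  (shift (hom n (1 - s ^+ 2)%:P 'X (shift p)))`_(n - l).
Proof.
move=> sp ln; rewrite -{1}(subKn ln) -coef_hom1X ?leq_subr//; congr (polyseq _)`_(_).
have shift_sum m (F : 'I_m -> {poly R}) : shift (\sum_i F i) = \sum_i shift (F i).
  exact: (raddf_sum (comp_poly ('X + s%:P))).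
rewrite (poly_sum_Xn sp) (shift_sum _ (fun i : 'I_n.+1 => p`_i *: 'X^i)).
rewrite (hom_sum n (lin s 1)) (hom_sum n 1 'X) (hom_sum n (1 - s ^+ 2)%:P) shift_sum.
(* By linearity a monomial [X^i] remains; after reversal both sides are
   [(1 + s X)^i (X + s)^(n - i)]. *)
apply: eq_bigr => i _.
have iN : (i <= n)%N by rewrite -ltnS.
rewrite !(homZ, comp_polyZ) hom_Xn//; congr (_ *: _).
have e1 := hom_lin 1 'X s 1 1 s i (n - i); rewrite subnKC// in e1; rewrite e1.
rewrite comp_Xn_poly.
have linE : ('X + s%:P : {poly R}) = lin s 1 by rewrite /lin scale1r addrC.
rewrite {2}linE.
have e2 := hom_lin (1 - s ^+ 2)%:P 'X s 1 1 0 i (n - i); rewrite subnKC// in e2.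
have l10 : lin 1 0 = 1 :> {poly R} by rewrite /lin scale0r addr0.
rewrite l10 expr1n mulr1 in e2; rewrite e2.
have shiftX q m : shift (q ^+ m) = shift q ^+ m.
  by elim: m => [|m IH]; rewrite ?expr0 ?comp_polyC// !exprS comp_polyM IH.
rewrite comp_polyM !shiftX !scale1r scale0r addr0 comp_polyD comp_polyZ comp_polyX comp_polyC.
congr (_ ^+ _ * _ ^+ _); rewrite /lin -?mul_polyC.
by rewrite expr2 polyCB polyCM; ring.
by rewrite mulr1.
Qed.

Lemma shiftN p : shift (- p) = - shift p.
Proof. exact: (raddfN (comp_poly ('X + s%:P))). Qed.

Lemma size_homcX a p : (size (hom n a%:P 'X p) <= n.+1)%N.
Proof.
apply/leq_sizeP => j jn; rewrite /hom coef_sum big1// => i _.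
rewrite -polyC_exp mul_polyC !coefZ coefXn; have := ltn_ord i.
by case: eqP => [|_ _]; rewrite ?mulr0//; lia.
Qed.

(** Each shift is strict only below the degree of its argument, so the degree of the reversed
    polynomial [q] has to be controlled. The cases are: [p] without positive coefficient, the first
    shift without negative one, and a genuine change, which is read on [- q] because reversal
    exchanges its two sides. *)
Lemma moebius_one_change p k : p != 0 -> (size p <= n.+1)%N ->
  (forall i, (i < k)%N -> p`_i <= 0) -> (forall i, (k <= i)%N -> 0 <= p`_i) ->
  exists k', forall i, (i <= n)%N ->
    ((i < k')%N -> (hom n (lin s 1) (lin 1 s) p)`_i < 0) /\
    ((k' < i)%N -> 0 < (hom n (lin s 1) (lin 1 s) p)`_i).
Proof.
move=> p0 sp neg pos; set q := hom n (1 - s ^+ 2)%:P 'X (shift p).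
suff [k' kP] : exists k', forall i, (i <= n)%N ->
    ((n - i < k')%N -> (shift q)`_i < 0) /\ ((k' < n - i)%N -> 0 < (shift q)`_i).
  exists k' => i iN; rewrite coef_moebius//; have := kP (n - i)%N (leq_subr _ _).
  by rewrite subKn.
have a0 : 0 < 1 - s ^+ 2 by rewrite subr_gt0 expr_lt1 ?ltW.
have qE j : (j <= n)%N -> q`_j = (1 - s ^+ 2) ^+ (n - j) * (shift p)`_(n - j).
  by move=> jn; rewrite coef_homcX.
have sq : (size q <= n.+1)%N by exact: size_homcX.
have q_gt0 j : (j <= n)%N -> (0 < q`_j) = (0 < (shift p)`_(n - j)).
  by move=> jn; rewrite qE// pmulr_rgt0// exprn_gt0.
have q_lt0 j : (j <= n)%N -> (q`_j < 0) = ((shift p)`_(n - j) < 0).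
  by move=> jn; rewrite qE// pmulr_rlt0// exprn_gt0.
have q_big j : (n < j)%N -> q`_j = 0 by move=> jn; rewrite nth_default// (leq_trans sq).
have q_ge0 j : (j <= n)%N -> (0 <= q`_j) = (0 <= (shift p)`_(n - j)).
  by move=> jn; rewrite !leNgt q_lt0.
have q_le0 j : (j <= n)%N -> (q`_j <= 0) = ((shift p)`_(n - j) <= 0).
  by move=> jn; rewrite !leNgt q_gt0.
have size_ge j : q`_j != 0 -> (j < size q)%N.
  by apply: contraR; rewrite -leqNgt => /leq_sizeP-> //.
have spp : (0 < size p)%N by rewrite size_poly_gt0.
have [lp|lp] := leP (lead_coef p) 0.
  have lp0 : lead_coef p != 0 by rewrite lead_coef_eq0.
  have szk : (size p <= k)%N.
    rewrite leqNgt; apply/negP => kp; move: lp0; rewrite eq_le lp.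
    by rewrite lead_coefE pos//; lia.
  have np i : 0 <= (- p)`_i.
    rewrite coefN oppr_ge0; have [ik|ki] := ltnP i k; first exact: neg.
    by rewrite nth_default// (leq_trans szk).
  have [nn pp] := shift_nonneg s0 np; rewrite shiftN size_polyN in nn pp.
  have nq i : 0 <= (- q)`_i.
    rewrite coefN oppr_ge0; have [iN|iN] := leqP i n; last by rewrite q_big.
    by rewrite q_le0// -oppr_ge0 -coefN.
  have [_ ppq] := shift_nonneg s0 nq; rewrite shiftN size_polyN in ppq.
  have szq : (n < size q)%N.
    by apply: size_ge; rewrite lt_eqF// q_lt0// subnn -oppr_gt0 -coefN pp.
  exists n.+1 => i iN; split=> [_|]; last by lia.
  by rewrite -oppr_gt0 -coefN ppq// (leq_trans _ szq).
have [k1 [kn kp]] := shift_one_change s0 lp neg pos.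
have kps i : (k1 < i)%N -> 0 <= (shift p)`_i.
  move=> ki; have [isz|isz] := ltnP i (size p); first by rewrite ltW// kp ?ki.
  by rewrite nth_default// size_shift.
have [p10|p10] := leP 0 (shift p)`_0.
  have k10 : k1 = 0%N by case: k1 kn {kp kps} => // k1 /(_ 0%N isT); rewrite ltNge p10.
  have nq i : 0 <= q`_i.
    have [iN|iN] := leqP i n; last by rewrite q_big.
    rewrite q_ge0//; have [->|ni] := eqVneq (n - i)%N 0%N; first by [].
    by apply: kps; lia.
  have [_ ppq] := shift_nonneg s0 nq.
  (* The coefficient of [q] at degree [n] may vanish here; only index 0 of the result depends on it,
     and that index is left free. *)
  have szq : (n <= size q)%N.
    have [sp1|sp1] := leqP (size p) 1.
      rewrite ltnW// size_ge// gt_eqF// q_gt0// subnn.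
      by move: lp; rewrite -(lead_shift s); have -> : (size p).-1 = 0%N by lia.
    have [->//|n0] := posnP n.
    have : (n.-1 < size q)%N.
      apply: size_ge; rewrite gt_eqF// q_gt0 ?leq_pred//.
      have -> : (n - n.-1 = 1)%N by lia.
      by rewrite kp// k10.
    by rewrite prednK.
  exists 0%N => i iN; split=> // ni; apply: ppq; lia.
have szq : size q = n.+1.
  by apply/eqP; rewrite eqn_leq sq size_ge// lt_eqF// q_lt0// subnn.
have lq : 0 < lead_coef (- q).
  by rewrite lead_coefN lead_coefE szq /= oppr_gt0 q_lt0// subnn.
(* The place of the change after reversal; the undetermined coefficient at [k1] joins the side that
   its sign allows. *)
pose k2 := if 0 <= (shift p)`_k1 then (n - k1).+1 else (n - k1)%N.
have k1n : (k1 <= n)%N.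
  rewrite leqNgt; apply/negP => h; have := kn (size p).-1.
  suff -> : ((size p).-1 < k1)%N by move=> /(_ isT); rewrite lead_shift ltNge ltW.
  lia.
have [||k3 [k3n k3p]] := @shift_one_change _ s s0 (- q) k2 lq.
- move=> i; rewrite coefN oppr_le0 /k2; case: leP => h ik.
    rewrite q_ge0; last by lia.
    have [->//|ni] := eqVneq (n - i)%N k1; apply: kps; lia.
  rewrite q_ge0; last by lia.
  apply: kps; lia.
- move=> i; rewrite coefN oppr_ge0; have [iN|iN] := leqP i n; last by rewrite q_big.
  rewrite q_le0// /k2; case: leP => h ik; first by rewrite ltW// kn//; lia.
  have [->|ni] := eqVneq (n - i)%N k1; first exact: ltW.
  by rewrite ltW// kn//; lia.
exists (n - k3)%N => i iN; rewrite shiftN size_polyN in k3n k3p; split => ik.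
  by rewrite -oppr_gt0 -coefN k3p// szq; lia.
by rewrite -oppr_lt0 -coefN k3n//; lia.
Qed.

End Moebius.

(** * Krawtchouk coordinates and the flow *)

Section Coordinates.
Variables (R : realFieldType) (n : nat).
Notation d := n.+1.
Implicit Types (y c : 'I_d -> R) (i j : 'I_d).

Definition bin (i : nat) : R := 'C(n, i)%:R.

(* The Krawtchouk polynomials: their coefficient matrix squares to [2 ^ n]. *)
Definition kraw (j : nat) : {poly R} := lin 1 1 ^+ (n - j) * lin 1 (-1) ^+ j.

(** Coordinates, in the basis [kraw j], of the polynomial with coefficients [bin i * y i]; [ksy] is
    the inverse transform. *)
Definition kco y j : R := (2 ^+ n)^-1 * \sum_(i < d) bin i * y i * (kraw i)`_j.

Definition ksy c i : R := (\sum_(j < d) c j * (kraw j)`_i) / bin i.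

Lemma binR_gt0 i : 0 < bin i.
Proof. by rewrite ltr0n bin_gt0 -ltnS. Qed.

Lemma lin_comm_kraw (j : nat) : lin 1 (-1) ^+ j * lin 1 1 ^+ (n - j) = kraw j.
Proof. by rewrite mulrC. Qed.

Lemma size_kraw j : (size (kraw j) <= d)%N.
Proof. by have := size_lin_prod 1 1 1 (-1 : R) (n - j) j; rewrite subnK -1?ltnS. Qed.

Lemma hom_kraw X Y j :
  hom n X Y (kraw j) = (Y + X) ^+ (n - j) * (Y - X) ^+ j.
Proof.
have := hom_lin X Y 1 1 1 (-1) (n - j) j.
by rewrite subnK -1?ltnS// !scale1r scaleN1r.
Qed.

(** Substitute [1 - X] and [1 + X] in the homogenised [kraw i]: the sum of the two forms is 2 and
    their difference is [2 X]. *)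
Lemma kraw_invol i : \sum_(j < d) (kraw i)`_j *: kraw j = (2 ^+ n) *: 'X^i.
Proof.
have := hom_kraw (lin 1 (-1)) (lin 1 1) i.
rewrite /hom; under eq_bigr do rewrite lin_comm_kraw; move=> ->.
have -> : lin 1 1 + lin 1 (-1) = 2%:P :> {poly R} by rewrite /lin -!mul_polyC; ring.
have -> : lin 1 1 - lin 1 (-1) = 2%:P * 'X :> {poly R}.
  by rewrite /lin -!mul_polyC; ring.
by rewrite exprMn mulrA -exprD subnK -1?ltnS// -polyC_exp mul_polyC.
Qed.

Lemma kraw_orth i (l : 'I_d) : \sum_(j < d) (kraw i)`_j * (kraw j)`_l = 2 ^+ n * (i == l)%:R.
Proof.
have /(congr1 (fun p : {poly R} => p`_l)) := kraw_invol i.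
by rewrite coef_scale_sum coefZ coefXn -val_eqE eq_sym.
Qed.

Lemma two_n_neq0 : (2 ^+ n : R) != 0.
Proof. by rewrite expf_neq0// pnatr_eq0. Qed.

Lemma ksyK c j : kco (ksy c) j = c j.
Proof.
rewrite /kco /ksy.
under eq_bigr => i _ do rewrite mulrCA divff ?gt_eqF ?binR_gt0// mulr1 mulr_suml.
rewrite exchange_big /=.
under eq_bigr => i _.
  under eq_bigr => l _ do rewrite -mulrA.
  rewrite -mulr_sumr kraw_orth.
  over.
rewrite (bigD1 j)//= eqxx mulr1 big1 ?addr0 => [|i /negbTE->]; last by rewrite !mulr0.
by rewrite mulrCA mulVf ?mulr1// two_n_neq0.
Qed.

Lemma kcoK y i : ksy (kco y) i = y i.
Proof.
rewrite /kco /ksy.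
under eq_bigr => j _ do rewrite -mulrA mulr_suml.
rewrite -mulr_sumr exchange_big /=.
under eq_bigr => l _.
  under eq_bigr => j _ do rewrite -mulrA.
  rewrite -mulr_sumr kraw_orth.
  over.
rewrite (bigD1 i)//= eqxx mulr1 big1 ?addr0 => [|l /negbTE->]; last by rewrite !mulr0.
have b := binR_gt0 i; have t := two_n_neq0; field; rewrite ?t ?gt_eqF//.
Qed.

Lemma kco_lin a b y y' j :
  kco (fun i => a * y i + b * y' i) j = a * kco y j + b * kco y' j.
Proof.
rewrite /kco (mulrCA a) (mulrCA b) -mulrDr; congr (_ * _).
rewrite !mulr_sumr -big_split /=.
by apply: eq_bigr => i _; ring.
Qed.

Lemma eq_kco y y' : y =1 y' -> kco y =1 kco y'.
Proof. by move=> e j; rewrite /kco; under eq_bigr do rewrite e. Qed.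

Lemma eq_ksy c c' : c =1 c' -> ksy c =1 ksy c'.
Proof. by move=> e j; rewrite /ksy; under eq_bigr do rewrite e. Qed.

Lemma coef0_lin_exp (b : R) m : (lin 1 b ^+ m)`_0 = 1.
Proof.
elim: m => [|m IH]; first by rewrite expr0 coef1.
by rewrite exprS coef0M IH /lin coefD coefC coefZ coefX mulr0 addr0 mulr1.
Qed.

Lemma coef1_lin_exp (b : R) m : (lin 1 b ^+ m)`_1 = m%:R * b.
Proof.
elim: m => [|m IH]; first by rewrite expr0 coef1 mul0r.
rewrite exprS coefM big_ord_recl big_ord1 /= IH coef0_lin_exp /lin !coefD !coefC !coefZ !coefX /=.
by rewrite mulrS; ring.
Qed.

Lemma kraw_coef0 (j : nat) : (kraw j)`_0 = 1.
Proof. by rewrite /kraw coef0M !coef0_lin_exp mulr1. Qed.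

Lemma kraw_coef1 j : (kraw j)`_1 = n%:R - 2 * j%:R.
Proof.
rewrite /kraw coefM big_ord_recl big_ord1 /= !coef0_lin_exp !coef1_lin_exp natrB -1?ltnS//.
by ring.
Qed.

Lemma kraw0E i : (kraw 0)`_i = bin i.
Proof.
rewrite /kraw expr0 mulr1 subn0 /lin scale1r /bin.
elim: (n) (i : nat) => [|m IH] l; first by rewrite expr0 coef1 bin0n.
by rewrite exprS mulrDl mul1r coefD coefXM !IH; case: l => [|l]; rewrite ?bin0 ?addr0// binS natrD.
Qed.

(** With [f = (1 + X)^n], both sides come from [n (1 + X)^(n-1) (1 - X) = n f - 2 X f']; the factor
    [n] avoids a division. *)
Lemma kraw1E i : n%:R * (kraw 1)`_i = bin i * (n%:R - 2 * i%:R).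
Proof.
case: (posnP n) => [n0|n0].
  by have := ltn_ord i; rewrite {2}n0 ltnS leqn0 => /eqP ->; rewrite n0; ring.
have -> : n%:R * (kraw 1)`_i = (n%:R *: kraw 0 - 2 *: ('X * (kraw 0)^`()))`_i.
  rewrite -coefZ; congr (polyseq _)`_(_).
  rewrite /kraw !expr0 !mulr1 expr1 subn0 deriv_exp.
  have -> : (lin 1 1)^`() = 1 :> {poly R}.
    by rewrite /lin derivD derivC derivZ derivX scale1r add0r.
  have -> : lin 1 1 ^+ n = lin 1 1 * lin 1 1 ^+ n.-1 :> {poly R}.
    by rewrite -exprS prednK.
  rewrite mul1r subn1 -!mul_polyC -mulr_natl !polyC_natr.
  by rewrite /lin -!mul_polyC; ring.
rewrite coefB !coefZ coefXM kraw0E.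
case: i => m iP /=; case: m iP => [|m] iP /=; first by ring.
have -> : ((kraw 0)^`())`_m = bin m.+1 * m.+1%:R.
  by rewrite coef_deriv (kraw0E (Ordinal iP)) mulr_natr.
by ring.
Qed.

End Coordinates.

(** * The flow and the number of sign changes *)

Section Flow.
Variables (R : realFieldType) (n : nat).
Notation d := n.+1.
Implicit Types (y c : 'I_d -> R) (i j : 'I_d) (b : bool).

Definition sgb b : R := (-1) ^+ b.

Lemma sgbT : sgb true = -1. Proof. by rewrite /sgb expr1. Qed.
Lemma sgbF : sgb false = 1. Proof. by rewrite /sgb expr0. Qed.

Lemma sgb_addb b b' : sgb (b (+) b') = sgb b * sgb b'.
Proof. by rewrite /sgb signr_addb. Qed.

Lemma sgbN b : sgb (~~ b) = - sgb b.
Proof. by rewrite /sgb signrN. Qed.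

Lemma sgbK b (x : R) : sgb b * (sgb b * x) = x.
Proof. by rewrite /sgb signrMK. Qed.

Lemma norm_sgb b (x : R) : `|sgb b * x| = `|x|.
Proof. by rewrite /sgb normrMsign. Qed.

Lemma sgb_eq0 b (x : R) : (sgb b * x == 0) = (x == 0).
Proof. by rewrite mulf_eq0 signr_eq0. Qed.

Lemma sgb_agree b b' (x : R) : 0 <= sgb b * x -> 0 <= sgb b' * x -> b != b' -> x = 0.
Proof. by case: b; case: b' => //; rewrite /sgb ?expr0 ?expr1 ?mul1r; lra. Qed.

Lemma sgb_lt0 (x : R) : 0 <= sgb (x < 0) * x.
Proof. by case: ltP; rewrite /sgb ?expr0 ?expr1; lra. Qed.

Lemma sgb_neg b b' (x : R) : sgb b * x < 0 -> 0 <= sgb b' * x -> b' = ~~ b.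
Proof. by case: b; case: b' => //; rewrite /sgb ?expr0 ?expr1 ?mul1r; lra. Qed.

Lemma sgb_pos b b' (x : R) : 0 < sgb b * x -> 0 <= sgb b' * x -> b' = b.
Proof. by case: b; case: b' => //; rewrite /sgb ?expr0 ?expr1 ?mul1r; lra. Qed.

(** Zero entries fit either sign, so [inA] and [inB] are closed conditions that overlap; their
    overlap is where discs and collar are glued. *)
Definition inA y := exists k, forall i, 0 <= sgb (rho k i) * y i.
Definition inB y := exists2 s : 'I_d -> bool, alt s & forall i, 0 <= sgb (s i) * y i.

Lemma AorB y : inA y \/ inB y.
Proof.
pose s i := y i < 0; have sP i : 0 <= sgb (s i) * y i by exact: sgb_lt0.
case: (boolP (alt s)) => [as_|/noalt_rho[k _ sk]]; first by right; exists s.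
by left; exists k => i; rewrite -sk.
Qed.

(** The entry at [k] is left free, and [k] may lie beyond the last colour: this is the exact output
    of the strict diminution. *)
Definition one_change k y := forall i,
  ((i < k)%N -> y i < 0) /\ ((k < i)%N -> 0 < y i).

Lemma one_change_inA b k y : one_change k (fun i => sgb b * y i) -> inA y.
Proof.
(* The free entry, if there is one, joins the side that its sign allows. *)
move=> oc; pose k' : nat := if boolP (k < d)%N is AltTrue kd then
  (if sgb b * y (Ordinal kd) <= 0 then k.+1 else k) else k.
pose s i := b (+) (i < k')%N.
have [//|k2 _ kP] := @noalt_rho _ s.
  rewrite /s alt_addb; apply/existsP => -[i /existsP[j /existsP[l /and4P[ij jl]]]].
  case: (ltnP i k'); case: (ltnP j k'); case: (ltnP l k') => //=; lia.
exists k2 => i; rewrite -kP /s.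
have [h1 h2] := oc i.
have key : (i < k')%N -> sgb b * y i <= 0.
  rewrite /k'; case: {-}_ / boolP => kd; last by move=> ik; rewrite ltW// h1.
  case: ifP => h ik; last by rewrite ltW// h1.
  have [e|ne] := eqVneq (i : nat) k; last by rewrite ltW// h1//; lia.
  by rewrite (_ : i = Ordinal kd)//; exact: val_inj.
have key2 : (k' <= i)%N -> 0 <= sgb b * y i.
  rewrite /k'; case: {-}_ / boolP => kd; last by move: kd (ltn_ord i); lia.
  case: ifP => h ik; first by rewrite ltW// h2.
  have [e|ne] := eqVneq (i : nat) k; last by rewrite ltW// h2//; lia.
  by rewrite (_ : i = Ordinal kd)//; [rewrite ltW// ltNge h | exact: val_inj].
case: ltnP => ik; rewrite ?addbT ?addbF ?sgbN ?mulNr; first by rewrite oppr_ge0 key.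
exact: key2.
Qed.

(** In an alternating triple the middle index would have to be [k], since otherwise two neighbours
    lie strictly on one side; but then the outer two have opposite signs, and the middle one cannot
    differ from both. *)
Lemma one_change_notB b k y : one_change k (fun i => sgb b * y i) -> ~ inB y.
Proof.
move=> oc [s /existsP[i /existsP[j /existsP[l /and4P[ij jl sij sjl]]]] sP].
have neg (m : 'I_d) : (m < k)%N -> s m = ~~ b.
  by case: (oc m) => h _ /h /sgb_neg; apply.
have pos (m : 'I_d) : (k < m)%N -> s m = b.
  by case: (oc m) => _ h /h /sgb_pos; apply.
case: (ltngtP j k) => jk.
- by rewrite !neg ?eqxx// in sij; lia.
- by rewrite !pos ?eqxx// in sjl; lia.
- move: sij sjl; rewrite (neg i) -?jk// (pos l) -?jk//; by case: (s j); case: (b).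
Qed.

Definition flow (r : R) y : 'I_d -> R := ksy (fun j : 'I_d => r ^+ j * kco y j).

Lemma kco_flow r y j : kco (flow r y) j = r ^+ j * kco y j.
Proof. exact: ksyK. Qed.

Lemma flowE y y' r : (forall j, kco y' j = r ^+ j * kco y j) -> y' =1 flow r y.
Proof. by move=> h i; rewrite -[LHS]kcoK; apply: eq_ksy => j; rewrite h. Qed.

Lemma eq_flow r y y' : y =1 y' -> flow r y =1 flow r y'.
Proof. by move=> e; apply: flowE => j; rewrite kco_flow; congr (_ * _); apply: eq_kco. Qed.

Lemma flow_flow r r' y : flow r (flow r' y) =1 flow (r * r') y.
Proof. by apply: flowE => j; rewrite !kco_flow exprMn mulrA. Qed.

Lemma flow1 y : flow 1 y =1 y.
Proof. by move=> i; rewrite -[RHS]kcoK; apply: eq_ksy => j; rewrite expr1n mul1r. Qed.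

Lemma flowZ r a y : flow r (fun i => a * y i) =1 (fun i => a * flow r y i).
Proof.
move=> i; apply/esym; apply: (flowE (y' := fun i => a * flow r y i)) => j.
have E := kco_lin a 0 (flow r y) y j; have E' := kco_lin a 0 y y j.
rewrite !mul0r !addr0 in E E'.
rewrite (eq_kco (y' := fun i => a * flow r y i + 0 * y i)); last by move=> ?; rewrite mul0r addr0.
rewrite (eq_kco (y := fun i => a * y i) (y' := fun i => a * y i + 0 * y i)); last by move=> ?; rewrite mul0r addr0.
by rewrite !kco_lin !mul0r !addr0 kco_flow mulrCA.
Qed.

Definition gen y : {poly R} := \sum_(i < d) (bin R n i * y i) *: 'X^i.

Lemma coef_gen y i : (gen y)`_i = bin R n i * y i.
Proof.
rewrite coef_scale_sum (bigD1 i)//= coefXn eqxx mulr1 big1 ?addr0// => j ji.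
by rewrite coefXn eq_sym val_eqE (negbTE ji) mulr0.
Qed.

Lemma coef_gen_big y m : (n < m)%N -> (gen y)`_m = 0.
Proof.
move=> nm; rewrite coef_scale_sum big1// => j _; rewrite coefXn.
by case: eqP => [jm|]; rewrite ?mulr0//; have := ltn_ord j; lia.
Qed.

Lemma size_gen y : (size (gen y) <= d)%N.
Proof. by apply/leq_sizeP => j; exact: coef_gen_big. Qed.

Lemma gen_kraw y : gen y = \sum_(j < d) kco y j *: kraw R n j.
Proof.
apply/polyP => m; rewrite [RHS]coef_scale_sum; have [md|md] := ltnP m d; last first.
  rewrite coef_gen_big// big1// => j _; rewrite nth_default ?mulr0//.
  exact: leq_trans (size_kraw _ j) md.
have := coef_gen y (Ordinal md); rewrite -{1}[y (Ordinal md)]kcoK /ksy /= => ->.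
by rewrite mulrC divfK// gt_eqF// (binR_gt0 _ (Ordinal md)).
Qed.

(* On generating polynomials the flow is a Moebius substitution, whose effect on
   sign changes is that of two Taylor shifts. *)
Lemma gen_flow r y : 0 < 1 + r ->
  gen (flow r y) = ((1 + r) / 2) ^+ n *:
    hom n (lin ((1 - r) / (1 + r)) 1) (lin 1 ((1 - r) / (1 + r))) (gen y).
Proof.
move=> r1; rewrite !gen_kraw (hom_sum n (lin _ _)) scaler_sumr; apply: eq_bigr => j _.
rewrite kco_flow homZ hom_kraw scalerA; set s := (1 - r) / (1 + r).
(* The forms [1 + X] and [1 - X] are eigenvectors of the substitution, with eigenvalues [1 + s] and
   [1 - s]; the second divided by the first is [r]. *)
have -> : lin 1 s + lin s 1 = (1 + s) *: lin 1 1 :> {poly R}.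
  by rewrite /lin -!mul_polyC !polyCD; ring.
have -> : lin 1 s - lin s 1 = (1 - s) *: lin 1 (-1) :> {poly R}.
  by rewrite /lin -!mul_polyC !polyCB !polyCN; ring.
rewrite (exprZn (1 + s)) (exprZn (1 - s)).
rewrite -(@scalerAl _ {poly R}) -(@scalerAr _ {poly R}) !(@scalerA _ {poly R}); congr (_ *: _).
have e1 : (1 + r) / 2 * (1 + s) = 1 by rewrite /s; field; rewrite gt_eqF.
have e2 : (1 + r) / 2 * (1 - s) = r by rewrite /s; field; rewrite gt_eqF.
have sp : ((1 + r) / 2) ^+ n = ((1 + r) / 2) ^+ (n - j) * ((1 + r) / 2) ^+ j.
  by rewrite -exprD subnK// -ltnS.
rewrite sp -{1}e2 exprMn.
have e3 : ((1 + r) / 2) ^+ (n - j) * (1 + s) ^+ (n - j) = 1 by rewrite -exprMn e1 expr1n.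
by rewrite -[LHS]mul1r -{1}e3; ring.
Qed.

Lemma flow_strict r y : 0 < r -> r < 1 -> inA y -> (exists i, y i != 0) ->
  exists b k, one_change k (fun i => sgb b * flow r y i).
Proof.
move=> r0 r1 [k kP] [i0 yi0]; pose b := odd (k %/ d); exists b.
have s0 : 0 < (1 - r) / (1 + r) by rewrite divr_gt0//; lra.
have s1 : (1 - r) / (1 + r) < 1 by rewrite ltr_pdivrMr; lra.
pose y' i := sgb b * y i.
have [||||k' k'P] := @moebius_one_change _ n _ s0 s1 (gen y') (k %% d).+1.
- apply/eqP => /(congr1 (fun p : {poly R} => p`_i0)); rewrite coef_gen coef0 => /eqP.
  by rewrite mulf_eq0 gt_eqF ?binR_gt0//= sgb_eq0 (negbTE yi0).
- exact: size_gen.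
- move=> m mk; have md : (m < d)%N by rewrite (leq_trans mk)// ltn_pmod.
  rewrite (coef_gen y' (Ordinal md)) pmulr_rle0 ?binR_gt0// /y'.
  have := kP (Ordinal md); rewrite /rho /= -ltnS mk sgb_addb /b /sgb expr1.
  by rewrite mulrN1 mulNr oppr_ge0.
- move=> m mk; have [md|md] := ltnP m d; last by rewrite coef_gen_big.
  rewrite (coef_gen y' (Ordinal md)) pmulr_rge0 ?binR_gt0// /y'.
  by have := kP (Ordinal md); rewrite /rho /= leqNgt mk addbF.
exists k' => i; have := gen_flow y' (_ : 0 < 1 + r); rewrite addr_gt0// => /(_ isT).
move=> /(congr1 (fun p : {poly R} => p`_i)); rewrite coefZ coef_gen.
set c := _ ^+ n; have c0 : 0 < c by rewrite exprn_gt0// divr_gt0// addr_gt0.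
have [h1 h2] := k'P i (ltn_ord i); have b0 := binR_gt0 R i.
rewrite (flowZ r (sgb b) y i) => E.
split=> [/h1|/h2] h.
  by rewrite -(pmulr_rlt0 _ b0) E pmulr_rlt0.
by rewrite -(pmulr_rgt0 _ b0) E pmulr_rgt0.
Qed.

End Flow.

(** * Affine vectors and the flow near time 0 *)

Section FlowEnds.
Variables (R : realFieldType) (n : nat).
Hypothesis n_gt0 : (0 < n)%N.
Notation d := n.+1.
Implicit Types (y c : 'I_d -> R) (i j : 'I_d).

Definition ord1' : 'I_d := Ordinal (n_gt0 : 1 < d)%N.

Definition affine y := exists a b : R, forall i, y i = a + b * i%:R.

Lemma kco0E y : 2 ^+ n * kco y ord0 = \sum_(i < d) bin R n i * y i.
Proof.
rewrite /kco mulrA divff ?two_n_neq0// mul1r; apply: eq_bigr => i _.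
by rewrite kraw_coef0 mulr1.
Qed.

Lemma kco1E y : 2 ^+ n * kco y ord1' = \sum_(i < d) bin R n i * y i * (n%:R - 2 * i%:R).
Proof.
rewrite /kco mulrA divff ?two_n_neq0// mul1r; apply: eq_bigr => i _.
by rewrite kraw_coef1.
Qed.

(** The affine factor [2 (i - K) - 1] changes sign exactly where [rho k] does, so weighting [y] with
    it gives terms of one sign. Their sum combines the two vanishing moments, hence is 0, and every
    term vanishes. *)
Lemma kernel_notA y : kco y ord0 = 0 -> kco y ord1' = 0 -> (exists i, y i != 0) -> ~ inA y.
Proof.
move=> k0 k1 [i0 yi0] [k kP].
have s0 := kco0E y; have s1 := kco1E y; rewrite k0 k1 mulr0 in s0 s1.
pose K : R := (k %% d)%:R; pose b := odd (k %/ d).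
have t_ge0 i : 0 <= sgb R b * (bin R n i * y i * (2 * (i%:R - K) - 1)).
  have bi := binR_gt0 R i; have := kP i; rewrite /rho -/b sgb_addb mulrAC => kPi.
  have -> : sgb R b * (bin R n i * y i * (2 * (i%:R - K) - 1)) =
    bin R n i * (sgb R b * y i * (2 * (i%:R - K) - 1)) by ring.
  rewrite pmulr_rge0//; move: (sgb R b * y i) kPi => z.
  case: (leqP i (k %% d)) => ik; rewrite ?sgbT ?sgbF => h.
    have ik' : (i%:R : R) <= K by rewrite ler_nat.
    nra.
  have ik' : K + 1 <= (i%:R : R) by rewrite natr1 ler_nat.
  by rewrite mulr1 in h; apply: mulr_ge0 => //; lra.
have : \sum_(i < d) sgb R b * (bin R n i * y i * (2 * (i%:R - K) - 1)) = 0.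
  rewrite -mulr_sumr.
  have -> : \sum_(i < d) bin R n i * y i * (2 * (i%:R - K) - 1) =
     (n%:R - 2 * K - 1) * \sum_(i < d) bin R n i * y i -
     \sum_(i < d) bin R n i * y i * (n%:R - 2 * i%:R).
    by rewrite mulr_sumr -sumrB; apply: eq_bigr => i _; ring.
  by rewrite -s0 -s1; ring.
move/eqP; rewrite psumr_eq0// => /allP/(_ i0); rewrite mem_index_enum => /(_ isT) /=.
rewrite sgb_eq0 !mulf_eq0 gt_eqF ?binR_gt0// (negbTE yi0) /= => /eqP h.
case: (leqP i0 (k %% d)) => ik.
  have ik' : (i0%:R : R) <= K by rewrite ler_nat.
  lra.
have ik' : K + 1 <= (i0%:R : R) by rewrite natr1 ler_nat.
lra.
Qed.

Lemma ksy_low y : (forall j, (1 < j)%N -> kco y j = 0) ->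
  forall i, y i = kco y ord0 + kco y ord1' * (n%:R - 2 * i%:R) / n%:R.
Proof.
move=> h i; rewrite -{1}[y i]kcoK /ksy.
rewrite (bigD1 ord0)//= (bigD1 ord1')//= big1 ?addr0; last first.
  move=> j /andP[j0 j1]; rewrite h ?mul0r//.
  by move: j0 j1; rewrite -!val_eqE /=; lia.
have b0 := binR_gt0 R i; have nn : (n%:R : R) != 0 by rewrite pnatr_eq0 -lt0n.
have -> : (kraw R n 1)`_i = bin R n i * (n%:R - 2 * i%:R) / n%:R.
  by rewrite -kraw1E mulrC mulrA mulVf// mul1r.
rewrite kraw0E; field; by rewrite nn gt_eqF.
Qed.

Lemma kco_high_affine y : (forall j, (1 < j)%N -> kco y j = 0) <-> affine y.
Proof.
have nn : (n%:R : R) != 0 by rewrite pnatr_eq0 -lt0n.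
split=> [/ksy_low h|[a [b h]] j j1].
  exists (kco y ord0 + kco y ord1'), (- 2 * kco y ord1' / n%:R) => i.
  by rewrite h; field.
(* From [i = n / 2 - (n - 2 i) / 2], where [(n - 2 i) / n] is the vector of coordinate 1. *)
pose c j : R := if j == ord0 then a + b * n%:R / 2 else if j == ord1' then - b * n%:R / 2 else 0.
have j0 : (j == ord0) = false by rewrite -val_eqE /=; lia.
have j1' : (j == ord1') = false by rewrite -val_eqE /=; lia.
suff yc : y =1 ksy c by rewrite (eq_kco yc) ksyK /c j0 j1'.
move=> i; rewrite (@ksy_low (ksy c)); last first.
  move=> l l1; rewrite ksyK /c -!val_eqE /=.
  by case: l l1 => -[|[|l]].
rewrite !ksyK /c -!val_eqE /= h.
by field.
Qed.

(** For small [r] the first nonzero coordinate dominates: the vector is close to a constant one, or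
    else to a multiple of [n - 2 i], which changes sign once in the middle. All other terms are
    bounded through [M]. *)
Lemma small_flow y : kco y ord0 != 0 \/ kco y ord1' != 0 ->
  exists2 r, 0 < r <= 1 & inA (flow r y).
Proof.
pose T j i := kco y j * (kraw R n j)`_i.
pose M := \sum_(i < d) \sum_(j < d) `|T j i|.
have MT i : \sum_(j < d) `|T j i| <= M.
  rewrite /M [leRHS](bigD1 i)//= lerDl sumr_ge0// => l _; exact: sumr_ge0.
have M0 : 0 <= M by apply: sumr_ge0 => l _; exact: sumr_ge0.
have flE r i : bin R n i * flow r y i = \sum_(j < d) r ^+ j * T j i.
  rewrite /flow /ksy mulrC divfK ?gt_eqF ?binR_gt0//.
  by apply: eq_bigr => j _; rewrite /T mulrA.
have rest (P : pred 'I_d) (r : R) (e : 'I_d -> nat) i : 0 <= r <= 1 ->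
    (forall j, P j -> (0 < e j)%N) -> `|\sum_(j < d | P j) r ^+ e j * T j i| <= r * M.
  move=> /andP[r0 r1] Pe; apply: le_trans (ler_norm_sum _ _ _) _.
  apply: (@le_trans _ _ (\sum_(j < d | P j) r * `|T j i|)).
    apply: ler_sum => j /Pe ej; rewrite normrM ler_wpM2r// normrX ger0_norm//.
    by rewrite -(prednK ej) exprS ler_piMr// exprn_ile1.
  rewrite -mulr_sumr ler_wpM2l//; apply: le_trans _ (MT i).
  by rewrite [leRHS](bigID P)/= lerDl sumr_ge0.
have small (x : R) : 0 < x -> exists2 r : R, 0 < r <= 1 & r * M < x.
  move=> x0; have Mx : 0 < M + x + 1 by lra.
  exists (x / (M + x + 1)); first by rewrite divr_gt0//= ler_pdivrMr//; lra.
  rewrite mulrAC ltr_pdivrMr//; nra.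
case: (eqVneq (kco y ord0) 0) => [c0|c0 _].
  case=> [//|c1].
  have nR : 0 < (n%:R : R) by rewrite ltr0n.
  have [|r r01 rM] := small (`|kco y ord1'| / n%:R); first by rewrite divr_gt0// normr_gt0.
  have r0 : 0 < r by case/andP: r01.
  (* Since [n - 2 i] is positive first, the sign is negated. For even [n] its zero [n / 2] is the
     entry left free. *)
  exists r => //; apply: (@one_change_inA _ _ (~~ (kco y ord1' < 0)) (uphalf n)).
  have key i : 2 * i%:R != n%:R :> R ->
      0 < (sgb R (kco y ord1' < 0) * flow r y i) * (n%:R - 2 * i%:R).
    move=> ni; set D := n%:R - 2 * i%:R.
    have D1 : 1 <= D ^+ 2.
      have -> : D = (n%:Z - 2 * i%:Z)%:~R by rewrite /D intrB intrM.
      rewrite -rmorphXn /= ler1z; move: ni.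
      rewrite -subr_eq0 -(opprB n%:R) oppr_eq0 -/D.
      have -> : D = (n%:Z - 2 * i%:Z)%:~R by rewrite /D intrB intrM.
      by rewrite intr_eq0 => ?; nia.
    set S := \sum_(j < d | (j != ord0) && (j != ord1')) r ^+ j.-1 * T j i.
    have SM : `|S| <= r * M.
      apply: rest; first by case/andP: r01 => /ltW-> ->.
      by move=> j; rewrite -!val_eqE /=; lia.
    have E : bin R n i * flow r y i = r * (kco y ord1' * (bin R n i * D / n%:R) + S).
      rewrite flE (bigD1 ord0)//= (bigD1 ord1')//= /T c0 mul0r mulr0 add0r mulrDr expr1.
      congr (_ * (_ * _) + _).
        by rewrite -kraw1E mulrC mulrA mulVf ?mul1r// gt_eqF.
      rewrite mulr_sumr; apply: eq_bigr => j /andP[j0 j1]; rewrite [RHS]mulrA -exprS prednK//.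
      by move: j0 j1; rewrite -!val_eqE /=; lia.
    have b1 : 1 <= bin R n i by rewrite ler1n bin_gt0 -ltnS.
    set b := kco y ord1' < 0.
    have sc : sgb R b * kco y ord1' = `|kco y ord1'|.
      rewrite /b; case: ltP => h; rewrite ?sgbT ?sgbF ?mul1r ?mulN1r.
        by rewrite ltr0_norm.
      by rewrite ger0_norm.
    rewrite -(pmulr_rgt0 _ (binR_gt0 R i)).
    have -> : bin R n i * (sgb R b * flow r y i * D) = r * (bin R n i * (`|kco y ord1'| / n%:R) * D ^+ 2 + sgb R b * D * S).
      transitivity (sgb R b * (bin R n i * flow r y i) * D); first by ring.
      by rewrite E -sc; ring.
    rewrite pmulr_rgt0//; move: rM; set A := `|_| / _ => rM.
    have A0 : 0 < A by rewrite divr_gt0// normr_gt0.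
    have D2 : `|D| ^+ 2 = D ^+ 2 by rewrite real_normK// num_real.
    have aD : 1 <= `|D|.
      by rewrite -(@ler_pXn2r _ 2)// ?nnegrE// expr1n D2.
    have : - (`|D| * `|S|) <= sgb R b * D * S.
      by rewrite -normrM -(norm_sgb b (D * S)) mulrA; have := ler_norm (- (sgb R b * D * S)); rewrite normrN; lra.
    have h1 : `|D| * `|S| < A * `|D| ^+ 2 by rewrite expr2 mulrA mulrC ltr_pM2r; [nra|lra].
    have h2 : A * `|D| ^+ 2 <= bin R n i * A * `|D| ^+ 2.
      by rewrite ler_wpM2r// ?exprn_ge0// ler_peMl// ltW.
    rewrite -D2; lra.
  have natD i : n%:R - 2 * i%:R = (n%:R - (2 * i)%:R) :> R by rewrite natrM.
  have neD i : (2 * i != n)%N -> 2 * i%:R != n%:R :> R by rewrite -natrM eqr_nat.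
  move=> i; split=> ik.
    have h : (2 * i < n)%N by rewrite uphalfE in ik; lia.
    have := key i (neD _ (negbT (ltn_eqF h))).
    rewrite pmulr_lgt0 ?sgbN ?mulNr ?oppr_lt0//.
    by rewrite natD subr_gt0 ltr_nat.
  have h : (n < 2 * i)%N by rewrite uphalfE in ik; lia.
  have := key i (neD _ (negbT (gtn_eqF h))).
  rewrite nmulr_lgt0 ?sgbN ?mulNr ?oppr_gt0//.
  by rewrite natD subr_lt0 ltr_nat.
have [|r r01 rM] := small `|kco y ord0|; first by rewrite normr_gt0.
exists r => //; apply: (@one_change_inA _ _ (kco y ord0 < 0) 0) => i; split=> // _.
set S := \sum_(j < d | j != ord0) r ^+ j * T j i.
have SM : `|S| <= r * M.
  by apply: rest; [case/andP: r01 => /ltW-> -> | move=> j; rewrite -val_eqE lt0n].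
have E : bin R n i * flow r y i = kco y ord0 * bin R n i + S.
  by rewrite flE (bigD1 ord0)//= /T expr0 mul1r kraw0E.
have b1 : 1 <= bin R n i by rewrite ler1n bin_gt0 -ltnS.
rewrite -(pmulr_rgt0 _ (binR_gt0 R i)) mulrCA E.
have := ler_norm S; have := ler_norm (- S); rewrite normrN => h1 h2.
case: (ltP (kco y ord0) 0) => c0'; rewrite ?sgbT ?sgbF ?mul1r ?mulN1r.
  rewrite (ltr0_norm c0') in rM; nra.
rewrite (ger0_norm c0') in rM; nra.
Qed.

End FlowEnds.

(** * Affine pencils and the angle *)

Section Pencil.
Variables (R : realFieldType) (n : nat).
Hypothesis n_gt1 : (1 < n)%N.
Notation d := n.+1.
Notation kap := (@kap n).
Notation affine := (@affine R n).
Implicit Types (w y : 'I_d -> R) (k : nat) (th t h : R) (e : bool).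

(** The affine vector that vanishes at [kap k] and otherwise has the signs [rho k]. With [k] running
    over the [2 d] slots and [th] over the unit interval, [dir] goes once around the directions of
    affine vectors. *)
Definition node k (i : 'I_d) : R := sgb R (odd (k %/ d)) * (i%:R - (k %% d)%:R).
Definition dir k th i := (1 - th) * node k i + th * node k.+1 i.
Definition gap k (i : 'I_d) : R := `|i%:R - (kap k)%:R|.
Definition speed k th i := (1 - th) * gap k i + th * gap k.+1 i.
Definition sg k (i : 'I_d) : R := sgb R (rho k i).

Lemma sgM k i (x : R) : `|sg k i * x| = `|x|.
Proof. exact: norm_sgb. Qed.

Lemma sg_neq0 k i : sg k i != 0.
Proof. by rewrite /sg /sgb signr_eq0. Qed.

Lemma sg_node k i : sg k i * node k i = gap k i.
Proof.
rewrite /sg /rho /gap /node sgb_addb mulrACA -sgb_addb addbb sgbF mul1r /=.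
case: leqP => h; rewrite ?sgbT ?sgbF ?mulN1r ?mul1r.
  by rewrite ler0_norm// subr_le0 ler_nat.
by rewrite gtr0_norm// subr_gt0 ltr_nat.
Qed.

Lemma gap_eq0 k i : (gap k i == 0) = (i == kap k).
Proof. by rewrite normr_eq0 subr_eq0 eqr_nat -val_eqE. Qed.

Lemma gap_gt0 k i : i != kap k -> 0 < gap k i.
Proof. by move=> ik; rewrite lt0r gap_eq0 ik /= normr_ge0. Qed.

(** [node k.+1] vanishes at the one colour where [rho k] and [rho k.+1] differ, so it fits both
    patterns. *)
Lemma sg_node_succ k i : sg k i * node k.+1 i = gap k.+1 i.
Proof.
have [ik|ik] := eqVneq i (kap k.+1); last by rewrite -sg_node /sg rho_succ (negbTE ik) addbF.
have /eqP g0 : gap k.+1 i == 0 by rewrite gap_eq0 ik.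
have : sg k.+1 i * node k.+1 i = 0 by rewrite sg_node.
by move/eqP; rewrite mulf_eq0 (negbTE (sg_neq0 _ _)) /= => /eqP->; rewrite mulr0 g0.
Qed.

Lemma sg_dir k th i : sg k i * dir k th i = speed k th i.
Proof. by rewrite mulrDr mulrCA sg_node mulrCA sg_node_succ. Qed.

Lemma affine_node k : affine (node k).
Proof.
exists (- sgb R (odd (k %/ d)) * (k %% d)%:R), (sgb R (odd (k %/ d))) => i.
by rewrite /node; ring.
Qed.

Lemma affine_lin a b y y' : affine y -> affine y' -> affine (fun i => a * y i + b * y' i).
Proof.
move=> [a1 [b1 h1]] [a2 [b2 h2]]; exists (a * a1 + b * a2), (a * b1 + b * b2) => i.
by rewrite h1 h2; ring.
Qed.

Lemma eq_affine y y' : y =1 y' -> affine y -> affine y'.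
Proof. by move=> e [a [b h]]; exists a, b => i; rewrite -e. Qed.

Lemma affine_dir k th : affine (dir k th).
Proof. exact: affine_lin (affine_node _) (affine_node _). Qed.

Lemma affine0 y k : affine y -> y (kap k) = 0 -> y (kap k.+1) = 0 -> forall i, y i = 0.
Proof.
move=> [a [b h]]; rewrite !h => h1 h2 i.
have ne : ((kap k.+1)%:R : R) - (kap k)%:R != 0.
  by rewrite subr_eq0 eqr_nat; exact: (kap_succ_neq k (ltnW n_gt1)).
have b0 : b = 0.
  have : b * ((kap k.+1)%:R - (kap k)%:R) = 0 by rewrite mulrBr; lra.
  by move/eqP; rewrite mulf_eq0 (negbTE ne) orbF => /eqP.
by move: h1; rewrite h b0 !mul0r.
Qed.

Definition interp w k (i : 'I_d) : R :=
  (w (kap k) * ((kap k.+1)%:R - i%:R) + w (kap k.+1) * (i%:R - (kap k)%:R)) /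
  ((kap k.+1)%:R - (kap k)%:R).
Definition apex w k i := w i - interp w k i.

Lemma kap_sub_neq0 k : ((kap k.+1)%:R : R) - (kap k)%:R != 0.
Proof. by rewrite subr_eq0 eqr_nat; exact: (kap_succ_neq k (ltnW n_gt1)). Qed.

Lemma apex_kap w k : apex w k (kap k) = 0.
Proof.
have := kap_sub_neq0 k; rewrite /apex /interp.
move: ((kap k.+1)%:R) => a; move: ((kap k)%:R) => b ne; field; exact: ne.
Qed.

Lemma apex_kap_succ w k : apex w k (kap k.+1) = 0.
Proof.
have := kap_sub_neq0 k; rewrite /apex /interp.
move: ((kap k.+1)%:R) => a; move: ((kap k)%:R) => b ne; field; exact: ne.
Qed.

Lemma affine_interp w k : affine (interp w k).
Proof.
exists ((w (kap k) * (kap k.+1)%:R - w (kap k.+1) * (kap k)%:R) / ((kap k.+1)%:R - (kap k)%:R)).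
exists ((w (kap k.+1) - w (kap k)) / ((kap k.+1)%:R - (kap k)%:R)) => i.
have := kap_sub_neq0 k; rewrite /interp.
move: ((kap k.+1)%:R) => a; move: ((kap k)%:R) => b ne; field; exact: ne.
Qed.

(* [apex w k] is the vector of the affine class of [w] that vanishes at [kap k] and
   [kap k.+1]; [th] is the ratio in which [t] is shared between these two values. *)
Definition pt w k th t i := apex w k i + t * dir k th i.

Lemma affine_pt w k th t : affine (fun i => pt w k th t i - w i).
Proof.
have h := affine_lin (-1) t (affine_interp w k) (affine_dir k th).
by apply: eq_affine h => i; rewrite /pt /apex; ring.
Qed.

Lemma sg_pt w k th t i : sg k i * pt w k th t i = sg k i * apex w k i + t * speed k th i.
Proof. by rewrite mulrDr mulrCA sg_dir. Qed.

Definition len k := gap k.+1 (kap k).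

Lemma len_gt0 k : 0 < len k.
Proof. by apply: gap_gt0; rewrite eq_sym; exact: (kap_succ_neq k (ltnW n_gt1)). Qed.

Lemma gap_sym k : gap k (kap k.+1) = len k.
Proof. exact: distrC. Qed.

Lemma gap_self k : gap k (kap k) = 0.
Proof. by apply/eqP; rewrite gap_eq0. Qed.

Lemma sg_pt_kap w k th t : sg k (kap k) * pt w k th t (kap k) = t * th * len k.
Proof. by rewrite sg_pt apex_kap mulr0 add0r /speed gap_self; rewrite -/(len k); ring. Qed.

Lemma sg_pt_succ w k th t :
  sg k (kap k.+1) * pt w k th t (kap k.+1) = t * (1 - th) * len k.
Proof. by rewrite sg_pt apex_kap_succ mulr0 add0r /speed gap_self gap_sym; ring. Qed.

(** The signed values of [pt] at the two colours of the block are [t * th * len k] and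
    [t * (1 - th) * len k]: their sum gives [t], their ratio [th], and the sign hypothesis puts [th]
    between 0 and 1. Agreement at two colours is enough within an affine class. *)
Lemma pt_rep w k y : affine (fun i => y i - w i) ->
  0 <= (sg k (kap k) * y (kap k)) * (sg k (kap k.+1) * y (kap k.+1)) ->
  exists th t, 0 <= th <= 1 /\ y =1 pt w k th t.
Proof.
move=> aff; set a := sg k _ * _; set b := sg k _ * _ => ab.
have L := len_gt0 k; pose t := (a + b) / len k.
(* If both values vanish, [y] is the apex and any [th] will do. *)
pose th := if a + b == 0 then 0 else a / (a + b).
have tha : t * th * len k = a /\ 0 <= th <= 1.
  rewrite /t /th; case: eqP => [s0|/eqP s0]; first by split; [nra|lra].
  split; first by field; rewrite s0 gt_eqF.
  have s2 : 0 < (a + b) ^+ 2 by rewrite lt0r sqrf_eq0 s0 sqr_ge0.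
  have -> : a / (a + b) = (a ^+ 2 + a * b) / (a + b) ^+ 2 by field.
  by rewrite divr_ge0 ?ler_pdivrMr//=; nra.
have [h1 h2] := tha; exists th, t; split=> // i; apply/eqP; rewrite -subr_eq0; apply/eqP.
apply: (@affine0 (fun i => y i - pt w k th t i) k).
- have := affine_lin 1 (-1) aff (affine_pt w k th t); apply: eq_affine => l; ring.
- apply: (mulfI (sg_neq0 k (kap k))).
  by rewrite mulr0 mulrBr sg_pt_kap h1 -/a subrr.
- apply: (mulfI (sg_neq0 k (kap k.+1))).
  rewrite mulr0 mulrBr sg_pt_succ -/b.
  have -> : t * (1 - th) * len k = t * len k - t * th * len k by ring.
  by rewrite h1 /t divfK ?gt_eqF//; ring.
Qed.

(** The numbers [sg k i * y i] are the entries of [v]. Some block weakly has the sign opposite to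
    [e], where [kap k] and [kap k.+1] together form one block. Thus [layer k] describes the vectors
    supported by a collar word of slot [k]. *)
Definition wit e k y :=
  (exists i, [/\ i != kap k, i != kap k.+1 & sgb R e * (sg k i * y i) <= 0]) \/
  (sgb R e * (sg k (kap k) * y (kap k)) <= 0 /\
   sgb R e * (sg k (kap k.+1) * y (kap k.+1)) <= 0).

Definition layer k y :=
  [/\ 0 <= (sg k (kap k) * y (kap k)) * (sg k (kap k.+1) * y (kap k.+1)),
      wit false k y & wit true k y].

(** Off the block every entry of [v] grows with [t] at rate [speed]; each quotient is the value of
    [sgb R e * t] at which an entry reaches the sign [e], and 0 is that value for the block. The
    maximum is the end of the segment. *)
Definition ext e w k th : R := \big[Order.max/0]_(i | (i != kap k) && (i != kap k.+1))
  (- (sgb R e * (sg k i * apex w k i)) / speed k th i).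

Lemma speed_gt0 k th i : 0 <= th <= 1 -> i != kap k -> i != kap k.+1 -> 0 < speed k th i.
Proof.
move=> /andP[t0 t1] /gap_gt0 g1 /gap_gt0 g2; rewrite /speed.
have [->|tn] := eqVneq th 0; first by rewrite subr0 mul1r mul0r addr0.
have tp : 0 < th by rewrite lt0r tn.
by rewrite ltr_wpDl ?mulr_gt0//; apply: mulr_ge0; [lra|exact: ltW].
Qed.

Lemma gap_ge0 k i : 0 <= gap k i.
Proof. exact: normr_ge0. Qed.

Lemma speed_ge0 k th i : 0 <= th <= 1 -> 0 <= speed k th i.
Proof. by move=> /andP[t0 t1]; rewrite addr_ge0// mulr_ge0 ?gap_ge0//; lra. Qed.

Lemma ext_ge0 e w k th : 0 <= ext e w k th.
Proof. exact: bigmax_ge_id. Qed.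

(** On the block the entries are [t] times non-negative numbers with positive sum, off it they move
    at positive speed; so each disjunct of [wit] bounds [sgb R e * t] by one term of the maximum. *)
Lemma witP e w k th t : 0 <= th <= 1 ->
  wit e k (pt w k th t) <-> sgb R e * t <= ext e w k th.
Proof.
move=> th01; have L := len_gt0 k; have [t0 t1] := andP th01.
have E i : sgb R e * (sg k i * pt w k th t i) =
    sgb R e * (sg k i * apex w k i) + sgb R e * t * speed k th i.
  by rewrite sg_pt; ring.
split=> [[[i [i1 i2]]|[]]|].
- rewrite E => h; apply/bigmax_geP; right; exists i; first by rewrite i1.
  by rewrite ler_pdivlMr ?speed_gt0//; lra.
- rewrite sg_pt_kap sg_pt_succ => h1 h2; apply/bigmax_geP; left.
  have : (sgb R e * t) * len k <= 0.
    have -> : sgb R e * t * len k = sgb R e * (t * th * len k) + sgb R e * (t * (1 - th) * len k) by ring.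
    lra.
  by rewrite pmulr_lle0.
- move/bigmax_geP => [h|[i /andP[i1 i2] h]].
    right; rewrite sg_pt_kap sg_pt_succ.
    have h1 : sgb R e * t * len k <= 0 by rewrite pmulr_lle0.
    split.
      have -> : sgb R e * (t * th * len k) = th * (sgb R e * t * len k) by ring.
      exact: mulr_ge0_le0.
    have -> : sgb R e * (t * (1 - th) * len k) = (1 - th) * (sgb R e * t * len k) by ring.
    by rewrite mulr_ge0_le0//; lra.
  left; exists i; split=> //; rewrite E.
  by move: h; rewrite ler_pdivlMr ?speed_gt0//; lra.
Qed.

Lemma eq_wit e k y y' : y =1 y' -> wit e k y -> wit e k y'.
Proof.
by move=> E [[i [i1 i2 h]]|[h1 h2]]; [left; exists i; rewrite -E|right; rewrite -!E].
Qed.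

Lemma eq_layer k y y' : y =1 y' -> layer k y -> layer k y'.
Proof. by move=> E [h1 h2 h3]; split; [rewrite -!E|exact: eq_wit h2|exact: eq_wit h3]. Qed.

Lemma layer_pt w k th t : 0 <= th <= 1 ->
  t <= ext false w k th -> - t <= ext true w k th -> layer k (pt w k th t).
Proof.
move=> th01 h1 h2; split; last first.
- by apply/witP => //; rewrite sgbT mulN1r.
- by apply/witP => //; rewrite sgbF mul1r.
rewrite sg_pt_kap sg_pt_succ; have [t0 t1] := andP th01.
have -> : t * th * len k * (t * (1 - th) * len k) = (t * len k) ^+ 2 * (th * (1 - th)) by ring.
by rewrite mulr_ge0 ?sqr_ge0// mulr_ge0//; lra.
Qed.

Lemma wit_speed e w k th t : 0 <= th <= 1 -> wit e k (pt w k th t) ->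
  exists2 i, 0 < speed k th i & sgb R e * (sg k i * pt w k th t i) <= 0.
Proof.
move=> th01 [[i [i1 i2 h]]|[h1 h2]]; first by exists i; rewrite ?speed_gt0.
have L := len_gt0 k; have [t0 t1] := andP th01.
have [th0|thn] := eqVneq th 0.
  by exists (kap k.+1) => //; rewrite /speed gap_self gap_sym th0; lra.
exists (kap k) => //; rewrite /speed gap_self -/(len k) mulr0 add0r mulr_gt0//.
by rewrite lt0r thn.
Qed.

Definition num k y : R := \sum_i sg k i * y i.
Definition den y : R := \sum_i `|y i|.

Lemma den_ge0 y : 0 <= den y.
Proof. exact: sumr_ge0. Qed.

Lemma den_gt0 y : (exists i, y i != 0) -> 0 < den y.
Proof.
move=> [i yi]; rewrite lt0r den_ge0 andbT psumr_neq0//; apply/hasP; exists i.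
  exact: mem_index_enum.
by rewrite normr_gt0.
Qed.

Lemma eq_num k y y' : y =1 y' -> num k y = num k y'.
Proof. by move=> E; apply: eq_bigr => i _; rewrite E. Qed.

Lemma eq_den y y' : y =1 y' -> den y = den y'.
Proof. by move=> E; apply: eq_bigr => i _; rewrite E. Qed.

Lemma height_mono k th y y' s : 0 < s -> 0 <= th <= 1 ->
  (forall i, sg k i * y' i = sg k i * y i + s * speed k th i) ->
  (exists2 i, 0 < speed k th i & sg k i * y' i <= 0) ->
  (exists2 i, 0 < speed k th i & 0 <= sg k i * y i) ->
  num k y' * den y = num k y * den y' -> False.
Proof.
move=> s0 th01 yE [i si yi] [j sj yj] E.
(* [P] strictly increases and [N] strictly decreases along the pencil, whereas equal
   heights mean equal ratios [P : N]. *)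
pose P y := \sum_i (`|y i| + sg k i * y i); pose N y := \sum_i (`|y i| - sg k i * y i).
have PE z : P z = den z + num k z by rewrite /P big_split.
have NE z : N z = den z - num k z by rewrite /N sumrB.
have N0 z : 0 <= N z.
  by apply: sumr_ge0 => l _; rewrite -(sgM k l) subr_ge0 ler_norm.
have P0 z : 0 <= P z.
  apply: sumr_ge0 => l _; rewrite -(sgM k l).
  by have := ler_norm (- (sg k l * z l)); rewrite normrN; lra.
have PP : P y < P y'.
  rewrite /P (bigD1 j)//= [ltRHS](bigD1 j)//=; apply: ltr_leD.
    rewrite -(sgM k j (y j)) -(sgM k j (y' j)) yE ger0_norm// ger0_norm.
      by have := mulr_gt0 s0 sj; lra.
    by have := mulr_gt0 s0 sj; lra.
  apply: ler_sum => l _; rewrite -(sgM k l (y l)) -(sgM k l (y' l)) yE.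
  have : 0 <= s * speed k th l by rewrite mulr_ge0 ?speed_ge0// ltW.
  move: (sg k l * y l) (s * speed k th l) => a b b0.
  by case: (ger0P a) => ?; case: (ger0P (a + b)) => ?; lra.
have NN : N y' < N y.
  rewrite /N (bigD1 i)//= [ltRHS](bigD1 i)//=; apply: ltr_leD.
    rewrite -(sgM k i (y i)) -(sgM k i (y' i)); move: yi; rewrite yE => yi.
    have := mulr_gt0 s0 si; rewrite ler0_norm// => h; rewrite ler0_norm; lra.
  apply: ler_sum => l _; rewrite -(sgM k l (y l)) -(sgM k l (y' l)) yE.
  have : 0 <= s * speed k th l by rewrite mulr_ge0 ?speed_ge0// ltW.
  move: (sg k l * y l) (s * speed k th l) => a b b0.
  by case: (ger0P a) => ?; case: (ger0P (a + b)) => ?; lra.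
have PN : P y' * N y = P y * N y'.
  rewrite !PE !NE; apply/eqP; rewrite -subr_eq0; apply/eqP.
  transitivity (2 * (num k y' * den y - num k y * den y')); first by ring.
  by rewrite E subrr mulr0.
have h1 : P y * N y' <= P y * N y by rewrite ler_wpM2l// ltW.
have h2 : P y * N y < P y' * N y by rewrite ltr_pM2r// (le_lt_trans (N0 y')).
by have := le_lt_trans h1 h2; rewrite PN ltxx.
Qed.

End Pencil.

(** * The points of a given height around the collar *)

Section Circle.
Variables (R : realFieldType) (n : nat).
Hypothesis n_gt1 : (1 < n)%N.
Notation d := n.+1.
Notation kap := (@kap n).
Variables (w : 'I_d -> R) (h : R).
Hypothesis w_naff : ~ affine w.
Implicit Types (y : 'I_d -> R) (k : nat) (th t : R).

(* Zero exactly when the point of height [h] in slot [k] is the apex, whatever [th]: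
   such slots must not contribute to the angle. *)
Definition width k : R := `|h * den (apex w k) - num k (apex w k)|.

Definition pin k th t y :=
  [/\ 0 <= th <= 1, y =1 pt w k th t, layer k y & num k y = h * den y].

Lemma nonaffine_neq0 y : affine (fun i => y i - w i) -> exists i, y i != 0.
Proof.
move=> aff; apply: contrapT => nex; apply: w_naff.
have y0 i : y i = 0 by apply/eqP; apply: contraPT nex => yi; apply; exists i.
have := affine_lin (-1) 0 aff aff; apply: eq_affine => i.
by rewrite y0; ring.
Qed.

Lemma apex_neq0 k : exists i, apex w k i != 0.
Proof.
apply: nonaffine_neq0; have := affine_lin (-1) 0 (affine_interp n_gt1 w k) (affine_interp n_gt1 w k).
by apply: eq_affine => i; rewrite /apex; ring.
Qed.

Lemma pt0 k th : pt w k th 0 =1 apex w k.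
Proof. by move=> i; rewrite /pt mul0r addr0. Qed.

Lemma wit0 e k th : wit e k (pt w k th 0).
Proof.
by right; rewrite !pt0 (apex_kap n_gt1) (apex_kap_succ n_gt1) !mulr0.
Qed.

Lemma heights_inj k th t t' y y' : 0 <= th <= 1 ->
  y =1 pt w k th t -> y' =1 pt w k th t' ->
  wit true k y -> wit false k y -> wit true k y' -> wit false k y' ->
  num k y' * den y = num k y * den y' -> t = t'.
Proof.
move=> th01 yE yE' w1 w2 w3 w4 E.
have wS e z s : z =1 pt w k th s -> wit e k z ->
    exists2 i, 0 < speed k th i & sgb R e * (sg R k i * z i) <= 0.
  by move=> zE /(eq_wit zE) /(wit_speed n_gt1 th01)[i i1 i2]; exists i; rewrite ?zE.
have pos z s : z =1 pt w k th s -> wit true k z ->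
    exists2 i, 0 < speed k th i & 0 <= sg R k i * z i.
  by move=> zE /(wS _ _ _ zE)[i i1]; rewrite sgbT mulN1r oppr_le0; exists i.
have neg z s : z =1 pt w k th s -> wit false k z ->
    exists2 i, 0 < speed k th i & sg R k i * z i <= 0.
  by move=> zE /(wS _ _ _ zE)[i i1]; rewrite sgbF mul1r; exists i.
case: (ltgtP t t') => // tt; exfalso.
- apply: (@height_mono _ _ k th y y' (t' - t)); rewrite ?subr_gt0//.
  + by move=> i; rewrite yE yE' !sg_pt; ring.
  + exact: neg yE' w4.
  + exact: pos yE w1.
- apply: (@height_mono _ _ k th y' y (t - t')); rewrite ?subr_gt0//.
  + by move=> i; rewrite yE yE' !sg_pt; ring.
  + exact: neg yE w2.
  + exact: pos yE' w3.
Qed.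

Lemma pin_inj k th t t' y y' : pin k th t y -> pin k th t' y' -> t = t'.
Proof.
move=> [th01 yE [_ l1 l2] E] [_ yE' [_ l3 l4] E'].
apply: (heights_inj th01 yE yE') => //; rewrite E E'; ring.
Qed.

Lemma width_eq0 k th t y : pin k th t y -> width k = 0 <-> t = 0.
Proof.
move=> [th01 yE [_ l1 l2] E]; split=> [/eqP|t0].
  rewrite normr_eq0 subr_eq0 => /eqP E'.
  apply: (heights_inj th01 yE (fun=> erefl)) => //; try exact: wit0.
  by rewrite (eq_num _ (pt0 k th)) (eq_den (pt0 k th)) E -E'; ring.
have yA : y =1 apex w k by move=> i; rewrite yE t0 pt0.
by apply/eqP; rewrite normr_eq0 subr_eq0 -(eq_num k yA) -(eq_den yA) E.
Qed.

Lemma width_ge0 k : 0 <= width k.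
Proof. exact: normr_ge0. Qed.

(** The block moves from [kap k], [kap k.+1] to [kap k.+1], [kap k.+2]. As [y] vanishes at the
    shared colour, a witness at [kap k.+2] becomes one on the new block. *)
Lemma wit_succ e k y : y (kap k.+1) = 0 -> wit e k y -> wit e k.+1 y.
Proof.
move=> y0.
have sgE i : i != kap k.+1 -> sg R k.+1 i = sg R k i.
  by move=> ik; rewrite /sg rho_succ (negbTE ik) addbF.
have gen i : i != kap k.+1 -> sgb R e * (sg R k i * y i) <= 0 -> wit e k.+1 y.
  move=> i1; rewrite -sgE// => i2; have [ii|ni] := eqVneq i (kap k.+2).
    by right; rewrite y0 !mulr0 -ii.
  by left; exists i; rewrite i1.
case=> [[i [_ i1 i2]]|[h1 _]]; first exact: gen i2.
by apply: gen h1; rewrite eq_sym; exact: (kap_succ_neq k (ltnW n_gt1)).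
Qed.

Lemma num_succ k y : y (kap k.+1) = 0 -> num k.+1 y = num k y.
Proof.
move=> y0; apply: eq_bigr => i _; have [->|ik] := eqVneq i (kap k.+1).
  by rewrite y0 !mulr0.
by rewrite /sg rho_succ (negbTE ik) addbF.
Qed.

(** Both apexes vanish at [kap k.+1], so they differ by an affine vector vanishing there. *)
Lemma apex_succ k : exists c, forall i, apex w k.+1 i = apex w k i + c * node R k.+1 i.
Proof.
have L : node R k.+1 (kap k) != 0.
  have := gap_gt0 R (kap_succ_neq k (ltnW n_gt1)); rewrite /gap distrC -/(gap R k.+1 (kap k)).
  rewrite -sg_node => /lt0r_neq0; by rewrite mulf_eq0 negb_or => /andP[].
exists (apex w k.+1 (kap k) / node R k.+1 (kap k)) => i; apply/eqP; rewrite -subr_eq0; apply/eqP.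
move: i; apply: (@affine0 _ _ n_gt1 _ k).
- set c := _ / _.
  have h1 := affine_lin 1 (-1) (affine_interp n_gt1 w k) (affine_interp n_gt1 w k.+1).
  have := affine_lin 1 (- c) h1 (affine_node _ _ k.+1).
  by apply: eq_affine => i; rewrite /apex; ring.
- by rewrite (apex_kap n_gt1) add0r divfK//; apply/eqP; rewrite subr_eq0.
- rewrite (apex_kap n_gt1) (apex_kap_succ n_gt1) add0r.
  have /eqP : sg R k.+1 (kap k.+1) * node R k.+1 (kap k.+1) = 0.
    by rewrite sg_node; apply/eqP; rewrite gap_eq0.
  by rewrite mulf_eq0 (negbTE (sg_neq0 _ _ _)) /= => /eqP ->; rewrite mulr0 addr0 oppr0.
Qed.

(** Either the point is at the end of its slot or the slot is collapsed to its apex. In both cases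
    [y] vanishes at [kap k.+1], the colour flipped next, and the next slot starts with the same
    point. *)
Lemma pin_succ k th t y : pin k th t y -> (1 - th) * width k = 0 ->
  y (kap k.+1) = 0 /\ exists t', pin k.+1 0 t' y.
Proof.
move=> pk; have [th01 yE lay E] := pk => /eqP; rewrite mulf_eq0 => h0.
have [c cE] := apex_succ k.
have [t1 yE1] : exists t1, forall i, y i = apex w k i + t1 * node R k.+1 i.
  case/orP: h0 => [|/eqP/(width_eq0 pk) t0].
    rewrite subr_eq0 => /eqP th1; exists t => i.
    by rewrite yE /pt /dir -th1; ring.
  by exists 0 => i; rewrite yE t0 pt0 mul0r addr0.
have y0 : y (kap k.+1) = 0.
  rewrite yE1 (apex_kap_succ n_gt1) add0r.
  have /eqP : sg R k.+1 (kap k.+1) * node R k.+1 (kap k.+1) = 0.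
    by rewrite sg_node; apply/eqP; rewrite gap_eq0.
  by rewrite mulf_eq0 (negbTE (sg_neq0 _ _ _)) /= => /eqP ->; rewrite mulr0.
split=> //; exists (t1 - c); split; first by rewrite lexx ler01.
- by move=> i; rewrite yE1 /pt cE /dir; ring.
- case: lay => _ l1 l2; split; [by rewrite y0 mulr0 mul0r|exact: wit_succ|exact: wit_succ].
- by rewrite num_succ.
Qed.

(** A walk through collapsed slots: each step flips the pattern only at a colour where [y]
    vanishes. *)
Lemma pin_chain k th t y e : pin k th t y -> (0 < e)%N -> (1 - th) * width k = 0 ->
  (forall j, (k < j < k + e)%N -> width j = 0) ->
  (exists t', pin (k + e) 0 t' y) /\ (forall i, y i != 0 -> rho (k + e) i = rho k i).
Proof.
move=> pk e0 w0; elim: e e0 => // -[|e] IH _ wj.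
  have [y0 [t' pk']] := pin_succ pk w0; rewrite addn1; split; first by exists t'.
  move=> i yi; rewrite rho_succ; case: eqP => [ii|]; last by rewrite addbF.
  by move: yi; rewrite ii y0 eqxx.
have [||[t' pk'] rk] := IH; [by []|by move=> j /andP[j1 j2]; apply: wj; lia|].
have [|y0 [t2 pk2]] := pin_succ pk'.
  by rewrite wj ?mulr0//; lia.
rewrite addnS; split; first by exists t2.
move=> i yi; rewrite rho_succ rk//; case: eqP => [ii|]; last by rewrite addbF.
by move: yi; rewrite ii y0 eqxx.
Qed.

Lemma pin_meet k th t y k' th' t' y' : pin k th t y -> pin k' th' t' y' ->
  (k < k')%N -> (1 - th) * width k = 0 -> (forall j, (k < j < k')%N -> width j = 0) ->
  th' * width k' = 0 ->
  y =1 y' /\ (forall i, y i != 0 -> rho k i = rho k' i).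
Proof.
move=> pk pk' kk w0 wj w1; rewrite -(subnKC (ltnW kk)) in wj pk' w1 *.
have [|//|//|[t2 pk2] rk] := pin_chain (e := k' - k) pk; first by rewrite subn_gt0.
split; last by move=> i yi; rewrite rk.
have [_ yE _ _] := pk2; have [_ yE' _ _] := pk'.
move/eqP: w1; rewrite mulf_eq0 => /orP[/eqP t0|/eqP w2].
  rewrite t0 in pk' yE'; move=> i; rewrite yE yE'.
  by rewrite (pin_inj pk2 pk').
move=> i; rewrite yE yE'; have /(width_eq0 pk2)-> := w2.
by have /(width_eq0 pk')-> := w2; rewrite !pt0.
Qed.

(** Converse of [pin_meet]. Agreement of the patterns off the zeros makes [y] vanish at every colour
    flipped on the way, so [y] is the apex of each slot strictly in between, at height [h]. Beyond
    half a turn colours are flipped back, hence the bound on [e]. *)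
Lemma pin_part k th t y e th' t' : pin k th t y -> pin (k + e) th' t' y ->
  (0 < e <= d)%N -> (forall i, y i != 0 -> rho k i = rho (k + e) i) ->
  [/\ (1 - th) * width k = 0, (forall j, (k < j < k + e)%N -> width j = 0)
    & th' * width (k + e) = 0].
Proof.
move=> pk pk' /andP[e0 ed] rk; have [th01 yE lay E] := pk; have [_ yE' lay' E'] := pk'.
have y0 j : (0 < j <= e)%N -> y (kap (k + j)) = 0.
  move=> /andP[j0 je]; apply/eqP; apply: contraT => /rk.
  by rewrite rho_between ?j0 ?(leq_trans je ed)// je; case: (rho k _).
have L := len_gt0 R n_gt1.
split.
- have := sg_pt_succ n_gt1 w k th t; rewrite -yE -addn1 y0 ?e0// mulr0 => /esym/eqP.
  rewrite mulf_eq0 (gt_eqF (L _)) orbF mulf_eq0 => /orP[/eqP/(width_eq0 pk)->|/eqP->].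
    by rewrite mulr0.
  by rewrite mul0r.
- move=> j /andP[kj je].
  have yA : y =1 apex w j.
    move=> i; apply/eqP; rewrite -subr_eq0; apply/eqP; move: i.
    apply: (@affine0 _ _ n_gt1 _ j).
    + have := affine_lin 1 1 (affine_pt n_gt1 w k th t) (affine_interp n_gt1 w j).
      by apply: eq_affine => i; rewrite yE /apex; ring.
    + by rewrite (apex_kap n_gt1) subr0 -(subnKC (ltnW kj)) y0//; lia.
    + rewrite (apex_kap_succ n_gt1) subr0; have -> : j.+1 = (k + (j.+1 - k))%N by lia.
      by rewrite y0//; lia.
  apply/eqP; rewrite normr_eq0 subr_eq0 -(eq_num j yA) -(eq_den yA) -E; apply/eqP.
  apply: eq_bigr => i _; have [->|yi] := eqVneq (y i) 0; first by rewrite !mulr0.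
  congr (sgb _ _ * _); rewrite -(subnKC (ltnW kj)).
  have [[m /andP[m0 me] mi]|nm] := pselect (exists2 m, (0 < m <= j - k)%N & kap (k + m) = i).
    by move: yi; rewrite -mi y0 ?eqxx// m0; lia.
  have gen m : (m <= j - k)%N -> rho (k + m) i = rho k i.
    elim: m => [|m IH] mj; first by rewrite addn0.
    rewrite addnS rho_succ IH ?(ltnW mj)//; case: eqP => [ii|]; last by rewrite addbF.
    by exfalso; apply: nm; exists m.+1; rewrite ?addnS ?ii.
  exact/esym/gen.
- have := sg_pt_kap n_gt1 w (k + e) th' t'; rewrite -yE' y0 ?e0 ?leqnn// mulr0 => /esym/eqP.
  rewrite mulf_eq0 (gt_eqF (L _)) orbF mulf_eq0 => /orP[/eqP/(width_eq0 pk')->|/eqP->].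
    by rewrite mulr0.
  by rewrite mul0r.
Qed.

Lemma periodic k :
  [/\ (forall i : 'I_d, sg R (k + d.*2) i = sg R k i), kap (k + d.*2) = kap k,
      kap (k + d.*2).+1 = kap k.+1, (forall i : 'I_d, node R (k + d.*2) i = node R k i)
    & (forall i : 'I_d, node R (k + d.*2).+1 i = node R k.+1 i)].
Proof.
have nd j (i : 'I_d) : node R (j + d.*2) i = node R j i.
  by rewrite /node (addnC j) -mul2n divnMDl// modnMDl oddD.
split=> //.
- by move=> i; rewrite /sg rhoD2.
- exact: kapD2.
- by rewrite -addSn kapD2.
- by move=> i; rewrite -addSn nd.
Qed.

Lemma interp_periodic k i : interp w (k + d.*2) i = interp w k i.
Proof. by have [_ e1 e2 _ _] := periodic k; rewrite /interp e1 e2. Qed.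

Lemma pt_periodic k th t i : pt w (k + d.*2) th t i = pt w k th t i.
Proof.
have [_ _ _ e1 e2] := periodic k.
by rewrite /pt /apex interp_periodic /dir e1 e2.
Qed.

Lemma width_periodic k : width (k + d.*2) = width k.
Proof.
have [e _ _ _ _] := periodic k.
have E : apex w (k + d.*2) =1 apex w k by move=> i; rewrite /apex interp_periodic.
rewrite /width (eq_num _ E) (eq_den E); congr `| _ - _ |.
by apply: eq_bigr => i _; rewrite e.
Qed.

Lemma pin_periodic k th t y : pin k th t y -> pin (k + d.*2) th t y.
Proof.
have [e1 e2 e3 _ _] := periodic k.
move=> [th01 yE [l0 l1 l2] E]; split=> //.
- by move=> i; rewrite yE pt_periodic.
- split; first by rewrite e2 e3 !e1.
    by case: l1 => [[i i1]|l1]; [left; exists i; rewrite e2 e3 e1|right; rewrite e2 e3 !e1].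
  by case: l2 => [[i i1]|q1]; [left; exists i; rewrite e2 e3 e1|right; rewrite e2 e3 !e1].
- by rewrite -E; apply: eq_bigr => i _; rewrite e1.
Qed.

Definition cum k : R := \sum_(j < k) width j.
Definition perim : R := cum d.*2.
Definition posn k th : R := cum k + th * width k.

Lemma cumS k : cum k.+1 = cum k + width k.
Proof. exact: big_ord_recr. Qed.

Lemma cum_mono k k' : (k <= k')%N -> cum k <= cum k'.
Proof.
move=> /subnKC <-; elim: (k' - k)%N => [|e IH]; first by rewrite addn0.
by rewrite addnS cumS (le_trans IH)// lerDl width_ge0.
Qed.

Lemma cum_eq k k' : (k <= k')%N -> cum k = cum k' ->
  forall j, (k <= j < k')%N -> width j = 0.
Proof.
move=> kk E j /andP[kj jk]; apply/eqP; rewrite eq_le width_ge0 andbT.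
have := cum_mono kj; have := cum_mono jk; rewrite cumS; lra.
Qed.

Lemma cum_const k k' : (k <= k')%N -> (forall j, (k <= j < k')%N -> width j = 0) ->
  cum k = cum k'.
Proof.
move=> /subnKC <-; elim: (k' - k)%N => [|e IH] H; first by rewrite addn0.
rewrite addnS cumS H ?addr0; last by lia.
by apply: IH => j jk; apply: H; lia.
Qed.

Lemma posn_bounds k th : 0 <= th <= 1 -> cum k <= posn k th <= cum k.+1.
Proof. by move=> /andP[t0 t1]; rewrite cumS /posn; have := width_ge0 k; nra. Qed.

Lemma cum_ge0 k : 0 <= cum k.
Proof. by apply: sumr_ge0 => i _; exact: width_ge0. Qed.

Definition same_angle (a a' : R) :=
  a = a' \/ (a = 0 /\ a' = perim) \/ (a = perim /\ a' = 0).

Lemma same_angleC a a' : same_angle a a' -> same_angle a' a.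
Proof. rewrite /same_angle; intuition. Qed.

Lemma posn_part k th : 0 <= th <= 1 -> posn k th = cum k.+1 -> (1 - th) * width k = 0.
Proof. by rewrite cumS /posn => _; lra. Qed.

(** The start of the turn is compared with its end by moving [k'] one full period ahead; all slots
    in between are collapsed. *)
Lemma pin_wrap k th t y k' th' t' y' : (k < d.*2)%N ->
  pin k th t y -> pin k' th' t' y' -> posn k th = perim -> posn k' th' = 0 ->
  y =1 y' /\ (forall i, y i != 0 -> rho k i = rho k' i).
Proof.
move=> kd pk pk' p1 p0; have [th01 _ _ _] := pk; have [th01' _ _ _] := pk'.
have [b1 b2] := andP (posn_bounds k th01); have [b1' b2'] := andP (posn_bounds k' th01').
have c0 := cum_ge0 k'; have c1 := cum_mono kd; rewrite -/perim in c1.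
have [||j||yy rr] := pin_meet pk (pin_periodic pk').
- by rewrite (leq_trans kd)// leq_addl.
- by apply: posn_part => //; lra.
- case: (ltnP j d.*2) => jd.
    by move=> /andP[kj _]; apply: (@cum_eq k.+1 d.*2) => //; [rewrite -/perim; lra|rewrite kj jd].
  move=> /andP[_ jk]; rewrite -(subnK jd) width_periodic.
  apply: (@cum_eq 0 k') => //; [rewrite {1}/cum big_ord0; lra|].
  by rewrite ltn_subLR// addnC.
- by rewrite width_periodic; have /andP[t0 _] := th01'; have := mulr_ge0 t0 (width_ge0 k'); move: p0; rewrite /posn; lra.
by split=> // i /rr; rewrite rhoD2.
Qed.

Lemma pin_same k th t y k' th' t' y' : (k < d.*2)%N -> (k' < d.*2)%N ->
  pin k th t y -> pin k' th' t' y' ->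
  (y =1 y' /\ (forall i, y i != 0 -> rho k i = rho k' i)) <->
  same_angle (posn k th) (posn k' th').
Proof.
wlog kk : k th t y k' th' t' y' / (k <= k')%N => [H kd kd' pk pk'|].
  case: (leqP k k') => [|/ltnW] kk; first exact: (H k th t y k' th' t' y').
  have HH := H k' th' t' y' k th t y kk kd' kd pk' pk; split=> [[h1 h2]|/same_angleC/HH[h1 h2]].
    by apply/same_angleC/HH; split=> [i|i yi]; rewrite ?h1//; apply/esym/h2; rewrite h1.
  by split=> [i|i yi]; rewrite ?h1//; apply/esym/h2; rewrite h1.
move=> kd kd' pk pk'; have [th01 yE lay E] := pk; have [th01' yE' lay' E'] := pk'.
have [b1 b2] := andP (posn_bounds k th01); have [b1' b2'] := andP (posn_bounds k' th01').
split=> [[yy rr]|].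
  have pky : pin k' th' t' y.
    split=> //; [by move=> i; rewrite yy yE'| |by rewrite (eq_num _ yy) (eq_den yy)].
    by apply: eq_layer lay' => i; rewrite yy.
  move: kk; rewrite leq_eqVlt => /orP[/eqP kE|kk].
    left; subst k'; rewrite /posn; congr (_ + _).
    have L := len_gt0 R n_gt1 k.
    have e1 := sg_pt_kap n_gt1 w k th t; have e2 := sg_pt_succ n_gt1 w k th t.
    have e1' := sg_pt_kap n_gt1 w k th' t'; have e2' := sg_pt_succ n_gt1 w k th' t'.
    have [_ yEy _ _] := pky.
    rewrite -yE in e1; rewrite -yE in e2; rewrite -yEy in e1'; rewrite -yEy in e2'.
    rewrite e1 in e1'; rewrite e2 in e2'.
    have s1 : t * th = t' * th' by apply: (mulIf (lt0r_neq0 L)).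
    have s2 : t * (1 - th) = t' * (1 - th') by apply: (mulIf (lt0r_neq0 L)).
    have tt : t = t' by lra.
    (* At the apex [th] is undetermined, but then the slot has width 0. *)
    have [t0|tn] := eqVneq t 0; first by have -> := (width_eq0 pk).2 t0; rewrite !mulr0.
    by rewrite tt in s1 tn; rewrite (mulfI tn s1).
  (* If the slots are more than half a turn apart, the walk goes the other way, from [k'] to
     [k + d.*2], and the angles are 0 and [perim]. *)
  case: (leqP (k' - k) d) => kd2.
    rewrite -(subnKC (ltnW kk)) in pky rr.
    have [|w0 wj w1] := pin_part pk pky _ rr; first by rewrite subn_gt0 kk.
    rewrite (subnKC (ltnW kk)) in wj w1.
    left; rewrite /posn w1 addr0 -(@cum_const k.+1 k') ?cumS//; lra.
  have pk2 := pin_periodic pk; pose e := (k + d.*2 - k')%N.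
  have ke : (k + d.*2 = k' + e)%N by rewrite /e; lia.
  rewrite ke in pk2.
  have [||w0 wj w1] := pin_part pky pk2.
  - by rewrite /e -addnn; lia.
  - by move=> i /rr <-; rewrite -ke rhoD2.
  rewrite -ke width_periodic in w1.
  have wj1 j : (k' < j < d.*2)%N -> width j = 0 by move=> jj; apply: wj; lia.
  have wj2 j : (j < k)%N -> width j = 0.
    by move=> jk; rewrite -width_periodic; apply: wj; lia.
  right; left; split.
    rewrite /posn w1 addr0 -(@cum_const 0 k)//; first exact: big_ord0.
  rewrite /posn /perim -(@cum_const k'.+1 d.*2) ?cumS//; lra.
case=> [pe|[[p0 p1]|[p1 p0]]].
- move: kk; rewrite leq_eqVlt => /orP[/eqP kE|kk].
    subst k'; move: pe; rewrite /posn => /addrI/eqP; rewrite -subr_eq0 -mulrBl mulf_eq0.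
    move=> /orP[|/eqP w0].
      rewrite subr_eq0 => /eqP tt; rewrite -tt in pk' yE'; split=> // i.
      by rewrite yE yE' (pin_inj pk pk').
    split=> // i; rewrite yE yE'; have -> := (width_eq0 pk).1 w0.
    by have -> := (width_eq0 pk').1 w0; rewrite !pt0.
  have kk' := cum_mono kk.
  apply: (pin_meet pk pk' kk).
  + by apply: posn_part => //; lra.
  + by move=> j jj; apply: (@cum_eq k.+1 k') => //; lra.
  + have : posn k' th' = cum k' by lra.
    by rewrite {1}/posn; lra.
- have [yy rr] := pin_wrap kd' pk' pk p1 p0.
  by split=> [i|i yi]; rewrite ?yy//; apply/esym/rr; rewrite yy.
- exact: pin_wrap pk pk' p1 p0.
Qed.

(** If every slot were collapsed, half a turn would join the apex of slot 0 to that of slot [d]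
    without changing the pattern off the zeros, yet [rho d] negates [rho 0]. *)
Lemma perim_gt0 : 0 < perim.
Proof.
rewrite lt0r cum_ge0 andbT; apply/eqP => p0.
have w0 k : (k < d.*2)%N -> width k = 0.
  move=> kd; apply: (@cum_eq 0 d.*2) => //; first by rewrite -/perim p0 /cum big_ord0.
have pk k : (k < d.*2)%N -> pin k 0 0 (apex w k).
  move=> kd; split; first by rewrite lexx ler01.
  - by move=> i; rewrite pt0.
  - apply: (@eq_layer _ _ k (pt w k 0 0)); first exact: pt0.
    by split; [rewrite !pt0 (apex_kap n_gt1) mulr0 mul0r|exact: wit0|exact: wit0].
  - by have /eqP := w0 k kd; rewrite normr_eq0 subr_eq0 => /eqP.
have dd : (d < d.*2)%N by rewrite -addnn ltnS leq_addl.
have [||j /andP[_ jd]||_ rr] := pin_meet (pk 0%N isT) (pk d dd).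
- by [].
- by rewrite w0 ?mulr0.
- exact: w0 (ltn_trans jd dd).
- by rewrite mul0r.
have [i /rr] := apex_neq0 0; rewrite -[d in RHS]add0n rhoD; by case: (rho _ _).
Qed.

End Circle.

(** * The two rims of the collar *)

Section Caps.
Variables (R : realFieldType) (n : nat).
Hypothesis n_gt1 : (1 < n)%N.
Notation d := n.+1.
Notation kap := (@kap n).
Implicit Types (w y : 'I_d -> R) (k : nat) (th t h : R) (e : bool).

Definition capped e k y := forall i, 0 <= sgb R e * (sg R k i * y i).

Lemma sgb_mulA e k (i : 'I_d) (x : R) :
  sgb R (e (+) rho k i) * x = sgb R e * (sg R k i * x).
Proof. by rewrite sgb_addb mulrA. Qed.

(** The equality case of the triangle inequality: the rims are the points of height 1 and -1. *)
Lemma capped_height e k y : capped e k y <-> num k y = sgb R e * den y.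
Proof.
have E : num k y = sgb R e * \sum_i (sgb R e * (sg R k i * y i)).
  by rewrite mulr_sumr; apply: eq_bigr => i _; rewrite sgbK.
split=> [c|].
  rewrite E; congr (_ * _); apply: eq_bigr => i _.
  by rewrite -(sgM k i) -(norm_sgb e) ger0_norm.
rewrite E => /(congr1 ( *%R (sgb R e))); rewrite !sgbK => /eqP; rewrite -subr_eq0 -opprB oppr_eq0.
rewrite /den -sumrB psumr_eq0 => [/allP h i|i _]; last first.
  by rewrite subr_ge0 -(sgM k i) -(norm_sgb e) ler_norm.
have /eqP := h i (mem_index_enum _); have := normr_ge0 (y i).
by move=> h1 /eqP; rewrite subr_eq0 => /eqP <-.
Qed.

Lemma ext_capped e w k th t : 0 <= th <= 1 -> sgb R e * t = ext e w k th ->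
  capped e k (pt w k th t).
Proof.
move=> th01 tE i; have [t0 t1] := andP th01; have L := len_gt0 R n_gt1 k.
have e0 : 0 <= sgb R e * t by rewrite tE ext_ge0.
have [->|i1] := eqVneq i (kap k).
  rewrite (sg_pt_kap n_gt1).
  have -> : sgb R e * (t * th * len R n k) = sgb R e * t * th * len R n k by ring.
  exact: mulr_ge0 (mulr_ge0 e0 t0) (ltW L).
have [->|i2] := eqVneq i (kap k.+1).
  rewrite (sg_pt_succ n_gt1).
  have -> : sgb R e * (t * (1 - th) * len R n k) = sgb R e * t * (1 - th) * len R n k by ring.
  by rewrite (mulr_ge0 (mulr_ge0 e0 _) (ltW L))// subr_ge0.
have := @le_bigmax_cond _ _ _ 0 i (fun i => (i != kap k) && (i != kap k.+1))
  (fun i => - (sgb R e * (sg R k i * apex w k i)) / speed k th i).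
rewrite i1 i2 => /(_ isT); rewrite -/(ext e w k th) -tE ler_pdivrMr ?speed_gt0//.
by rewrite sg_pt; nra.
Qed.

Lemma capped_ext e w k th t : 0 <= th <= 1 -> wit e k (pt w k th t) ->
  capped e k (pt w k th t) -> sgb R e * t = ext e w k th.
Proof.
move=> th01 /(witP n_gt1 _ _ _ _ th01) le c; apply/eqP; rewrite eq_le le /=.
have L := len_gt0 R n_gt1 k.
apply/bigmax_leP; split=> [|i /andP[i1 i2]].
  have := c (kap k); have := c (kap k.+1); rewrite (sg_pt_kap n_gt1) (sg_pt_succ n_gt1) => h1 h2.
  have : 0 <= (sgb R e * t) * len R n k by nra.
  by rewrite pmulr_lge0.
by rewrite ler_pdivrMr ?speed_gt0//; have := c i; rewrite sg_pt; nra.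
Qed.

Lemma ext_layer e w k th t : 0 <= th <= 1 -> sgb R e * t = ext e w k th ->
  layer k (pt w k th t).
Proof.
move=> th01 tE; have := ext_ge0 false w k th; have := ext_ge0 true w k th.
by move=> e1 e2; apply: (layer_pt n_gt1) => //; move: tE; case: e; rewrite ?sgbT ?sgbF; lra.
Qed.

Lemma capped_inA e k y : capped e k y -> inA y.
Proof.
move=> c; have [k' _ kE] : exists2 k', (k' < d.*2)%N & (fun i : 'I_d => e (+) rho k i) =1 rho k'.
  by apply: noalt_rho; rewrite alt_addb rho_noalt.
by exists k' => i; rewrite -kE sgb_mulA.
Qed.

(** In a capped vector a witness for [e] must vanish, so the pattern may be flipped there, and
    [alt_flip1] or [alt_flip2] supplies the second change. *)
Lemma capped_inB e k y : layer k y -> capped e k y -> inB y.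
Proof.
move=> [_ w0 w1] c; have W : wit e k y by case: (e).
have z i : sgb R e * (sg R k i * y i) <= 0 -> y i = 0.
  move=> h; have /eqP : sgb R e * (sg R k i * y i) = 0 by apply: le_anti; rewrite h c.
  by rewrite sgb_eq0 mulf_eq0 (negbTE (sg_neq0 _ _ _)) => /eqP.
case: W => [[i0 [i1 i2 /z y0]]|[/z y0 /z y1]].
  exists (fun i => e (+) (rho k i (+) (i == i0))).
    by rewrite alt_addb; apply: (alt_flip1 n_gt1 i1 i2).
  move=> i; have [->|_] := eqVneq i i0; first by rewrite y0 mulr0.
  by rewrite addbF sgb_mulA.
exists (fun i => e (+) (rho k i (+) ((i == kap k) || (i == kap k.+1)))).
  by rewrite alt_addb; apply: (alt_flip2 n_gt1 (k := k)).
move=> i; have [->|_] := eqVneq i (kap k); first by rewrite y0 mulr0.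
have [->|_] := eqVneq i (kap k.+1); first by rewrite y1 mulr0.
by rewrite addbF sgb_mulA.
Qed.

(** Where the alternating [s] disagrees with [e (+) rho k], both signs fit and [y] vanishes.
    Disagreement nowhere, or only at one colour of the block, would leave [s] with at most one
    change; so it occurs off the block or at both of its colours, which is a witness. *)
Lemma AB_layer e y : inA y -> inB y ->
  exists k, [/\ (k < d.*2)%N, layer k y & capped e k y].
Proof.
move=> [k0 k0P] [s s_alt sP].
have [k kd kE] : exists2 k', (k' < d.*2)%N & (fun i : 'I_d => e (+) rho k0 i) =1 rho k'.
  by apply: noalt_rho; rewrite alt_addb rho_noalt.
have c : capped e k y by move=> i; rewrite -sgb_mulA -kE addKb.
have flip i : s i != e (+) rho k i -> y i = 0.
  by move=> ne; apply: (sgb_agree (sP i) _ ne); rewrite sgb_mulA; exact: c.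
exists k; split=> //.
have wN : wit (~~ e) k y by right; rewrite !sgbN !mulNr !oppr_le0; split; exact: c.
have W : wit e k y.
  have [[i [i1 i2 i3]]|none] := pselect (exists i, [/\ i != kap k, i != kap k.+1 & s i != e (+) rho k i]).
    by left; exists i; rewrite flip ?mulr0.
  have out i : i != kap k -> i != kap k.+1 -> s i = e (+) rho k i.
    by move=> i1 i2; apply/eqP; apply: contraT => i3; exfalso; apply: none; exists i.
  have kn := kap_succ_neq k (ltnW n_gt1).
  have [f1|f1] := eqVneq (s (kap k)) (e (+) rho k (kap k));
  have [f2|f2] := eqVneq (s (kap k.+1)) (e (+) rho k (kap k.+1)).
  - exfalso; move: (@rho_noalt n k); rewrite -(alt_addb e) -(@eq_alt _ s) ?s_alt// => i.
    by have [->//|i1] := eqVneq i (kap k); have [->//|i2] := eqVneq i (kap k.+1); rewrite out.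
  - exfalso; move: (@rho_noalt n k.+1); rewrite -(alt_addb e) -(@eq_alt _ s) ?s_alt// => i.
    rewrite rho_succ; have [->|i2] := eqVneq i (kap k.+1).
      by move: f2; rewrite addbT; case: (s _); case: (e); case: (rho _ _).
    by rewrite addbF; have [->//|i1] := eqVneq i (kap k); rewrite out.
  (* The slot before [k], shifted by a period so that it also exists for [k = 0]. *)
  - exfalso; move: (@rho_noalt n (k + d.*2).-1).
    rewrite -(alt_addb e) -(@eq_alt _ s) ?s_alt// => i.
    have kS : ((k + d.*2).-1).+1 = (k + d.*2)%N by rewrite prednK// addn_gt0 orbT.
    have := rho_succ (k + d.*2).-1 i; rewrite kS kapD2 rhoD2.
    have [->|i1] := eqVneq i (kap k).
      by move: f1; rewrite addbT; case: (s _); case: (e); case: (rho _ _); case: (rho _ _).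
    by rewrite addbF => <-; have [->//|i2] := eqVneq i (kap k.+1); rewrite out.
  - by right; rewrite (flip _ f1) (flip _ f2) !mulr0.
split=> //; last 2 first.
- by case: (e) W wN.
- by case: (e) W wN.
have := c (kap k); have := c (kap k.+1); case: (e); rewrite ?sgbT ?sgbF; nra.
Qed.

End Caps.

(** * Fibres of the parametrisations *)

Section Fibres.
Variables (R : realFieldType) (n : nat).
Hypothesis n_gt1 : (1 < n)%N.
Notation d := n.+1.
Notation kap := (@kap n).
Let n_gt0 : (0 < n)%N := ltnW n_gt1.
Implicit Types (c u w y : 'I_d -> R) (k : nat) (th t h r : R) (e : bool).

(** Together with [affine_layer] this shows that no point of the complex is affine, so its
    coordinates of index at least 2 can be normalised. *)
Lemma affine_notB y : affine y -> inB y -> forall i, y i = 0.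
Proof.
move=> [a [b yE]] [s /existsP[i /existsP[j /existsP[l /and4P[ij jl sij sjl]]]] sP].
have ijR : (i%:R : R) + 1 <= j%:R by rewrite natr1 ler_nat.
have jlR : (j%:R : R) + 1 <= l%:R by rewrite natr1 ler_nat.
have sli : s l = s i by move: sij sjl; case: (s i); case: (s j); case: (s l).
have sji : s j = ~~ s i by move: sij; case: (s i); case: (s j).
have := sP i; have := sP j; have := sP l; rewrite sli sji sgbN !yE.
set x : R := i%:R; set z : R := l%:R; set m : R := j%:R.
rewrite -/x -/m -/z in ijR jlR.
set S := sgb R (s i) => h1 h2 h3.
have S2 : S * S = 1 by rewrite /S; case: (s i); rewrite ?sgbT ?sgbF; ring.
have b0 : S * b = 0.
  have p1 : 0 <= (S * (b * (z - m))) by rewrite !mulrDr in h1 h2 h3 *; lra.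
  have p2 : 0 <= (S * (b * (x - m))) by rewrite !mulrDr in h1 h2 h3 *; lra.
  have q1 : 0 <= S * b by rewrite mulrA pmulr_lge0 in p1; lra.
  have q2 : S * b <= 0 by rewrite mulrA nmulr_lge0 in p2; lra.
  by apply/eqP; rewrite eq_le q1 q2.
have b1 : b = 0 by rewrite -[b]mul1r -S2 -mulrA b0 mulr0.
have a0 : S * a = 0.
  by rewrite b1 !mul0r !addr0 in h1 h2; lra.
have a1 : a = 0 by rewrite -[a]mul1r -S2 -mulrA a0 mulr0.
by move=> q; rewrite yE a1 b1 mul0r addr0.
Qed.

(** The zero vector represents the class, so every apex is 0 and both ends of each segment are at
    [t = 0]. *)
Lemma affine_layer k y : affine y -> layer k y -> forall i, y i = 0.
Proof.
move=> aff lay; pose z (i : 'I_d) : R := 0.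
have zA : affine (fun i => y i - z i).
  by apply: eq_affine aff => i; rewrite subr0.
have [ab w0 w1] := lay.
have [th [t [th01 yE]]] := pt_rep n_gt1 zA ab.
have ap i : apex z k i = 0 by rewrite /apex /interp /z; ring.
have ext0 e : ext e z k th = 0.
  apply: le_anti; rewrite ext_ge0 andbT; apply/bigmax_leP; split=> // i _.
  by rewrite ap !mulr0 oppr0 mul0r.
move/(eq_wit yE)/(witP n_gt1 _ _ _ _ th01) : w0; rewrite ext0 sgbF mul1r => t0.
move/(eq_wit yE)/(witP n_gt1 _ _ _ _ th01) : w1; rewrite ext0 sgbT mulN1r => t1.
have t00 : t = 0 by lra.
by move=> i; rewrite yE t00 /pt ap mul0r addr0.
Qed.

(* The time [r = 0] belongs to the vectors that never flow into [inA]. *)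
Definition exit r y := [/\ 0 <= r <= 1,
  r = 0 -> kco y ord0 = 0 /\ kco y (ord1' n_gt0) = 0
  & 0 < r -> inA (flow r y) /\ inB (flow r y)].

(** For exit times [0 < a < b], flowing by [a / b < 1] takes a vector of [inA] strictly out of
    [inB]. For [a = 0] the two low coordinates vanish at all times, and [kernel_notA] forbids
    [b]. *)
Lemma exit_unique r r' y : (exists i, y i != 0) -> exit r y -> exit r' y -> r = r'.
Proof.
move=> [i yi].
have fl s : 0 < s -> exists l, flow s y l != 0.
  move=> s0; apply: contrapT => nex.
  have z l : flow s y l = 0 by apply/eqP; apply: contraPT nex => ?; apply; exists l.
  have kz j : kco y j = 0.
    apply: (mulfI (expf_neq0 j (lt0r_neq0 s0))); rewrite mulr0 -kco_flow /kco big1 ?mulr0// => l _.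
    by rewrite z mulr0 mul0r.
  move/eqP: yi; apply; rewrite -(kcoK y i) /ksy big1 ?mul0r// => j _.
  by rewrite kz mul0r.
suff main a b : exit a y -> exit b y -> a < b -> False.
  by move=> e1 e2; case: (ltgtP r r') => // h; exfalso; [apply: main h|apply: main h].
move=> [/andP[a0 a1] az ap] [/andP[b0 b1] bz bp] ab.
have bpos : 0 < b by apply: le_lt_trans ab.
have [bA bB] := bp bpos.
have [a00|an] := eqVneq a 0.
  have [k0 k1] := az a00.
  apply: (@kernel_notA _ _ n_gt0 (flow b y)); rewrite ?kco_flow ?k0 ?k1 ?mulr0//.
  exact: fl.
have apos : 0 < a by rewrite lt0r an.
have [aA aB] := ap apos.
have q0 : 0 < a / b by rewrite divr_gt0.
have q1 : a / b < 1 by rewrite ltr_pdivrMr ?mul1r.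
have [e [k ok]] := flow_strict q0 q1 bA (fl b bpos).
apply: (one_change_notB ok); case: aB => s s1 s2; exists s => // l.
by rewrite flow_flow divfK ?gt_eqF.
Qed.

(** These are the coordinates of index at least 2 of [r ^- 2 * flow r y] when those of [y] are [c].
    Dividing by [r ^ 2] keeps coordinate 2 fixed and leaves no negative power at [r = 0]. *)
Definition synth r c : 'I_d -> R :=
  ksy (fun j : 'I_d => if (j < 2)%N then 0 else r ^+ (j - 2) * c j).
(* The vector that the flow carries to [r ^+ 2 * u], in a form that makes sense at
   [r = 0]. *)
Definition body r c u : 'I_d -> R :=
  ksy (fun j : 'I_d => if (j < 2)%N then r ^+ (2 - j) * kco u j else c j).

Lemma affine_synth r c u : affine (fun i => u i - synth r c i) <->
  forall j : 'I_d, (1 < j)%N -> kco u j = r ^+ (j - 2) * c j.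
Proof.
rewrite -(kco_high_affine n_gt0).
have E (j : 'I_d) : (1 < j)%N -> kco (fun i => u i - synth r c i) j = kco u j - r ^+ (j - 2) * c j.
  move=> j1; have := kco_lin 1 (-1) u (synth r c) j.
  rewrite mul1r mulN1r /synth ksyK ltnNge j1 /= => <-.
  by apply: eq_kco => i; ring.
split=> h j j1; first by have := h j j1; rewrite E// => /eqP; rewrite subr_eq0 => /eqP.
by rewrite E// h// subrr.
Qed.

Lemma flow_body r c u : affine (fun i => u i - synth r c i) ->
  flow r (body r c u) =1 (fun i => r ^+ 2 * u i).
Proof.
move=> /affine_synth uE i; apply/esym; apply: (flowE (y' := fun i => r ^+ 2 * u i)) => j.
rewrite /body ksyK.
have -> : kco (fun i => r ^+ 2 * u i) j = r ^+ 2 * kco u j.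
  have := kco_lin (r ^+ 2) 0 u u j; rewrite mul0r addr0 => <-.
  by apply: eq_kco => l; rewrite mul0r addr0.
case: ltnP => j2; first by rewrite mulrA -exprD subnKC// ltnW.
by rewrite uE// mulrA -exprD subnKC.
Qed.

Lemma body1 c u : affine (fun i => u i - synth 1 c i) -> body 1 c u =1 u.
Proof.
move=> /affine_synth uE i; rewrite -[RHS]kcoK; apply: eq_ksy => j.
by case: ltnP => j2; rewrite ?expr1n ?mul1r// uE// expr1n mul1r.
Qed.

Lemma body_flow r c y : 0 < r -> (forall j : 'I_d, (1 < j)%N -> kco y j = c j) ->
  body r c (fun i => r ^- 2 * flow r y i) =1 y.
Proof.
move=> r0 yc i; rewrite -[RHS]kcoK; apply: eq_ksy => j.
case: ltnP => j2; last by rewrite yc.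
have -> : kco (fun i => r ^- 2 * flow r y i) j = r ^- 2 * kco (flow r y) j.
  have := kco_lin (r ^- 2) 0 (flow r y) y j; rewrite mul0r addr0 => <-.
  by apply: eq_kco => l; rewrite mul0r addr0.
rewrite kco_flow mulrCA [X in _ * X]mulrA -exprD subnK ?(ltnW j2)// mulrA mulVf ?mul1r//.
by rewrite expf_neq0// gt_eqF.
Qed.

Lemma eq_body r c u u' : u =1 u' -> body r c u =1 body r c u'.
Proof.
by move=> E; apply: eq_ksy => j; case: ltnP => // _; congr (_ * _); apply: eq_kco.
Qed.

(** At radius 0 the low coordinates are lost, and all directions meet in the centre of the disc. *)
Lemma body0 c u u' : body 0 c u =1 body 0 c u'.
Proof.
apply: eq_ksy => j; case: ltnP => // j2; rewrite !expr0n.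
have -> : (2 - j == 0)%N = false by lia.
by rewrite !mul0r.
Qed.

Section State.
Variable c : 'I_d -> R.
Hypothesis c_neq0 : exists2 j : 'I_d, (1 < j)%N & c j != 0.

Lemma sgb_inj : injective (@sgb R).
Proof. by case=> [] []; rewrite ?sgbT ?sgbF // => h; exfalso; lra. Qed.

Definition apt r k th t := pt (synth r c) k th t.
(* [None] is the collar and [Some e] the disc of sign [e]. *)
Definition fits (K : option bool) k th t r h := 0 <= th <= 1 /\
  match K with
  | None => [/\ r = 1, layer k (apt 1 k th t) & num k (apt 1 k th t) = h * den (apt 1 k th t)]
  | Some e => [/\ 0 <= r <= 1, h = sgb R e & sgb R e * t = ext e (synth r c) k th]
  end.
(** The sign [tau] of colour [i]; in the collar it is recovered from [sigma] and the pattern of the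
    slot. *)
Definition letter (K : option bool) k y (i : 'I_d) : bool :=
  match K with None => (y i < 0) (+) rho k i | Some e => e end.

Lemma synth_naff r : 0 < r -> ~ affine (synth r c).
Proof.
move=> r0 /(kco_high_affine n_gt0) h; case: c_neq0 => j j1 /eqP; apply.
have := h j j1; rewrite ksyK ltnNge j1 /= => /eqP.
by rewrite mulf_eq0 expf_eq0 (gt_eqF r0) andbF /= => /eqP.
Qed.

Lemma body_neq0 r u : exists i, body r c u i != 0.
Proof.
apply: contrapT => nex; case: c_neq0 => j j1 /eqP; apply.
have <- : kco (body r c u) j = c j by rewrite ksyK ltnNge j1.
rewrite /kco big1 ?mulr0// => i _; have -> : body r c u i = 0.
  by apply/eqP; apply: contraPT nex => ?; apply; exists i.
by rewrite mulr0 mul0r.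
Qed.

Section Fit.
Variables (K : option bool) (k : nat) (th t r h : R).
Hypothesis fit : fits K k th t r h.
Let u := apt r k th t.
Let y := body r c u.

Lemma fits_r : 0 <= r <= 1.
Proof. by case: fit => _; case: K => [e []|[-> _ _]] //; rewrite ler01 lexx. Qed.

(** After flowing and rescaling, a disc point is the end of a segment, of height [sgb R e]; so discs
    at every positive radius obey the same circle lemmas as the collar. *)
Lemma fits_pin : 0 < r -> pin (synth r c) h k th t u.
Proof.
move=> r0; case: fit => th01; rewrite /u; case: K => [e [_ -> tE]|[-> lay E]]; split=> //.
  exact: ext_layer tE.
by apply/capped_height; exact: ext_capped.
Qed.

Lemma flow_state : flow r y =1 (fun i => r ^+ 2 * u i).
Proof. exact/flow_body/affine_pt. Qed.

Lemma letter_state i : u i != 0 -> letter K k u i = (u i < 0) (+) rho k i.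
Proof.
case: fit => th01; case: K => [e [_ _ tE]|] // ui.
have := ext_capped n_gt1 th01 tE i; rewrite -/(apt r k th t) -/u -sgb_mulA => h0.
rewrite /letter; have := sgb_lt0 (u i) => h1.
have := sgb_agree h0 h1; case: eqP => [<- _|_ /(_ isT)/eqP]; last by rewrite (negbTE ui).
by rewrite addbK.
Qed.

Lemma state_unit : r = 1 -> y =1 u.
Proof. by move=> r1; rewrite /y /u r1; exact/body1/affine_pt. Qed.

Lemma exit_of e : capped e k u -> layer k u -> exit r y.
Proof.
move=> cu lu; split; first exact: fits_r.
  move=> r0; rewrite /y /body !ksyK /= r0 !expr0n /= !mul0r //.
move=> r0; have r2 : 0 < r ^+ 2 by rewrite exprn_gt0.
have sc b i : (0 <= sgb R b * flow r y i) = (0 <= sgb R b * u i).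
  by rewrite flow_state mulrCA pmulr_rge0.
split.
  by have [k' kP] := capped_inA cu; exists k' => i; rewrite sc.
by have [s s1 s2] := capped_inB n_gt1 lu cu; exists s => // i; rewrite sc.
Qed.

(** A collar point whose letters all equal [e] is capped, hence on the rim of the disc [e], with
    exit time 1. *)
Lemma state_exit e : (forall i, y i != 0 -> letter K k y i = e) -> exit r y /\ h = sgb R e.
Proof.
have ee := exit_of; have su := state_unit; have [i0 yi0] := body_neq0 r u.
case: fit => th01; move: ee; case EK: K => [e'|] ee.
  move=> [r01 hE tE] /(_ i0 yi0) /= <-; split=> //; apply: (ee e').
    exact: ext_capped tE.
  exact: ext_layer tE.
move=> [r1 lay E] le; have yu := su r1.
have uE : u = apt 1 k th t by rewrite /u r1.
rewrite -uE in lay E.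
have cu : capped e k u.
  move=> i; rewrite -sgb_mulA; have [->|ui] := eqVneq (u i) 0; first by rewrite mulr0.
  have := le i; rewrite yu => /(_ ui) /= <-; rewrite yu addbK; exact: sgb_lt0.
split; first exact: ee cu lay.
have /capped_height := cu; rewrite E; apply: mulIf; apply: lt0r_neq0.
by apply: den_gt0; exists i0; rewrite -yu.
Qed.

End Fit.

Lemma disc_of K k th t r h : fits K k th t r h -> r != 1 -> exists e, K = Some e /\ h = sgb R e.
Proof. by case: K => [e [_ [_ hE _]] _|[_ [-> _ _]]]; [exists e|rewrite eqxx]. Qed.

Lemma eq_letter K k y y' : y =1 y' -> letter K k y =1 letter K k y'.
Proof. by move=> E i; case: K => //=; rewrite E. Qed.

(** If either point is in a disc, the letters are constant; then [r] is recovered as the unique exit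
    time and [h] as the sign of the letters. For two collar points both radii are 1 and the height
    is computed from [y] and its letters. The angle, for positive [r], is left to [pin_same]. *)
Lemma fibre K k th t r h K' k' th' t' r' h' : (k < d.*2)%N -> (k' < d.*2)%N ->
  fits K k th t r h -> fits K' k' th' t' r' h' ->
  let y := body r c (apt r k th t) in
  let y' := body r' c (apt r' k' th' t') in
  (y =1 y' /\ (forall i, y i != 0 -> letter K k y i = letter K' k' y' i)) <->
  [/\ r = r', h = h' & r = 0 \/
     same_angle (synth r c) h (posn (synth r c) h k th) (posn (synth r c) h k' th')].
Proof.
move=> kd kd' fit fit' y y'.
have [i0 yi0] := body_neq0 r (apt r k th t).
have key : r = r' -> h = h' -> 0 < r ->
    (apt r k th t =1 apt r' k' th' t' /\ (forall i, apt r k th t i != 0 -> rho k i = rho k' i)) <->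
     same_angle (synth r c) h (posn (synth r c) h k th) (posn (synth r c) h k' th').
  move=> rr hh r0; subst r' h'.
  exact: (pin_same n_gt1 kd kd' (fits_pin fit r0) (fits_pin fit' r0)).
have fl := flow_state k th t r; have fl' := flow_state k' th' t' r'.
have r01 := fits_r fit; have r01' := fits_r fit'.
split=> [[yy ll]|[rr hh]].
  have [rr hh] : r = r' /\ h = h'.
    have aux e : (forall i, y i != 0 -> letter K k y i = e) -> r = r' /\ h = h'.
      move=> le; have [ex hE] := state_exit fit le.
      have [|ex' hE'] := state_exit fit' (e := e).
        by move=> i yi; rewrite -/y' -ll ?le// yy.
      split; last by rewrite hE hE'.
      apply: (exit_unique _ ex); first by exists i0.
      have [x1 x2 x3] := ex'; split=> //.
        by move=> /x2[]; rewrite -!(eq_kco yy).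
      by move=> /x3[[q qP] [s s1 s2]]; split; [exists q|exists s] => // i;
        rewrite (eq_flow r' yy).
    case EK: K => [e|]; first by apply: (aux e) => i _; rewrite EK.
    case EK': K' => [e|]; first by apply: (aux e) => i yi; rewrite ll// EK'.
    move: fit fit'; rewrite EK EK' => -[_ [r1 _ E]] [_ [r1' _ E']]; split; first by rewrite r1 r1'.
    have yu : y =1 apt 1 k th t by have := @state_unit k th t r r1; rewrite {3}r1.
    have yu' : y' =1 apt 1 k' th' t' by have := @state_unit k' th' t' r' r1'; rewrite {3}r1'.
    rewrite -!(eq_num _ yu) -!(eq_den yu) in E.
    rewrite -!(eq_num _ yu') -!(eq_den yu') -!(eq_den yy) in E'.
    apply: (mulIf (x := den y)); first by apply: lt0r_neq0; apply: den_gt0; exists i0.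
    rewrite -E -E'; apply: eq_bigr => i _; rewrite -yy.
    have [->|yi] := eqVneq (y i) 0; first by rewrite !mulr0.
    by have := ll i yi; rewrite EK EK' /letter -yy => /addbI; rewrite /sg => ->.
  split=> //; have [r0|r0] := eqVneq r 0; [by left|right].
  have rp : 0 < r by rewrite lt0r r0; case/andP: r01.
  have uu : apt r k th t =1 apt r' k' th' t'.
    move=> i; apply: (mulfI (expf_neq0 2 r0)); rewrite -fl [in RHS]rr -[RHS]fl'.
    rewrite -/y -/y' (eq_flow _ yy); by rewrite rr.
  apply/(key rr hh rp); split=> // i ui.
  have := letter_state fit ui; rewrite uu in ui *.
  have := letter_state fit' ui => E' E; apply: (@addbI (apt r' k' th' t' i < 0)).
  rewrite -E -E'; have [r1|r1] := eqVneq r 1.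
    have yu : y =1 apt r k th t by exact: state_unit.
    have yu' : y' =1 apt r' k' th' t' by apply: state_unit; rewrite -rr.
    by rewrite -(eq_letter K k yu) -(eq_letter K' k' yu'); apply: ll; rewrite yy yu'.
  have := ll i0 yi0; have [e [-> _]] := disc_of fit r1.
  by rewrite rr in r1; have [e' [-> _]] := disc_of fit' r1.
have [r0|r0] := eqVneq r 0.
  have r1 : r != 1 by rewrite r0 eq_sym oner_eq0.
  have [e [-> he]] := disc_of fit r1; rewrite rr in r1; have [e' [-> he']] := disc_of fit' r1.
  split=> [i|i _ /=]; last by apply: sgb_inj; rewrite -he -he' hh.
  by rewrite /y /y' -rr r0; exact: body0.
case=> [/eqP|sa]; first by rewrite (negbTE r0).
have rp : 0 < r by rewrite lt0r r0; case/andP: r01.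
have [uu rk] := (key rr hh rp).2 sa.
have yy : y =1 y' by move=> i; rewrite /y /y' -rr; apply: eq_body => l; rewrite uu rr.
split=> // i yi; have [r1|r1] := eqVneq r 1; last first.
  have [e [-> he]] := disc_of fit r1; rewrite rr in r1; have [e' [-> he']] := disc_of fit' r1.
  by apply: sgb_inj; rewrite -he -he' hh.
have yu : y =1 apt r k th t by exact: state_unit.
have yu' : y' =1 apt r' k' th' t' by apply: state_unit; rewrite -rr.
have ui : apt r k th t i != 0 by rewrite -yu.
have ui' : apt r' k' th' t' i != 0 by rewrite -uu.
rewrite (eq_letter K k yu) (eq_letter K' k' yu') (letter_state fit ui) (letter_state fit' ui').
by rewrite rk// uu.
Qed.

End State.

End Fibres.

Local Open Scope classical_set_scope.
Local Open Scope ring_scope.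

(** * Topology *)

Lemma hausdorff_inj (X T : topologicalType) (f : X -> T) :
  continuous f -> injective f -> hausdorff_space T -> hausdorff_space X.
Proof.
move=> cf inj hT p q pq; apply: inj; apply: hT => A B nA nB.
have [x [xA xB]] := pq _ _ (cf p _ nA) (cf q _ nB).
by exists (f x).
Qed.

(** The preimage of a closed set is a finite union of images of closed, hence compact, subsets of
    [Z]. *)
Lemma descend_continuous (I : finType) (Z X Y : topologicalType)
    (q : I -> Z -> X) (r : I -> Z -> Y) (f : X -> Y) :
  compact [set: Z] -> hausdorff_space X ->
  (forall i, continuous (q i)) -> (forall i, continuous (r i)) ->
  (forall x, exists i z, q i z = x) -> (forall i z, f (q i z) = r i z) -> continuous f.
Proof.
move=> cZ hX cq cr q_surj fq; apply/continuous_closedP => C cC.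
have -> : f @^-1` C = \bigcup_(i in [set: I]) (q i @` (r i @^-1` C)).
  apply/seteqP; split=> x; last by move=> [i _ [z zC <-]]; rewrite /preimage /= fq.
  by have [i [z <-]] := q_surj x; rewrite /preimage /= fq => rC; exists i => //; exists z.
apply: closed_bigcup => [|i _]; first exact: finite_finset.
apply: compact_closed => //; apply: continuous_compact; first exact: continuous_subspaceT.
apply: subclosed_compact cZ _ => //.
by move/continuous_closedP: (cr i); apply.
Qed.

Lemma glue_homeomorphic (I : finType) (Z X Y : topologicalType)
    (q : I -> Z -> X) (r : I -> Z -> Y) :
  compact [set: Z] -> hausdorff_space X -> hausdorff_space Y ->
  (forall i, continuous (q i)) -> (forall i, continuous (r i)) ->
  (forall x, exists i z, q i z = x) -> (forall y, exists i z, r i z = y) ->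
  (forall i j z z', q i z = q j z' <-> r i z = r j z') -> homeomorphic X Y.
Proof.
move=> cZ hX hY cq cr q_surj r_surj qr.
have sel (T : Type) (g : I -> Z -> T) : (forall x, exists i z, g i z = x) ->
    {s : T -> I * Z | forall x, g (s x).1 (s x).2 = x}.
  move=> gs; have h x : exists p : I * Z, g p.1 p.2 = x.
    by have [i [z <-]] := gs x; exists (i, z).
  by exists (fun x => sval (cid (h x))) => x; exact: (svalP (cid (h x))).
have [s sP] := sel _ _ q_surj; have [s' s'P] := sel _ _ r_surj.
(* Defined through chosen preimages; equality of fibres makes the choice irrelevant. *)
pose f x := r (s x).1 (s x).2; pose g y := q (s' y).1 (s' y).2.
have fq i z : f (q i z) = r i z by apply/qr; exact: sP.
have gr i z : g (r i z) = q i z by apply/qr; exact: s'P.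
exists f, g; split.
- by move=> x; rewrite -[in RHS](sP x) -gr.
- by move=> y; rewrite -[in RHS](s'P y) -fq.
- exact: descend_continuous fq.
- exact: descend_continuous gr.
Qed.

(** * Continuity at a point *)

Section Continuity.
Variables (R : realType) (Z : topologicalType) (z : Z).
Implicit Types f g : Z -> R.
Definition ct f : Prop := {for z, continuous f}.

Lemma eq_ct f g : f =1 g -> ct f -> ct g.
Proof. by move=> /funext ->. Qed.

Lemma ct_cst (a : R) : ct (fun=> a).
Proof. exact: cvg_cst. Qed.

Lemma ctD f g : ct f -> ct g -> ct (fun x => f x + g x).
Proof. exact: cvgD. Qed.

Lemma ctN f : ct f -> ct (fun x => - f x).
Proof. exact: cvgN. Qed.

Lemma ctB f g : ct f -> ct g -> ct (fun x => f x - g x).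
Proof. exact: cvgB. Qed.

Lemma ctM f g : ct f -> ct g -> ct (fun x => f x * g x).
Proof. exact: cvgM. Qed.

Lemma ctV f : f z != 0 -> ct f -> ct (fun x => (f x)^-1).
Proof. exact: cvgV. Qed.

Lemma ct_div f g : g z != 0 -> ct f -> ct g -> ct (fun x => f x / g x).
Proof. by move=> g0 cf cg; apply: ctM => //; exact: ctV. Qed.

Lemma ctX f m : ct f -> ct (fun x => f x ^+ m).
Proof.
move=> cf; elim: m => [|m IH].
  by apply: (eq_ct _ (@ct_cst 1)) => x; rewrite expr0.
by apply: (eq_ct _ (ctM cf IH)) => x; rewrite exprS.
Qed.

Lemma ct_norm f : ct f -> ct (fun x => `|f x|).
Proof. exact: cvg_norm. Qed.

Lemma ct_max f g : ct f -> ct g -> ct (fun x => Num.max (f x) (g x)).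
Proof. exact: continuous_max. Qed.

Lemma ct_sum (I : Type) (s : seq I) (P : pred I) (F : I -> Z -> R) :
  (forall i, P i -> ct (F i)) -> ct (fun x => \sum_(i <- s | P i) F i x).
Proof. by move=> cF; apply: cvg_big => //; exact: add_continuous. Qed.

Lemma ct_prod (I : Type) (s : seq I) (P : pred I) (F : I -> Z -> R) :
  (forall i, P i -> ct (F i)) -> ct (fun x => \prod_(i <- s | P i) F i x).
Proof. by move=> cF; apply: cvg_big => //; exact: mul_continuous. Qed.

Lemma ct_bigmax (I : Type) (s : seq I) (P : pred I) (F : I -> Z -> R) :
  (forall i, P i -> ct (F i)) -> ct (fun x => \big[Num.max/0]_(i <- s | P i) F i x).
Proof.
move=> cF; elim: s => [|i s IH].
  by apply: (eq_ct _ (@ct_cst 0)) => x; rewrite big_nil.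
case Pi : (P i); last by apply: (eq_ct _ IH) => x; rewrite big_cons Pi.
by apply: (eq_ct _ (ct_max (cF i Pi) IH)) => x; rewrite big_cons Pi.
Qed.

Lemma ct_comp (h : R -> R) f : continuous h -> ct f -> ct (fun x => h (f x)).
Proof. by move=> ch cf; apply: continuous_comp => //; exact: ch. Qed.

Lemma ct_bounded (f g : Z -> R) (M : R) : f z = 0 -> ct f ->
  (forall x, `|g x| <= M) -> ct (fun x => f x * g x).
Proof.
move=> f0 cf gM; apply/cvgrPdist_lt => e e0; rewrite f0 mul0r.
have M0 : 0 < `|M| + 1 by rewrite ltr_wpDl.
have := (cvgrPdist_lt _ _).1 cf _ (divr_gt0 e0 M0); rewrite f0 => /(_ (nbhs_filter z)); apply: filterS => x /=.
rewrite !sub0r !normrN ltr_pdivlMr// normrM; apply: le_lt_trans.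
rewrite ler_wpM2l//; apply: le_trans (gM x) _.
by have := ler_norm M; lra.
Qed.

Lemma ct_rV m (F : Z -> 'rV[R]_m) : (forall j, ct (fun x => F x ord0 j)) -> {for z, continuous F}.
Proof.
move=> cF; apply/cvg_ballP => e e0; rewrite near_simpl.
have H : \forall x \near z, forall j, ball (F z ord0 j) e (F x ord0 j).
  by apply: filter_forall => j; have /cvg_ballP/(_ _ e0) := cF j.
apply: filterS H => x xH; split=> // i j; rewrite ord1; exact: xH.
Qed.

Lemma ct_ptws (V : choiceType) (F : Z -> {ptws V -> R}) :
  (forall v, ct (fun x => F x v)) -> {for z, continuous F}.
Proof.
move=> cF; apply/cvg_sup => v U [_ [[W oW <-]] /= Wz sU].
by apply: filterS sU _; apply: cF; exact: open_nbhs_nbhs.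
Qed.

End Continuity.

(** * Exit times and the cylinder *)

Section Exit.
Variables (R : realType) (n : nat).
Notation d := n.+1.
Implicit Types (y : 'I_d -> R) (r : R).

(* By [AorB] the product [defectA * defectB] is zero, so a zero of the difference,
   given by the intermediate value theorem, lies in both sets. *)
Definition defect (s : 'I_d -> bool) y : R := \sum_i Num.max 0 (- (sgb R (s i) * y i)).
Definition defectA y : R := \prod_(k < d.*2) defect (rho k) y.
Definition defectB y : R := \prod_(s : {ffun 'I_d -> bool} | alt s) defect s y.

Lemma defect_ge0 s y : 0 <= defect s y.
Proof. by apply: sumr_ge0 => i _; rewrite le_max lexx. Qed.

Lemma defect_eq0 s y : reflect (forall i, 0 <= sgb R (s i) * y i) (defect s y == 0).
Proof.
rewrite psumr_eq0 => [|i _]; last by rewrite le_max lexx.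
apply: (iffP allP) => h i; last first.
  by move=> _ /=; apply/eqP/max_idPl; rewrite oppr_le0.
have /eqP/max_idPl := h i (mem_index_enum _); by rewrite oppr_le0.
Qed.

Lemma defectA_eq0 y : defectA y = 0 <-> inA y.
Proof.
split=> [/eqP/prodf_eq0[k _ /defect_eq0 h]|[k0 h]]; first by exists k.
apply/eqP/prodf_eq0; have [k kd kE] := noalt_rho (@rho_noalt n k0).
by exists (Ordinal kd) => //; apply/defect_eq0 => i; rewrite -kE.
Qed.

Lemma defectB_eq0 y : defectB y = 0 <-> inB y.
Proof.
split=> [/eqP/prodf_eq0[s s_alt /defect_eq0 h]|[s s_alt h]]; first by exists s.
apply/eqP/prodf_eq0; exists [ffun i => s i]; last by apply/defect_eq0 => i; rewrite ffunE.
by rewrite (@eq_alt _ _ s)// => i; rewrite ffunE.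
Qed.

Lemma ct_flow y i r : ct r (fun s => flow s y i).
Proof.
rewrite /flow /ksy; apply: ctM; last exact: ct_cst.
apply: ct_sum => j _; apply: ctM; last exact: ct_cst.
by apply: ctM; [apply: ctX; exact: cvg_id|exact: ct_cst].
Qed.

Lemma ct_defect (s : 'I_d -> bool) y r : ct r (fun q => defect s (flow q y)).
Proof.
apply: ct_sum => i _; apply: ct_max; first exact: ct_cst.
by apply: ctN; apply: ctM; [exact: ct_cst|exact: ct_flow].
Qed.

Lemma exit_exists y r0 : 0 < r0 <= 1 -> inA (flow r0 y) -> inB y ->
  exists r, [/\ 0 < r <= 1, inA (flow r y) & inB (flow r y)].
Proof.
move=> /andP[r00 r01] hA hB.
pose f r := defectA (flow r y) - defectB (flow r y).
have cf : continuous f.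
  by move=> r; apply: ctB; apply: ct_prod => k _; exact: ct_defect.
have a0 z : 0 <= defectA z by apply: prodr_ge0 => k _; exact: defect_ge0.
have b0 z : 0 <= defectB z by apply: prodr_ge0 => k _; exact: defect_ge0.
(* At time 1 [defectB] vanishes and at time [r0] [defectA] does, so [f] has opposite signs at the
   two ends. *)
have [|r rI fr] := @IVT R f r0 1 0 r01 (continuous_subspaceT cf).
  have -> : f 1 = defectA (flow 1 y).
    rewrite /f (_ : defectB _ = 0) ?subr0//; apply/defectB_eq0.
    by case: hB => s s1 s2; exists s => // i; rewrite flow1.
  have -> : f r0 = - defectB (flow r0 y) by rewrite /f (defectA_eq0 _).2 ?sub0r.
  by rewrite ge_min le_max oppr_le0 b0 a0 orbT.
move: rI; rewrite in_itv /= => /andP[rr r1].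
have AB : defectA (flow r y) = defectB (flow r y) by apply/eqP; rewrite -subr_eq0 -/(f r) fr.
exists r; rewrite (lt_le_trans r00 rr) r1; have [h|h] := AorB (flow r y); split=> //.
  by apply/defectB_eq0; rewrite -AB; exact/defectA_eq0.
by apply/defectA_eq0; rewrite AB; exact/defectB_eq0.
Qed.

End Exit.

(** * The boundary of a cylinder as a 2-sphere *)

Section Cylinder.
Variable R : realType.
Implicit Types (a h x y : R).

Definition turn a : R * R := (cos (2 * pi * a), sin (2 * pi * a)).

Lemma turn_eq a a' : 0 <= a <= 1 -> 0 <= a' <= 1 ->
  turn a = turn a' <-> [\/ a = a', a = 0 /\ a' = 1 | a = 1 /\ a' = 0].
Proof.
move=> /andP[a0 a1] /andP[b0 b1]; have p0 := pi_gt0 R.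
have c1 : cos (2 * pi : R) = 1 by rewrite mulrC mulr_natr cos2pi.
have s1 : sin (2 * pi : R) = 0 by rewrite mulrC mulr_natr sin2pi.
split; last first.
  by case=> [->//|[-> ->]|[-> ->]]; rewrite /turn mulr1 mulr0 cos0 sin0 c1 s1.
case=> hc hs.
(* The difference of the two angles has cosine 1, so its half, which lies between [- pi] and [pi],
   has sine 0. *)
have : sin (pi * (a - a')) = 0.
  have e : cos (2 * pi * a - 2 * pi * a') = 1.
    by rewrite cosB hc hs -!expr2 cos2Dsin2.
  have ee : 2 * pi * a - 2 * pi * a' = (pi * (a - a')) *+ 2 by rewrite mulr2n; ring.
  move: e; rewrite ee cos_mulr2n => e.
  have := cos2Dsin2 (pi * (a - a')) => e2.
  by apply/eqP; rewrite -sqrf_eq0; apply/eqP; rewrite mulr2n in e; lra.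
case: (ltgtP a a') => [ab|ab|->]; last by constructor 1.
- have [ab1|ab1] := eqVneq (a' - a) 1; first by move=> _; constructor 2; split; lra.
  have : 0 < sin (pi * (a' - a)).
    have l1 : a' - a < 1 by rewrite lt_neqAle ab1; lra.
    by apply: sin_gt0_pi; rewrite mulr_gt0 ?subr_gt0//= gtr_pMr.
  have -> : pi * (a' - a) = - (pi * (a - a')) by ring.
  by rewrite sinN => h e; rewrite e oppr0 ltxx in h.
- have [ab1|ab1] := eqVneq (a - a') 1; first by move=> _; constructor 3; split; lra.
  have l1 : a - a' < 1 by rewrite lt_neqAle ab1; lra.
  have : 0 < sin (pi * (a - a')).
    by apply: sin_gt0_pi; rewrite mulr_gt0 ?subr_gt0//= gtr_pMr.
  by move=> h e; rewrite e ltxx in h.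
Qed.

Lemma turn_surj x y : x ^+ 2 + y ^+ 2 = 1 -> exists2 a, 0 <= a <= 1 & turn a = (x, y).
Proof.
move=> xy; have p0 := pi_gt0 R.
have x1 : -1 <= x <= 1 by have := sqr_ge0 y; move=> y0; apply/andP; split; nra.
have A0 := acos_ge0 x1; have A1 := acos_lepi x1.
have y1 : 1 - x ^+ 2 = y ^+ 2 by lra.
have hs : sin (acos x) = `|y| by rewrite sin_acos// y1 sqrtr_sqr.
have hc : cos (acos x) = x by rewrite acosK ?in_itv.
have b01 : 0 <= acos x / (2 * pi) <= 1.
  by apply/andP; split; [apply: divr_ge0|rewrite ler_pdivrMr]; lra.
have bE : 2 * pi * (acos x / (2 * pi)) = acos x.
  by rewrite mulrC divfK// mulf_neq0 ?pnatr_eq0// gt_eqF.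
case: (lerP 0 y) => y0.
  by exists (acos x / (2 * pi)) => //; rewrite /turn bE hc hs ger0_norm.
exists (1 - acos x / (2 * pi)); first by move: b01; set b := _ / _; lra.
rewrite /turn mulrBr bE mulr1 addrC mulrC mulr_natr.
by rewrite cosD2pi sinD2pi cosN sinN hc hs ltr0_norm ?opprK.
Qed.

Definition onto_sphere (s a h : R) : 'rV[R]_3 := \row_(j < 3)
  ([:: s * (turn a).1; s * (turn a).2; h]`_j / Num.sqrt (s ^+ 2 + h ^+ 2)).

(* The boundary of the cylinder with radius 1 and heights between -1 and 1. *)
Definition on_can (s h : R) := [/\ 0 <= s <= 1, `|h| <= 1 & s = 1 \/ `|h| = 1].

Lemma can_gt0 s h : on_can s h -> 0 < s ^+ 2 + h ^+ 2.
Proof.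
have := sqr_ge0 s; have := sqr_ge0 h; rewrite -(real_normK (num_real h)) => h0 s0.
by case=> _ _ [->|->]; rewrite expr1n; lra.
Qed.

Lemma sum3 (F : 'I_3 -> R) : \sum_i F i = F 0 + F 1 + F (inord 2).
Proof.
rewrite !big_ord_recl big_ord0 addr0 addrA; congr (_ + _ + _); congr F; apply: val_inj => //=.
by rewrite inordK.
Qed.

Lemma onto_sphereP s a h : on_can s h -> sphere R 2 (onto_sphere s a h).
Proof.
move=> can; have N0 := can_gt0 can; rewrite /sphere /= sum3 !mxE /= inordK//=.
rewrite !expr_div_n sqr_sqrtr ?ltW// -!mulrDl -[RHS](divff (lt0r_neq0 N0)); congr (_ / _).
by rewrite !exprMn -mulrDr cos2Dsin2 mulr1.
Qed.

(** Points with the same radial projection are proportional, with ratio [l]; the larger of radius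
    and absolute height is 1 for both, so [l = 1]. *)
Lemma onto_sphere_inj s a h s' a' h' : on_can s h -> on_can s' h' ->
  onto_sphere s a h = onto_sphere s' a' h' <->
  [/\ s = s', h = h' & s = 0 \/ turn a = turn a'].
Proof.
move=> can can'; have N0 := can_gt0 can; have N0' := can_gt0 can'.
split; last first.
  case=> -> -> tt; apply/rowP => j; rewrite !mxE; congr (_ / _).
  by case: tt => [->|->//]; rewrite !mul0r.
move=> E; pose N := Num.sqrt (s ^+ 2 + h ^+ 2); pose N' := Num.sqrt (s' ^+ 2 + h' ^+ 2).
have n0 : 0 < N by rewrite sqrtr_gt0.
have n0' : 0 < N' by rewrite sqrtr_gt0.
pose l := N / N'; have l0 : 0 < l by rewrite divr_gt0.
have key (b b' : R) : b / N = b' / N' -> b = l * b'.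
  by move=> e; rewrite -[LHS](divfK (lt0r_neq0 n0)) e /l mulrC mulrA mulrAC.
have := congr1 (fun v : 'rV_3 => v 0 0) E; have := congr1 (fun v : 'rV_3 => v 0 1) E.
have := congr1 (fun v : 'rV_3 => v 0 (inord 2)) E; rewrite !mxE /= inordK//=.
move=> /key hh /key h2 /key h1.
have c1 := cos2Dsin2 (2 * pi * a); have c2 := cos2Dsin2 (2 * pi * a').
have [/andP[s0 s1] hl sh] := can; have [/andP[s0' s1'] hl' sh'] := can'.
have ss : s = l * s'.
  apply/eqP; rewrite -(@eqrXn2 _ 2)//; last by rewrite mulr_ge0// ltW.
  have sq (b e f : R) : e ^+ 2 + f ^+ 2 = 1 -> b ^+ 2 = (b * e) ^+ 2 + (b * f) ^+ 2.
    by move=> ef; rewrite !exprMn -mulrDr ef mulr1.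
  by apply/eqP; rewrite (sq s _ _ c1) h1 h2 (sq (l * s') _ _ c2) !mulrA.
have nh : `|h| = l * `|h'| by rewrite hh normrM gtr0_norm.
have l1 : l = 1.
  apply: le_anti; apply/andP; split; [case: sh'|case: sh] => e.
  - by rewrite e mulr1 in ss; rewrite -ss.
  - by rewrite e mulr1 in nh; rewrite -nh.
  - by rewrite -e ss ler_piMr// ltW.
  - by rewrite -e nh ler_piMr// ltW.
rewrite l1 !mul1r in ss hh h1 h2.
split=> //; have [->|sn] := eqVneq s 0; [by left|right].
rewrite -ss in h1 h2; by rewrite /turn (mulfI sn h1) (mulfI sn h2).
Qed.

Lemma onto_sphere_surj v : sphere R 2 v ->
  exists s a h, [/\ on_can s h, 0 <= a <= 1 & onto_sphere s a h = v].
Proof.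
rewrite /sphere /= sum3; set x := v _ _; set y := v _ _; set z := v _ _ => xyz.
pose q := Num.sqrt (x ^+ 2 + y ^+ 2).
have q0 : 0 <= q by exact: sqrtr_ge0.
have q2 : q ^+ 2 = x ^+ 2 + y ^+ 2 by rewrite sqr_sqrtr// addr_ge0 ?sqr_ge0.
(* Dividing by the larger of radius and absolute height moves the point radially onto the can. *)
pose m := Num.max q `|z|.
have z2 : `|z| ^+ 2 = z ^+ 2 by rewrite real_normK// num_real.
have m0 : 0 < m.
  rewrite lt_neqAle le_max q0 andbT eq_sym; apply/eqP => m0.
  have : q <= m by rewrite le_max lexx.
  have : `|z| <= m by rewrite le_max lexx orbT.
  by rewrite m0; have := normr_ge0 z; nra.
have [a a01 aE] : exists2 a, 0 <= a <= 1 & q * (turn a).1 = x /\ q * (turn a).2 = y.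
  have [e|qn] := eqVneq q 0.
    exists 0; rewrite ?lexx ?ler01//; rewrite e !mul0r.
    have x20 : x ^+ 2 = 0 by have := sqr_ge0 x; have := sqr_ge0 y; rewrite e expr0n /= in q2; lra.
    have y20 : y ^+ 2 = 0 by have := sqr_ge0 x; have := sqr_ge0 y; rewrite e expr0n /= in q2; lra.
    by split; apply/esym/eqP; rewrite -sqrf_eq0; apply/eqP.
  have [|a a01 aE] := @turn_surj (x / q) (y / q).
    by rewrite !expr_div_n -mulrDl -q2 divff// expf_neq0.
  by exists a => //; rewrite aE /=; split; rewrite mulrC divfK.
exists (q / m), a, (z / m); split=> //.
  split.
  - by rewrite (divr_ge0 q0 (ltW m0)) ler_pdivrMr// mul1r le_max lexx.
  - by rewrite normrM normfV (gtr0_norm m0) ler_pdivrMr// mul1r le_max lexx orbT.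
  - rewrite normrM normfV (gtr0_norm m0); have : m = q \/ m = `|z|.
      by rewrite /m; case: leP; [right|left].
    by case=> e; [left|right]; rewrite -e divff ?gt_eqF.
have N1 : Num.sqrt ((q / m) ^+ 2 + (z / m) ^+ 2) = m^-1.
  by rewrite !expr_div_n -mulrDl q2 xyz mul1r -exprVn sqrtr_sqr ger0_norm// invr_ge0 ltW.
have [a1 a2] := aE; apply/rowP => j; rewrite !mxE N1 invrK.
have mm (b : R) : b / m * m = b by rewrite divfK// gt_eqF.
case: j => -[|[|[|//]]] jl /=.
- rewrite mulrAC mm a1; congr (v _ _); exact: val_inj.
- rewrite mulrAC mm a2; congr (v _ _); exact: val_inj.
- rewrite mm; congr (v _ _); apply: val_inj; by rewrite /= inordK.
Qed.

End Cylinder.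

(** * The complex *)

Section Words.
Variables (R : realFieldType) (n : nat).
Notation d := n.+1.
Notation V := ('I_d * (bool * bool))%type.
Implicit Types (y : 'I_d -> R) (s : 'I_d -> bool -> bool) (p : V -> R).

(** Colour [i] puts its normalised mass on the vertex whose [sigma] is the sign of [y i] and whose
    [tau] is given by [s]. The positive part replaces a sign test to make continuity in [y]
    visible. *)
Definition pmap s y (v : V) : R :=
  if v.2.2 == s v.1 v.2.1 then Num.max (sgb R v.2.1 * y v.1) 0 / den y else 0.

Definition mass p i : R := \sum_b \sum_b' sgb R b * p (i, (b, b')).

Lemma sum_bool (F : bool -> R) : \sum_b F b = F true + F false.
Proof. by rewrite big_bool. Qed.

Lemma pos_part (x : R) b : Num.max (sgb R b * x) 0 = if b == (x < 0) then `|x| else 0.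
Proof.
rewrite maxElt; case: b; rewrite ?sgbT ?sgbF; case: (ltrP x 0) => h /=;
  case: ltrP => h'; rewrite ?(ltr0_norm h) ?(ger0_norm h); lra.
Qed.

Lemma pmapE s y i b b' : pmap s y (i, (b, b')) =
  if (b == (y i < 0)) && (b' == s i b) then `|y i| / den y else 0.
Proof. by rewrite /pmap /= pos_part; do 2 case: eqP => //=; rewrite ?mul0r. Qed.

Lemma mass_pmap s y i : mass (pmap s y) i = y i / den y.
Proof.
rewrite /mass !sum_bool !pmapE.
by case: (ltrP (y i) 0) => yi; case: (s i true); case: (s i false) => /=;
  rewrite ?sgbT ?sgbF; rewrite ?(ltr0_norm yi) ?(ger0_norm yi); ring.
Qed.

Lemma pmap_ge0 s y v : 0 <= pmap s y v.
Proof.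
case: v => i [b b']; rewrite pmapE; case: ifP => // _.
by rewrite divr_ge0// den_ge0.
Qed.

Lemma sum_words (F : V -> R) : \sum_v F v = \sum_i \sum_b \sum_b' F (i, (b, b')).
Proof.
rewrite (eq_bigr (fun v : V => F (v.1, v.2))) => [|[]//].
rewrite -(pair_bigA _ (fun i w => F (i, w))) /=; apply: eq_bigr => i _.
by rewrite [RHS]pair_bigA; apply: eq_bigr => -[].
Qed.

Lemma sum_pmap s y : (exists i, y i != 0) -> \sum_v pmap s y v = 1.
Proof.
move=> yn; rewrite sum_words -[RHS](divff (lt0r_neq0 (den_gt0 yn))) {2}/den mulr_suml.
apply: eq_bigr => i _; rewrite !sum_bool !pmapE.
by case: (ltrP (y i) 0) => yi; case: (s i true); case: (s i false) => /=; ring.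
Qed.

Lemma pmap_support s y i b b' : pmap s y (i, (b, b')) != 0 ->
  [/\ y i != 0, b = (y i < 0) & b' = s i (y i < 0)].
Proof.
rewrite pmapE; case: ifP => [/andP[/eqP-> /eqP->]|]; last by rewrite eqxx.
by rewrite mulf_eq0 negb_or normr_eq0 => /andP[].
Qed.

Lemma eq_pmap s y s' y' : y =1 y' ->
  (forall i, y i != 0 -> s i (y i < 0) = s' i (y i < 0)) -> pmap s y = pmap s' y'.
Proof.
move=> yy ss; apply/funext => -[i [b b']]; rewrite !pmapE -(yy i) -(eq_den yy).
have [->|yi] := eqVneq (y i) 0; first by rewrite normr0 mul0r !if_same.
by case: (b =P (y i < 0)) => [->|//]; rewrite ss.
Qed.

Lemma pmap_inj s y s' y' : (exists i, y i != 0) -> pmap s y = pmap s' y' ->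
  (forall i, y i / den y = y' i / den y') /\
  (forall i, y i != 0 -> s i (y i < 0) = s' i (y' i < 0)).
Proof.
move=> yn E; split=> [i|i yi]; first by rewrite -(mass_pmap s) E mass_pmap.
have : pmap s y (i, (y i < 0, s i (y i < 0))) != 0.
  by rewrite pmapE !eqxx /= mulf_neq0 ?normr_eq0// invr_eq0 lt0r_neq0// den_gt0.
by rewrite E => /pmap_support[_ _ ->].
Qed.

Lemma pmap_scale s y (a : R) : 0 < a -> pmap s (fun i => a * y i) = pmap s y.
Proof.
move=> a0; apply/funext => -[i [b b']]; rewrite !pmapE pmulr_rlt0//.
have -> : den (fun i => a * y i) = a * den y.
  by rewrite /den mulr_sumr; apply: eq_bigr => l _; rewrite normrM gtr0_norm.
case: ifP => // _; rewrite normrM gtr0_norm// -mulf_div divff ?mul1r//.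
exact: lt0r_neq0.
Qed.

Section FromPoint.
Variables (p : V -> R) (f : 'I_d -> bool * bool).
Hypothesis p_ge0 : forall v, 0 <= p v.
Hypothesis p_sum : \sum_v p v = 1.
Hypothesis p_supp : forall v, p v != 0 -> v.2 = f v.1.

Lemma off_word i b b' : (b, b') != f i -> p (i, (b, b')) = 0.
Proof. by move=> ne; apply/eqP; apply: contraR ne => /p_supp /= ->. Qed.

Lemma mass_word i : mass p i = sgb R (f i).1 * p (i, f i).
Proof.
rewrite /mass pair_bigA /= (bigD1 (f i))//= big1 ?addr0 => [|[b b'] ne].
  by case: (f i).
by rewrite off_word ?mulr0.
Qed.

Lemma mass_abs i : `|mass p i| = p (i, f i).
Proof. by rewrite mass_word norm_sgb ger0_norm. Qed.

Lemma mass_sign i : 0 <= sgb R (f i).1 * mass p i.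
Proof. by rewrite mass_word sgbK. Qed.

Lemma mass_neq0 : exists i, mass p i != 0.
Proof.
apply: contrapT => nex; move: p_sum; rewrite big1; first by move/eqP; rewrite eq_sym oner_eq0.
move=> [i w] _; apply/eqP; apply: contraPT nex => pi; apply; exists i.
by rewrite -normr_eq0 mass_abs -(p_supp pi).
Qed.

Lemma den_mass : den (mass p) = 1.
Proof.
rewrite -p_sum sum_words /den; apply: eq_bigr => i _; rewrite mass_abs.
rewrite pair_bigA /= (bigD1 (f i))//= big1 ?addr0 => [|[b b'] ne].
  by case: (f i).
by rewrite off_word.
Qed.

(** Where a mass is nonzero its sign is the [sigma] of the word; elsewhere both sides vanish. *)
Lemma pmap_mass s : (forall i, s i (f i).1 = (f i).2) -> pmap s (mass p) = p.
Proof.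
move=> sf; apply/funext => -[i [b b']]; rewrite pmapE den_mass divr1 mass_abs.
have ms : p (i, f i) != 0 -> (mass p i < 0) = (f i).1.
  move=> pf; have mi : mass p i != 0 by rewrite -normr_eq0 mass_abs.
  by have := sgb_lt0 (mass p i) => h; have := sgb_agree h (mass_sign i);
    case: eqP => // _ /(_ isT)/eqP; rewrite (negbTE mi).
have [p0|pn] := eqVneq (p (i, f i)) 0.
  rewrite p0 if_same; apply/esym; have [e|/off_word//] := eqVneq (b, b') (f i).
  by rewrite e.
rewrite ms//; case: eqP => [->|ne] /=; last first.
  by rewrite off_word//; apply/eqP => e; apply: ne; rewrite -e.
rewrite sf; case: eqP => [->|ne]; first by case: (f i).
by rewrite off_word//; apply/eqP => e; apply: ne; rewrite -e.
Qed.

End FromPoint.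

End Words.

(** * Facets, colouring and vertex count *)

Section Complex.
Variable n : nat.
Hypothesis n_gt1 : (1 < n)%N.
Notation d := n.+1.
Notation V := ('I_d * (bool * bool))%type.
Notation word_type := {ffun 'I_d -> bool * bool}.
Implicit Types (f : word_type) (k : nat).

Definition disc_word f : bool :=
  alt (fun i => (f i).1) && [forall i, (f i).2 == (f ord0).2].
(** With constant [tau] the word [sigma] would itself be a pattern with at most one change; such
    words belong to neither family. *)
Definition collar_word k f : bool :=
  [&& [forall i, (f i).1 (+) (f i).2 == rho k i], (f (kap n k)).2 == (f (kap n k.+1)).2
    & [exists i, (f i).2 != (f ord0).2]].
Definition word f : bool := disc_word f || [exists k : 'I_d.*2, collar_word k f].
Definition graph f : {set V} := [set (i, f i) | i : 'I_d]%SET.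
Definition cpx : {set {set V}} :=
  [set S : {set V} | [exists f, word f && (S \subset graph f)]]%SET.

Lemma graphP f v : (v \in graph f) = (v.2 == f v.1).
Proof.
apply/imsetP/eqP => [[i _ ->]//|]; case: v => i w /= ->; by exists i.
Qed.

Lemma cpxP (S : {set V}) :
  reflect (exists2 f, word f & forall v, v \in S -> v.2 = f v.1) (S \in cpx).
Proof.
rewrite inE; apply: (iffP existsP) => [[f /andP[wf /fintype.subsetP sf]]|[f wf sf]]; exists f.
- by [].
- by move=> v /sf; rewrite graphP => /eqP.
- by rewrite wf; apply/fintype.subsetP => v /sf e; rewrite graphP e.
Qed.

Lemma word_through (v : V) : exists2 f, word f & v \in graph f.
Proof.
(* Signs alternating along the colours, adjusted to be [s] at [i0]; three colours already give two
   changes. *)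
case: v => i0 [s t]; pose a i := (s (+) odd i0) (+) odd i.
exists [ffun i : 'I_d => (a i, t)]; last first.
  by rewrite graphP /= ffunE /a -addbA addbb addbF.
apply/orP; left; apply/andP; split; last by apply/forallP => i; rewrite !ffunE.
apply: (@altP _ _ ord0 (Ordinal (ltnW n_gt1 : 1 < d)%N) (Ordinal (n_gt1 : 2 < d)%N)) => //;
  by rewrite !ffunE /a /=; case: (s (+) odd i0).
Qed.

Lemma cpx_complex : simplicial_complex cpx.
Proof.
split=> [|S T /cpxP[f wf sf] TS].
  have [f wf _] := word_through (ord0, (true, true)).
  by apply/cpxP; exists f => // v; rewrite inE.
by apply/cpxP; exists f => // v vT; apply: sf; exact: (fintype.subsetP TS).
Qed.

Lemma card_graph f : #|graph f| = d.
Proof. by rewrite card_imset ?card_ord// => i j []. Qed.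

Lemma cpx_dim : (complex_dim cpx).+1 = d.
Proof.
rewrite /complex_dim; suff -> : (\max_(S in cpx) #|S|)%N = d by [].
apply/eqP; rewrite eqn_leq; apply/andP; split.
  apply/bigmax_leqP => S; rewrite inE => /existsP[f /andP[_ /subset_leq_card]].
  by rewrite card_graph.
have [f wf _] := word_through (ord0, (true, true)).
apply: leq_trans (_ : #|graph f| <= _)%N; first by rewrite card_graph.
apply: leq_bigmax_cond; rewrite inE; apply/existsP; exists f; rewrite wf /=.
exact: subxx.
Qed.

(** A face lies in the graph of a function of the colour, so it has at most one vertex of each
    colour. *)
Lemma cpx_balanced : balanced d cpx.
Proof.
split; first exact: cpx_dim.
exists (fun v => v.1) => x y /andP[xy /cpxP[f _ sf]]; apply: contra xy => /eqP e.
have ex := sf x; have ey := sf y; rewrite !inE !eqxx orbT in ex ey.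
by apply/eqP; rewrite [x]surjective_pairing [y]surjective_pairing ex// ey// e.
Qed.

Lemma cpx_vertices : #|vertices cpx| = (4 * d)%N.
Proof.
have -> : vertices cpx = [set: V]%SET.
  apply/setP => v; rewrite !inE; apply/existsP.
  have [f wf vf] := word_through v; exists f; rewrite wf /=.
  by rewrite finset.sub1set.
by rewrite cardsT !card_prod card_ord card_bool mulnC.
Qed.

End Complex.

(** * Parametrisations *)

Section Slots.
Variables (R : realFieldType) (n : nat) (w : 'I_n.+1 -> R) (h : R).

Lemma slot_exists (x : R) N : 0 <= x <= cum w h N -> (0 < N)%N ->
  exists k th, [/\ (k < N)%N, 0 <= th <= 1 & posn w h k th = x].
Proof.
move=> /andP[x0]; elim: N => // N IH xN _; case: (lerP x (cum w h N)) => xN'.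
  case: N => [|N] in IH xN xN' *.
    exists 0%N, 0; rewrite lexx ler01; split=> //.
    by move: xN'; rewrite /posn /cum big_ord0; lra.
  by have [//|//|k [th [kN th01 E]]] := IH _ _; exists k, th; split=> //; exact: ltnW.
rewrite cumS in xN; exists N, ((x - cum w h N) / width w h N).
have w0 : 0 < width w h N by lra.
split=> //; last by rewrite /posn divfK ?gt_eqF//; ring.
by apply/andP; split; [apply: divr_ge0|rewrite ler_pdivrMr//]; lra.
Qed.

End Slots.

Section Param.
Variables (R : realType) (m : nat).
Notation n := m.+2.
Notation d := n.+1.
Notation V := ('I_d * (bool * bool))%type.
Notation Z := ('rV[R]_m.+1 * R * R)%type.
Let n_gt1 : (1 < n)%N := isT.
Implicit Types (z : Z) (k : nat) (K : option bool) (e : bool) (om : 'rV[R]_m.+1) (y : 'I_d -> R).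

(* Only the values at [j >= 2] matter. *)
Definition cof om (j : 'I_d) : R := om ord0 (inord (j - 2)).

(** After the point of the sphere come the place within the slot and a number with two meanings: the
    radius in a disc, the position along the segment in the collar. *)
Definition dom : set Z := [set z | [/\ sphere R m z.1.1, 0 <= z.1.2 <= 1 & 0 <= z.2 <= 1]].

Definition rad K z : R := if K is Some _ then z.2 else 1.
Definition base K z : 'I_d -> R := synth (rad K z) (cof z.1.1).
(** In the collar the segment runs from its end of height 1 to its end of height -1; a disc point
    always sits at the end of sign [e]. *)
Definition offset K k z : R :=
  if K is Some e then sgb R e * ext e (base K z) k z.1.2
  else (1 - z.2) * ext false (base K z) k z.1.2 - z.2 * ext true (base K z) k z.1.2.
Definition tip K k z : 'I_d -> R := pt (base K z) k z.1.2 (offset K k z).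
Definition level K k z : R :=
  if K is Some e then sgb R e else num k (tip K k z) / den (tip K k z).
Definition vect K k z : 'I_d -> R := body (rad K z) (cof z.1.1) (tip K k z).
Definition rule K k (i : 'I_d) (b : bool) : bool := if K is Some e then e else b (+) rho k i.
Definition qmap K k z : V -> R := pmap (rule K k) (vect K k z).
Definition angle K k z : R :=
  posn (base K z) (level K k z) k z.1.2 / perim (base K z) (level K k z).
Definition rmap K k z : 'rV[R]_3 := onto_sphere (rad K z) (angle K k z) (level K k z).

Lemma sum_cof om : \sum_(j < d | (1 < j)%N) cof om j ^+ 2 = \sum_i om ord0 i ^+ 2.
Proof.
rewrite big_mkcond 2!big_ord_recl /= !add0r; apply: eq_bigr => i _ /=.
by rewrite /cof /= /bump /= !add1n /= subn2 /= inord_val.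
Qed.

Lemma cof_neq0 om : sphere R m om -> exists2 j : 'I_d, (1 < j)%N & cof om j != 0.
Proof.
rewrite /sphere /= -sum_cof => E; apply: contrapT => nex.
move/eqP: E; rewrite big1 ?(eq_sym 0) ?oner_eq0// => j j1.
have -> : cof om j = 0 by apply/eqP; apply: contraPT nex => ?; apply; exists j.
by rewrite expr0n.
Qed.

Lemma normalize y : ~ affine y -> exists om a, [/\ sphere R m om, 0 < a
  & forall j : 'I_d, (1 < j)%N -> kco (fun i => a * y i) j = cof om j].
Proof.
move=> naff; pose N := \sum_(j < d | (1 < j)%N) kco y j ^+ 2.
have N0 : 0 < N.
  rewrite lt0r sumr_ge0 ?andbT => [|j _]; last exact: sqr_ge0.
  apply/eqP => NZ; apply: naff; apply/(kco_high_affine (ltnW n_gt1)) => j j1.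
  have /eqP := NZ; rewrite /N psumr_eq0 => [/allP/(_ j (mem_index_enum _))|l _]; last exact: sqr_ge0.
  by rewrite j1 /= sqrf_eq0 => /eqP.
pose a := (Num.sqrt N)^-1; have a0 : 0 < a by rewrite invr_gt0 sqrtr_gt0.
have kS j : kco (fun i => a * y i) j = a * kco y j.
  have := kco_lin a 0 y y j; rewrite mul0r addr0 => <-.
  by apply: eq_kco => l; rewrite mul0r addr0.
exists (\row_i (a * kco y (inord (i + 2)))), a; split=> // [|j j1].
  rewrite /sphere /= -sum_cof.
  rewrite (eq_bigr (fun j : 'I_d => a ^+ 2 * kco y j ^+ 2)) => [|j j1].
    by rewrite -mulr_sumr -/N /a exprVn sqr_sqrtr ?ltW// mulVf ?gt_eqF.
  by rewrite /cof mxE exprMn; congr (_ * kco y _ ^+ 2); apply: val_inj; rewrite /= !inordK; have := ltn_ord j; lia.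
by rewrite kS /cof mxE; congr (_ * kco y _); apply: val_inj; rewrite /= !inordK; have := ltn_ord j; lia.
Qed.

Lemma ruleE K k y i : letter K k y i = rule K k i (y i < 0).
Proof. by case: K. Qed.

Lemma cof_inj om om' (a : R) : sphere R m om -> sphere R m om' -> 0 < a ->
  (forall j : 'I_d, (1 < j)%N -> cof om' j = a * cof om j) -> a = 1 /\ om = om'.
Proof.
rewrite /sphere /= => S S' a0 E.
have a1 : a = 1.
  apply/eqP; rewrite -(@eqrXn2 _ 2) ?ltW ?expr1n// -S' -sum_cof.
  rewrite (eq_bigr (fun j : 'I_d => a ^+ 2 * cof om j ^+ 2)) => [|j j1].
    by rewrite -mulr_sumr sum_cof S mulr1.
  by rewrite E// exprMn.
split=> //; apply/rowP => i; have := E (inord (i + 2)).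
have -> : nat_of_ord (inord (i + 2) : 'I_d) = (i + 2)%N by rewrite inordK//; have := ltn_ord i; lia.
rewrite addn2 /= => /(_ isT); rewrite a1 mul1r /cof.
have -> : nat_of_ord (inord i.+2 : 'I_d) = i.+2 by rewrite inordK// ltnS ltnS; have := ltn_ord i; lia.
by rewrite subn2 /= inord_val.
Qed.

Section OnDom.
Variables (K : option bool) (k : nat) (z : Z).
Hypothesis zD : dom z.

Lemma tip_neq0 : K = None -> exists i, tip K k z i != 0.
Proof.
move=> KN; apply: (@nonaffine_neq0 _ _ (base K z)); last exact: affine_pt.
by case: zD => /cof_neq0 c0 _ _; apply: synth_naff => //; rewrite KN.
Qed.

Lemma dom_fits : fits (cof z.1.1) K k z.1.2 (offset K k z) (rad K z) (level K k z).
Proof.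
case: zD => S th01 /andP[s0 s1]; split=> //.
have := tip_neq0; rewrite /level /rad /offset /tip; case: K => [e|] nz /=.
  by rewrite sgbK s0 s1.
set u := pt _ _ _ _ in nz *; have u0 := den_gt0 (nz erefl).
split=> //; last by rewrite divfK ?gt_eqF.
have F0 := ext_ge0 false (base None z) k z.1.2; have T0 := ext_ge0 true (base None z) k z.1.2.
apply: (layer_pt n_gt1) => //; nra.
Qed.

Lemma dom_can : on_can (rad K z) (level K k z).
Proof.
case: zD => _ _ s01; have := tip_neq0; rewrite /level /rad /offset; case: K => [e|] nz.
  by split=> //; [|right]; rewrite -[sgb R e]mulr1 norm_sgb normr1.
have u0 := den_gt0 (nz erefl); split; [by rewrite ler01 lexx| |by left].
rewrite normrM normfV (gtr0_norm u0) ler_pdivrMr// mul1r (le_trans (ler_norm_sum _ _ _))//.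
by apply: ler_sum => i _; rewrite sgM.
Qed.

Lemma vect_neq0 : exists i, vect K k z i != 0.
Proof. by case: zD => /cof_neq0 c0 _ _; exact: body_neq0. Qed.

Lemma kco_vect (j : 'I_d) : (1 < j)%N -> kco (vect K k z) j = cof z.1.1 j.
Proof. by move=> j1; rewrite /vect /body ksyK ltnNge j1. Qed.

End OnDom.

(** [turn] identifies just the two ends 0 and 1, which is [same_angle] after division by the
    perimeter. *)
Lemma rmap_eq K k z K' k' z' : (k < d.*2)%N -> (k' < d.*2)%N -> dom z -> dom z' -> z.1.1 = z'.1.1 ->
  rmap K k z = rmap K' k' z' <->
  [/\ rad K z = rad K' z', level K k z = level K' k' z' & rad K z = 0 \/
   same_angle (base K z) (level K k z) (posn (base K z) (level K k z) k z.1.2)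
     (posn (base K z) (level K k z) k' z'.1.2)].
Proof.
move=> kd kd' zD zD' om; rewrite (onto_sphere_inj _ _ (dom_can _ _ zD) (dom_can _ _ zD')).
have aux : rad K z = rad K' z' -> level K k z = level K' k' z' -> rad K z != 0 ->
   turn (angle K k z) = turn (angle K' k' z') <->
   same_angle (base K z) (level K k z) (posn (base K z) (level K k z) k z.1.2)
     (posn (base K z) (level K k z) k' z'.1.2).
  move=> rr hh r0; have bb : base K' z' = base K z by rewrite /base -rr -om.
  have rp : 0 < rad K z by have [/andP[? _] _ _] := dom_can K k zD; rewrite lt0r r0.
  have [/cof_neq0 c0 th01 _] := zD; have [_ th01' _] := zD'.
  have P0 := perim_gt0 n_gt1 (level K k z) (synth_naff n_gt1 c0 rp); rewrite -/(base K z) in P0.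
  have bd j th : (j < d.*2)%N -> 0 <= th <= 1 ->
      0 <= posn (base K z) (level K k z) j th / perim (base K z) (level K k z) <= 1.
    move=> jd /(@posn_bounds _ _ (base K z) (level K k z) j) /andP[b1 b2].
    have b0 := cum_ge0 (base K z) (level K k z) j.
    have b3 := cum_mono (base K z) (level K k z) jd.
    rewrite divr_ge0 ?(ltW P0) ?(le_trans b0)//= ler_pdivrMr// mul1r (le_trans b2)//.
  rewrite /angle bb -hh turn_eq ?bd//.
  set P := perim _ _ in P0 *; have Pn := lt0r_neq0 P0.
  have e0 x : (x / P = 0) = (x = 0).
    by apply/propext; split=> [/(congr1 ( *%R^~ P))|->]; rewrite ?mul0r// divfK.
  have e1 x : (x / P = 1) = (x = P).
    by apply/propext; split=> [/(congr1 ( *%R^~ P))|->]; rewrite ?divff// divfK// mul1r.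
  rewrite /same_angle !e0 !e1; split.
    by case=> [/(mulIf (invr_neq0 Pn)) ->|[-> ->]|[-> ->]]; [left|right; left|right; right].
  by case=> [->|[[-> ->]|[-> ->]]]; [constructor 1|constructor 2|constructor 3].
split=> -[rr hh H]; split=> //.
  by case: (eqVneq (rad K z) 0) => [|r0]; [left|right; apply/(aux rr hh r0); case: H => // /eqP; rewrite (negbTE r0)].
by case: (eqVneq (rad K z) 0) => [|r0]; [left|right; apply/(aux rr hh r0); case: H => // /eqP; rewrite (negbTE r0)].
Qed.

Lemma qr_fibre K k z K' k' z' : (k < d.*2)%N -> (k' < d.*2)%N -> dom z -> dom z' ->
  qmap K k z = qmap K' k' z' <-> (rmap K k z, z.1.1) = (rmap K' k' z', z'.1.1).
Proof.
move=> kd kd' zD zD'; have [S _ _] := zD; have [S' _ _] := zD'.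
have fib : z.1.1 = z'.1.1 ->
    (vect K k z =1 vect K' k' z' /\
     forall i, vect K k z i != 0 -> letter K k (vect K k z) i = letter K' k' (vect K' k' z') i) <->
    rmap K k z = rmap K' k' z'.
  move=> om; rewrite (@rmap_eq K k z K' k' z' kd kd' zD zD' om).
  have F' := dom_fits K' k' zD'; have c0 := cof_neq0 S; rewrite -om in F'.
  have -> : vect K' k' z' = body (rad K' z') (cof z.1.1)
      (apt (cof z.1.1) (rad K' z') k' z'.1.2 (offset K' k' z')) by rewrite om.
  exact: (fibre n_gt1 c0 kd kd' (dom_fits K k zD) F').
split=> [E|[rr om]]; last first.
  have [yy ll] := (fib om).2 rr; apply: eq_pmap => // i yi.
  by have := ll i yi; rewrite !ruleE -yy.
have [y1 ll] := pmap_inj (vect_neq0 K k zD) E.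
pose y := vect K k z; pose y' := vect K' k' z'.
have d0 : 0 < den y := den_gt0 (vect_neq0 K k zD).
have d0' : 0 < den y' := den_gt0 (vect_neq0 K' k' zD').
(* A point of the realization remembers its vector only up to the positive scale [a]; as both high
   parts lie on the unit sphere, [cof_inj] gives [a = 1]. *)
pose a := den y' / den y; have a0 : 0 < a by rewrite divr_gt0.
have ya i : y' i = a * y i.
  have := y1 i; rewrite -/y -/y' => /(congr1 ( *%R (den y'))).
  by rewrite [den y' * (y' i / _)]mulrC divfK ?gt_eqF// => <-; rewrite /a mulrCA mulrC.
have [|a1 om] := @cof_inj _ _ a S S' a0.
  move=> j j1; rewrite -(kco_vect K' k' z' j1) -(kco_vect K k z j1) -/y -/y' (eq_kco ya).
  have := kco_lin a 0 y y j; rewrite mul0r addr0 => <-.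
  by apply: eq_kco => l; rewrite mul0r addr0.
congr (_, _) => //; apply/(fib om); split=> [i|i yi].
  by rewrite -/y' ya a1 mul1r.
by rewrite !ruleE ll.
Qed.

End Param.

(** * The parametrisation covers exactly the complex *)

Section Onto.
Variables (R : realType) (m : nat).
Notation n := m.+2.
Notation d := n.+1.
Notation V := ('I_d * (bool * bool))%type.
Notation Z := ('rV[R]_m.+1 * R * R)%type.
Let n_gt1 : (1 < n)%N := isT.
Implicit Types (z : Z) (k : nat) (K : option bool) (e : bool) (om : 'rV[R]_m.+1) (y : 'I_d -> R).

Lemma kco_scale (a : R) y (j : 'I_d) : kco (fun i => a * y i) j = a * kco y j.
Proof.
have := kco_lin a 0 y y j; rewrite mul0r addr0 => <-.
by apply: eq_kco => l; rewrite mul0r addr0.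
Qed.

Lemma qmap_eq K k z y : vect K k z =1 y -> qmap K k z = pmap (rule K k) y.
Proof. by move=> E; exact: eq_pmap. Qed.

Lemma collar_onto om k y : sphere R m om -> (forall j : 'I_d, (1 < j)%N -> kco y j = cof om j) ->
  layer k y -> exists z, [/\ dom z, z.1.1 = om & vect None k z =1 y].
Proof.
move=> S yc lay; pose w := synth 1 (cof om).
have aff : affine (fun i => y i - w i).
  by apply/(affine_synth n_gt1) => j j1; rewrite yc// expr1n mul1r.
have [ab w0 w1] := lay; have [th [t [th01 yE]]] := pt_rep n_gt1 aff ab.
move/(eq_wit yE)/(witP n_gt1 _ _ _ _ th01) : w0; rewrite sgbF mul1r => tF.
move/(eq_wit yE)/(witP n_gt1 _ _ _ _ th01) : w1; rewrite sgbT mulN1r => tT.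
(* The position of [t] between [ext false] and [- ext true]; a segment reduced to a point leaves it
   free. *)
have [s s01 tE] : exists2 s, 0 <= s <= 1 &
    (1 - s) * ext false w k th - s * ext true w k th = t.
  have F0 := ext_ge0 false w k th; have T0 := ext_ge0 true w k th.
  move: (ext false w k th) (ext true w k th) F0 T0 tF tT => F T F0 T0 tF tT.
  have [e|ne] := eqVneq (F + T) 0; first by exists 0; rewrite ?lexx ?ler01//; lra.
  have p : 0 < F + T by rewrite lt0r ne addr_ge0.
  exists ((F - t) / (F + T)).
    by apply/andP; split; [apply: divr_ge0|rewrite ler_pdivrMr//]; lra.
  have -> : (1 - (F - t) / (F + T)) * F - (F - t) / (F + T) * T =
     F - (F - t) / (F + T) * (F + T) by ring.
  by rewrite divfK//; ring.
exists (om, th, s); split=> //= i; rewrite /vect /tip /offset /base /= -/w tE.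
by rewrite yE; apply: (body1 n_gt1); exact: affine_pt.
Qed.

(** The radius is the exit time of [y]. The rescaled vector [u] at that time lies in both [inA] and
    [inB], hence by [AB_layer] at the end of sign [e] of a segment. *)
Lemma disc_onto om e y : sphere R m om -> (forall j : 'I_d, (1 < j)%N -> kco y j = cof om j) ->
  (exists i, y i != 0) -> inB y ->
  exists k z, [/\ (k < d.*2)%N, dom z, z.1.1 = om & vect (Some e) k z =1 y].
Proof.
move=> S yc yn yB; set o1 : 'I_d := ord1' (ltnW n_gt1).
(* Without low coordinates [y] is the centre of the disc, given by any slot at radius 0. *)
have [[k0 k1]|ker] := pselect (kco y ord0 = 0 /\ kco y o1 = 0).
  exists 0%N, (om, 0, 0); split=> //; first by split=> //=; rewrite lexx ler01.
  move=> i; rewrite -[RHS]kcoK; apply: eq_ksy => j /=.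
  case: ltnP => j2; last by rewrite yc.
  rewrite expr0n; have -> : (2 - j == 0)%N = false by lia.
  rewrite mul0r; have [j0|j0] := posnP j.
    by rewrite -k0; congr kco; apply: val_inj.
  by rewrite -k1; congr kco; apply: val_inj => /=; lia.
have [r0 r001 r0A] : exists2 r, 0 < r <= 1 & inA (flow r y).
  apply: (small_flow (n_gt0 := ltnW n_gt1)).
  case: (eqVneq (kco y ord0) 0) => [k0|]; last by left.
  by right; apply/eqP => k1; apply: ker.
have [r [/andP[rp r1] rA rB]] := exit_exists r001 r0A yB.
pose u i := r ^- 2 * flow r y i.
have r2 : 0 < r ^- 2 by rewrite invr_gt0 exprn_gt0.
have sc b i : (0 <= sgb R b * u i) = (0 <= sgb R b * flow r y i).
  by rewrite /u mulrCA pmulr_rge0.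
have uA : inA u by case: rA => q qP; exists q => i; rewrite sc.
have uB : inB u by case: rB => q q1 qP; exists q => // i; rewrite sc.
have [k [kd lay cap]] := AB_layer n_gt1 e uA uB.
pose w := synth r (cof om).
have aff : affine (fun i => u i - w i).
  apply/(affine_synth n_gt1) => j j1; rewrite kco_scale kco_flow yc// mulrA; congr (_ * _).
  by rewrite -{1}(subnKC j1) exprD mulrA mulVf ?mul1r// expf_neq0// gt_eqF.
have [ab w0 w1] := lay; have [th [t [th01 uE]]] := pt_rep n_gt1 aff ab.
have we : wit e k (pt w k th t) by apply: (eq_wit uE); case: (e).
have tE : sgb R e * t = ext e w k th.
  by apply: (capped_ext n_gt1) => // i; rewrite -uE.
exists k, (om, th, r); split=> //; first by split=> //=; rewrite ltW.
move=> i; rewrite /vect /tip /offset /base /= -/w -tE sgbK.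
by rewrite -(body_flow rp yc i); apply: eq_body => l; rewrite -uE.
Qed.

(** Otherwise [y] is in [inA]. Exit time 1 gives [inB] directly, an earlier positive one contradicts
    strict diminution, and exit time 0 contradicts [kernel_notA]. *)
Lemma exit_inB r y : exit n_gt1 r y -> (exists i, y i != 0) -> inB y.
Proof.
move=> [/andP[r0 r1] rz rp] yn; have [yA|//] := AorB y.
have [r00|rn] := eqVneq r 0.
  by have [k0 k1] := rz r00; have := kernel_notA k0 k1 yn.
have rpos : 0 < r by rewrite lt0r rn.
have [fA fB] := rp rpos; have [r11|rn1] := eqVneq r 1.
  by case: fB => s s1 s2; exists s => // i; have := s2 i; rewrite r11 flow1.
have [|b [k ok]] := flow_strict rpos _ yA yn; first by rewrite lt_neqAle rn1.
by have := one_change_notB ok fB.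
Qed.

Lemma qmap_realization K k z : (k < d.*2)%N -> dom z -> realization R (cpx n) (qmap K k z).
Proof.
move=> kd zD; split; [exact: pmap_ge0|exact: sum_pmap (vect_neq0 K k zD)|].
pose y := vect K k z; have yn := vect_neq0 K k zD.
apply/cpxP.
suff [f wf fP] : exists2 f : {ffun 'I_d -> bool * bool}, word f &
    forall i, y i != 0 -> f i = (y i < 0, rule K k i (y i < 0)).
  exists f => // -[i [b b']]; rewrite inE => /pmap_support[yi -> ->] /=.
  by rewrite fP.
have fits := dom_fits K k zD.
(* Constant letters, which also occur on the rims of the collar, are completed to a disc word; its
   [sigma] comes from [inB]. *)
have [[e e2]|ne] := pselect (exists e, forall i, y i != 0 -> rule K k i (y i < 0) = e).
  have [s s_alt sP] : inB y.
    have [/cof_neq0 c0 _ _] := zD; have [|ex _] := state_exit n_gt1 c0 fits (e := e).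
      by move=> i yi; rewrite ruleE; exact: e2.
    exact: exit_inB ex yn.
  exists [ffun i => (s i, e)].
    apply/orP; left; apply/andP; split; last by apply/forallP => i; rewrite !ffunE.
    by rewrite (@eq_alt _ _ s)// => i; rewrite ffunE.
  move=> i yi; rewrite ffunE e2//; congr (_, _).
  have := sgb_agree (sP i) (sgb_lt0 (y i)); case: eqP => // _ /(_ isT)/eqP.
  by rewrite (negbTE yi).
case: K => [e|] in y yn fits ne *; first by exfalso; apply: ne; exists e.
have [lay vE] : layer k y /\ y =1 tip None k z.
  have yE : y =1 tip None k z by apply: (body1 n_gt1); exact: affine_pt.
  by split=> //; case: fits => _ [_ lay _]; apply: eq_layer lay => i; rewrite yE.
pose v i := sg R k i * y i.
pose B i := (i == kap n k) || (i == kap n k.+1).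
(* One entry of the block may vanish; the other then decides the common sign, and [layer] excludes
   opposite signs. *)
pose t i := if B i then (v (kap n k) < 0) || (v (kap n k.+1) < 0) else v i < 0.
have tE i : y i != 0 -> t i = (y i < 0) (+) rho k i.
  move=> yi; have vi : v i != 0 by rewrite mulf_neq0 ?sg_neq0.
  have -> : (y i < 0) (+) rho k i = (v i < 0).
    rewrite /v /sg; case: (rho k i); rewrite ?sgbT ?sgbF ?mulN1r ?mul1r ?addbT ?addbF//.
    by rewrite oppr_lt0 -leNgt le_eqVlt eq_sym (negbTE yi).
  have [vv _ _] := lay; rewrite -/(v (kap n k)) -/(v (kap n k.+1)) in vv.
  rewrite /t /B; have [ik|ik] := eqVneq i (kap n k) => /=.
    rewrite -ik in vv *; case: (ltrP (v i) 0) => //= vi0; apply/negbTE; rewrite -leNgt.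
    by rewrite -(pmulr_rge0 _ (_ : 0 < v i))// lt0r vi.
  have [ik1|//] := eqVneq i (kap n k.+1).
  rewrite -ik1 in vv *; case: (ltrP (v i) 0) => //= vi0; rewrite ?orbT ?orbF//; apply/negbTE; rewrite -leNgt.
  by rewrite -(pmulr_lge0 _ (_ : 0 < v i))// lt0r vi.
exists [ffun i => (t i (+) rho k i, t i)]; last first.
  by move=> i yi; rewrite ffunE tE//= addbK.
apply/orP; right; apply/existsP; exists (Ordinal kd); apply/and3P; split.
- by apply/forallP => i; rewrite !ffunE /= addbAC addbb addFb.
- by rewrite !ffunE /= /t /B !eqxx orbT.
- apply/existsP; apply: contrapT => nt; apply: ne; exists (t ord0) => i yi /=.
  rewrite -tE//; apply/eqP; apply: contraPT nt => ti; apply; exists i.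
  by rewrite !ffunE.
Qed.

(** The entries of [v] have weakly the signs [tau], which agree on the block and take both
    values. *)
Lemma word_layer f k y : collar_word k f -> (forall i, 0 <= sgb R (f i).1 * y i) -> layer k y.
Proof.
move=> /and3P[/forallP f1 /eqP f2 /existsP[j f3]] ysgn.
have vE i : sg R k i * y i = sgb R (f i).2 * (sgb R (f i).1 * y i).
  by rewrite /sg -(eqP (f1 i)) sgb_addb; ring.
split.
- rewrite !vE f2; have := ysgn (kap n k); have := ysgn (kap n k.+1).
  by case: (f _).2; rewrite ?sgbT ?sgbF; nra.
- have [i fi] : exists i, (f i).2 = true.
    by move: f3; case e0: (f ord0).2; [exists ord0|exists j; case: (f j).2 f3].
  have neg l : (f l).2 = true -> sgb R false * (sg R k l * y l) <= 0.
    by move=> fl; rewrite vE fl sgbT sgbF; have := ysgn l; lra.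
  have [ik|i1] := eqVneq i (kap n k).
    by right; split; apply: neg; rewrite -?f2 -?ik.
  have [ik|i2] := eqVneq i (kap n k.+1).
    by right; split; apply: neg; rewrite ?f2 -?ik.
  by left; exists i; split=> //; exact: neg.
- have [i fi] : exists i, (f i).2 = false.
    by move: f3; case e0: (f ord0).2; [exists j; case: (f j).2 f3|exists ord0].
  have pos l : (f l).2 = false -> sgb R true * (sg R k l * y l) <= 0.
    by move=> fl; rewrite vE fl sgbT sgbF; have := ysgn l; lra.
  have [ik|i1] := eqVneq i (kap n k).
    by right; split; apply: pos; rewrite -?f2 -?ik.
  have [ik|i2] := eqVneq i (kap n k.+1).
    by right; split; apply: pos; rewrite ?f2 -?ik.
  by left; exists i; split=> //; exact: pos.
Qed.

Lemma realization_qmap p : realization R (cpx n) p ->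
  exists K k z, [/\ (k < d.*2)%N, dom z & qmap K k z = p].
Proof.
case=> p0 p1 /cpxP[f wf sf].
have p_supp v : p v != 0 -> v.2 = f v.1 by move=> pv; apply: sf; rewrite inE.
have [om [a]] : exists om a, [/\ sphere R m om, 0 < a
  & forall j : 'I_d, (1 < j)%N -> kco (fun i => a * mass p i) j = cof om j].
  apply: normalize => aff; have [i /eqP] := mass_neq0 p0 p1 p_supp; apply; move: i.
  have ms := mass_sign p0 p_supp.
  case/orP: wf => [/andP[alt1 _]|/existsP[k cw]].
    by apply: (affine_notB aff); exists (fun i => (f i).1).
  exact: affine_layer aff (word_layer cw ms).
move=> [S a0 yc]; pose y i := a * mass p i.
have yn : exists i, y i != 0.
  by have [i mi] := mass_neq0 p0 p1 p_supp; exists i; rewrite mulf_neq0// gt_eqF.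
have ysgn i : 0 <= sgb R (f i).1 * y i.
  by rewrite mulrCA pmulr_rge0//; exact: mass_sign.
case/orP: wf => [/andP[alt1 /forallP const]|/existsP[k cw]].
  have yB : inB y by exists (fun i => (f i).1).
  have [k [z [kd zD om' E]]] := disc_onto (f ord0).2 S yc yn yB.
  exists (Some (f ord0).2), k, z; split=> //.
  rewrite (qmap_eq E) pmap_scale//; apply: (pmap_mass p0 p1 p_supp) => i /=.
  by rewrite (eqP (const i)).
have [z [zD om' E]] := collar_onto S yc (word_layer cw ysgn).
exists None, k, z; split=> //.
rewrite (qmap_eq E) pmap_scale//; apply: (pmap_mass p0 p1 p_supp) => i /=.
by case/and3P: cw => /forallP/(_ i)/eqP <- _ _; rewrite addKb.
Qed.

End Onto.

(** * Continuity of the pencil constructions *)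

Section PencilContinuity.
Variables (R : realType) (n : nat) (Z : topologicalType) (z : Z).
Notation d := n.+1.
Implicit Types (W U : Z -> 'I_d -> R) (f T H : Z -> R) (k : nat) (e : bool).

Lemma ct_kco U j : (forall i, ct z (U ^~ i)) -> ct z (fun x => kco (U x) j).
Proof.
move=> cU; apply: ctM; first exact: ct_cst.
by apply: ct_sum => i _; apply: ctM; [apply: ctM => //; exact: ct_cst|exact: ct_cst].
Qed.

Lemma ct_ksy (C : Z -> 'I_d -> R) i : (forall j, ct z (C ^~ j)) -> ct z (fun x => ksy (C x) i).
Proof.
move=> cC; apply: ctM; last exact: ct_cst.
by apply: ct_sum => j _; apply: ctM => //; exact: ct_cst.
Qed.

Lemma ct_apex W k i : (forall i, ct z (W ^~ i)) -> ct z (fun x => apex (W x) k i).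
Proof.
move=> cW; apply: ctB => //; apply: ctM; last exact: ct_cst.
by apply: ctD; apply: ctM => //; exact: ct_cst.
Qed.

Lemma ct_dir T k (i : 'I_d) : ct z T -> ct z (fun x => dir k (T x) i).
Proof.
move=> cT; apply: ctD; apply: ctM => //; try exact: ct_cst.
by apply: ctB => //; exact: ct_cst.
Qed.

Lemma ct_speed T k (i : 'I_d) : ct z T -> ct z (fun x => speed k (T x) i).
Proof.
move=> cT; apply: ctD; apply: ctM => //; try exact: ct_cst.
by apply: ctB => //; exact: ct_cst.
Qed.

Lemma ct_pt W T f k i : (forall i, ct z (W ^~ i)) -> ct z T -> ct z f ->
  ct z (fun x => pt (W x) k (T x) (f x) i).
Proof. by move=> cW cT cf; apply: ctD; [exact: ct_apex|apply: ctM => //; exact: ct_dir]. Qed.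

Lemma ct_ext e W T k : 0 <= T z <= 1 -> (forall i, ct z (W ^~ i)) -> ct z T ->
  ct z (fun x => ext e (W x) k (T x)).
Proof.
move=> T01 cW cT; apply: ct_bigmax => i /andP[i1 i2].
apply: ct_div; [by rewrite gt_eqF// speed_gt0| |exact: ct_speed].
apply: ctN; apply: ctM; first exact: ct_cst.
by apply: ctM; [exact: ct_cst|exact: ct_apex].
Qed.

Lemma ct_num U k : (forall i, ct z (U ^~ i)) -> ct z (fun x => num k (U x)).
Proof. by move=> cU; apply: ct_sum => i _; apply: ctM => //; exact: ct_cst. Qed.

Lemma ct_den U : (forall i, ct z (U ^~ i)) -> ct z (fun x => den (U x)).
Proof. by move=> cU; apply: ct_sum => i _; exact: ct_norm. Qed.

Lemma ct_width W H k : (forall i, ct z (W ^~ i)) -> ct z H -> ct z (fun x => width (W x) (H x) k).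
Proof.
move=> cW cH; apply: ct_norm; apply: ctB.
  by apply: ctM => //; apply: ct_den => i; exact: ct_apex.
by apply: ct_num => i; exact: ct_apex.
Qed.

Lemma ct_cum W H k : (forall i, ct z (W ^~ i)) -> ct z H -> ct z (fun x => cum (W x) (H x) k).
Proof. by move=> cW cH; apply: ct_sum => j _; exact: ct_width. Qed.

Lemma ct_posn W H T k : (forall i, ct z (W ^~ i)) -> ct z H -> ct z T ->
  ct z (fun x => posn (W x) (H x) k (T x)).
Proof.
by move=> cW cH cT; apply: ctD; [exact: ct_cum|apply: ctM => //; exact: ct_width].
Qed.

End PencilContinuity.

(** * The map to the product of spheres *)

Section Target.
Variables (R : realType) (m : nat).
Notation n := m.+2.
Notation d := n.+1.
Notation Z := ('rV[R]_m.+1 * R * R)%type.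
Let n_gt1 : (1 < n)%N := isT.
Implicit Types (z : Z) (k : nat) (K : option bool) (e : bool) (om : 'rV[R]_m.+1).

(** The ends of the segment are capped, so the height is 1 at one and -1 at the other; the
    intermediate value theorem gives the rest. *)
Lemma height_onto (w : 'I_d -> R) k th h : ~ affine w -> 0 <= th <= 1 -> `|h| <= 1 ->
  exists2 s, 0 <= s <= 1 &
    let u := pt w k th ((1 - s) * ext false w k th - s * ext true w k th) in
    num k u / den u = h.
Proof.
move=> naff th01 h1.
pose t s := (1 - s) * ext false w k th - s * ext true w k th.
pose f s := num k (pt w k th (t s)) / den (pt w k th (t s)).
have u0 s : 0 < den (pt w k th (t s)).
  by apply: den_gt0; apply: (nonaffine_neq0 naff); exact: affine_pt.
have cf : continuous f.
  move=> s; have ct1 : ct s (fun x : R => t x).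
    by apply: ctB; apply: ctM; try exact: ct_cst; [apply: ctB; [exact: ct_cst|]|]; exact: cvg_id.
  have cp i : ct s (fun x => pt w k th (t x) i).
    by apply: (@ct_pt _ _ _ _ (fun=> w) (fun=> th)) => // [j|]; exact: ct_cst.
  by apply: ct_div; [rewrite gt_eqF|exact: ct_num|exact: ct_den].
have cap e s : t s = sgb R e * ext e w k th -> f s = sgb R e.
  move=> tE; have /capped_height E : capped e k (pt w k th (t s)).
    by apply: (ext_capped n_gt1) => //; rewrite tE sgbK.
  by rewrite /f E mulfK// gt_eqF.
have f0 : f 0 = 1 by rewrite (cap false) ?sgbF// /t; ring.
have f1 : f 1 = -1 by rewrite (cap true) ?sgbT// /t; ring.
have [|s sI fs] := @IVT R f 0 1 h ler01 (continuous_subspaceT cf).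
  by rewrite f0 f1 ge_min le_max; move: h1; rewrite ler_norml => /andP[-> ->]; rewrite orbT.
by exists s => //; move: sI; rewrite in_itv.
Qed.

Lemma rmap_onto om v : sphere R m om -> sphere R 2 v ->
  exists K k z, [/\ (k < d.*2)%N, dom z, z.1.1 = om & rmap K k z = v].
Proof.
move=> S /onto_sphere_surj[s [a [h [can a01 <-]]]].
have [s01 h1 sh] := can; have c0 := cof_neq0 S.
have slot (w : 'I_d -> R) : ~ affine w -> exists k th,
    [/\ (k < d.*2)%N, 0 <= th <= 1 & posn w h k th = a * perim w h].
  move=> naff; apply: slot_exists => //; have P := perim_gt0 n_gt1 h naff.
  have /andP[a0 a1] := a01; apply/andP; split; first exact: mulr_ge0 (ltW P).
  by rewrite -/(perim w h) ger_pMl.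
have [s1|s1] := eqVneq s 1.
  have naff : ~ affine (synth 1 (cof om)) by exact: synth_naff.
  have [k [th [kd th01 pE]]] := slot _ naff.
  have [s' s01' lE] := height_onto k naff th01 h1.
  have P := perim_gt0 n_gt1 h naff.
  exists None, k, (om, th, s'); split=> //.
  rewrite /rmap /angle /level /tip /offset /base /= lE pE s1 mulfK// gt_eqF//.
have ha : `|h| = 1 by case: sh => // /eqP; rewrite (negbTE s1).
pose e := h < 0; have hE : sgb R e = h.
  rewrite /e; case: (ltrP h 0) => h0; rewrite ?sgbT ?sgbF -ha ?(ltr0_norm h0) ?(ger0_norm h0)//.
  by rewrite opprK.
have [s0|sn] := eqVneq s 0.
  exists (Some e), 0%N, (om, 0, 0); split=> //; first by split; rewrite /= ?lexx ?ler01.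
  rewrite /rmap /= hE; apply/onto_sphere_inj; [by rewrite -s0|by []|].
  by rewrite s0; split=> //; left.
have sp : 0 < s by rewrite lt0r sn; case/andP: s01.
have naff : ~ affine (synth s (cof om)) by exact: synth_naff.
have [k [th [kd th01 pE]]] := slot _ naff; have P := perim_gt0 n_gt1 h naff.
exists (Some e), k, (om, th, s); split=> //.
by rewrite /rmap /angle /level /base /= hE pE mulfK// gt_eqF.
Qed.

Lemma rmap_sphere K k z : dom z -> sphere R 2 (rmap K k z).
Proof. by move=> zD; exact: onto_sphereP (dom_can K k zD). Qed.

Section At.
Variables (K : option bool) (k : nat) (z : Z).
Hypothesis zD : dom z.

Lemma ct_om i : ct z (fun x : Z => x.1.1 ord0 i).
Proof.
apply: (@continuous_comp _ _ _ (fun x : Z => x.1.1) (fun v : 'rV[R]_m.+1 => v ord0 i)).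
  by apply: continuous_comp; exact: cvg_fst.
exact: coord_continuous.
Qed.

Lemma ct_th : ct z (fun x : Z => x.1.2).
Proof.
by apply: (@continuous_comp _ _ _ (fun x : Z => x.1) (fun v => v.2)); [exact: cvg_fst|exact: cvg_snd].
Qed.

Lemma ct_s : ct z (fun x : Z => x.2).
Proof. exact: cvg_snd. Qed.

Lemma ct_rad : ct z (rad K).
Proof. by rewrite /rad; case: K => [e|]; [exact: ct_s|exact: ct_cst]. Qed.

Lemma ct_base i : ct z (fun x => base K x i).
Proof.
apply: ct_ksy => j; case: (ltnP j 2) => _; first exact: ct_cst.
by apply: ctM; [apply: ctX; exact: ct_rad|exact: ct_om].
Qed.

Lemma ct_offset : ct z (offset K k).
Proof.
have [_ th01 _] := zD; have ce e : ct z (fun x => ext e (base K x) k x.1.2).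
  by apply: ct_ext => //; [exact: ct_base|exact: ct_th].
rewrite /offset; move: ce; case: K => [e|] ce; first by apply: ctM => //; exact: ct_cst.
by apply: ctB; apply: ctM => //; [apply: ctB; [exact: ct_cst|exact: ct_s]|exact: ct_s].
Qed.

Lemma ct_tip i : ct z (fun x => tip K k x i).
Proof. by apply: ct_pt; [exact: ct_base|exact: ct_th|exact: ct_offset]. Qed.

Lemma ct_level : ct z (level K k).
Proof.
have ctt := ct_tip; have tn := tip_neq0 k zD (K := K).
rewrite /level; move: tn ctt; case: K => [e|] tn ctt; first exact: ct_cst.
by apply: ct_div; [rewrite gt_eqF// den_gt0//; exact: tn|exact: ct_num|exact: ct_den].
Qed.

Lemma ct_vect i : ct z (fun x => vect K k x i).
Proof.
apply: ct_ksy => j; case: (ltnP j 2) => _; last exact: ct_om.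
by apply: ctM; [apply: ctX; exact: ct_rad|apply: ct_kco; exact: ct_tip].
Qed.

Lemma qmap_continuous : {for z, continuous (qmap K k : Z -> {ptws ('I_d * (bool * bool))%type -> R})}.
Proof.
apply: ct_ptws => v; rewrite /qmap /pmap; case: (v.2.2 == _); last exact: ct_cst.
apply: ct_div; first by rewrite gt_eqF// den_gt0//; exact: vect_neq0.
  apply: ct_max; last exact: ct_cst.
  by apply: ctM; [exact: ct_cst|exact: ct_vect].
by apply: ct_den => i; exact: ct_vect.
Qed.

Lemma ct_angle : rad K z != 0 -> ct z (angle K k).
Proof.
move=> r0; have [/cof_neq0 c0 _ _] := zD; have [/andP[rg _] _ _] := dom_can K k zD.
have naff : ~ affine (base K z) by apply: synth_naff => //; rewrite lt0r r0.
apply: ct_div; first by rewrite gt_eqF// perim_gt0.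
  by apply: ct_posn; [exact: ct_base|exact: ct_level|exact: ct_th].
by apply: ct_cum; [exact: ct_base|exact: ct_level].
Qed.

Lemma rmap_continuous : {for z, continuous (rmap K k)}.
Proof.
have N0 := can_gt0 (dom_can K k zD).
have cN : ct z (fun x => (Num.sqrt (rad K x ^+ 2 + level K k x ^+ 2))^-1).
  apply: ctV; first by rewrite gt_eqF// sqrtr_gt0.
  apply: (@ct_comp _ _ _ Num.sqrt); first exact: sqrt_continuous.
  by apply: ctD; apply: ctX; [exact: ct_rad|exact: ct_level].
have cturn (g : R -> R) : continuous g -> (forall x, `|g x| <= 1) ->
    ct z (fun x => rad K x * g (2 * pi * angle K k x)).
  (* At radius 0 the angle is not continuous, but its cosine and sine are bounded. *)
  move=> cg g1; have [r0|r0] := eqVneq (rad K z) 0.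
    by apply: (ct_bounded (M := 1)) => //; exact: ct_rad.
  apply: ctM; first exact: ct_rad.
  apply: ct_comp => //; apply: ctM; [exact: ct_cst|exact: ct_angle].
apply: ct_rV => j.
apply: (@eq_ct _ _ _ (fun x => [:: rad K x * (turn (angle K k x)).1;
    rad K x * (turn (angle K k x)).2; level K k x]`_j *
    (Num.sqrt (rad K x ^+ 2 + level K k x ^+ 2))^-1)) => [x|]; first by rewrite mxE.
apply: ctM => //; case: j => -[|[|[|//]]] jl /=.
- by apply: cturn; [exact: continuous_cos|move=> x; rewrite ler_norml cos_geN1 cos_le1].
- by apply: cturn; [exact: continuous_sin|move=> x; rewrite ler_norml sin_geN1 sin_le1].
- exact: ct_level.
Qed.

End At.

End Target.

(** * The homeomorphism *)

Lemma compact_set_type (T : topologicalType) (A : set T) :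
  compact A -> compact [set: set_type A].
Proof.
move=> cA F PF _; have [|p [Ap pF]] := cA (val @ F) (fmap_proper_filter _ PF).
  by apply: (@filterS _ F _ setT) => [x _|]; [exact: set_valP|exact: filterT].
exists (exist _ p (mem_set Ap)); split=> // U W FU [_ [[G oG <-]] /= Gp GW].
have [|x [[u Uu <-] Gu]] := pF (set_val @` U) G _ (open_nbhs_nbhs (conj oG Gp)).
  by apply: (@filterS _ F _ U) => // u Uu; exists u.
by exists u; split=> //; exact: GW.
Qed.

Lemma hausdorff_set_type (T : topologicalType) (A : set T) :
  hausdorff_space T -> hausdorff_space (set_type A).
Proof. by apply: hausdorff_inj (@initial_continuous _ _ _) _; exact: val_inj. Qed.

Lemma hausdorff_pair (S T : topologicalType) :
  hausdorff_space S -> hausdorff_space T -> hausdorff_space (S * T)%type.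
Proof.
move=> hS hT [a b] [a' b'] cl; congr (_, _).
  apply: hS => A B nA nB.
  have [||[x y] [[Ax _] [Bx _]]] := cl (A `*` setT) (B `*` setT); last by exists x.
    by exists (A, setT) => //; split=> //; exact: filterT.
  by exists (B, setT) => //; split=> //; exact: filterT.
apply: hT => A B nA nB.
have [||[x y] [[_ Ay] [_ By]]] := cl (setT `*` A) (setT `*` B); last by exists y.
  by exists (setT, A) => //; split=> //; exact: filterT.
by exists (setT, B) => //; split=> //; exact: filterT.
Qed.

Lemma lift_continuous (S T : topologicalType) (D : set S) (A : set T) (f : S -> T)
    (g : set_type D -> set_type A) :
  (forall z, D z -> {for z, continuous f}) -> (forall x, val (g x) = f (val x)) -> continuous g.
Proof.
move=> cf gf; apply: continuous_comp_initial => x.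
have -> : val \o g = f \o val by apply/funext => y; exact: gf.
apply: continuous_comp; first exact: initial_continuous.
by apply: cf; exact: set_valP.
Qed.

Lemma sphere_compact (R : realType) (n : nat) : compact (sphere R n).
Proof.
apply: (@subclosed_compact _ _ [set v : 'rV[R]_n.+1 | forall i, v ord0 i \in `[(-1), 1]]).
- have -> : sphere R n = (fun x : 'rV[R]_n.+1 => \sum_i x ord0 i ^+ 2) @^-1` [set 1] by [].
  apply: closed_comp => [x _|]; last exact: closed_eq.
  by apply: ct_sum => i _; apply: ctX; exact: coord_continuous.
- have H := @rV_compact R n.+1 (fun=> `[(-1), 1]%classic) (fun=> @segment_compact R _ _). exact: H.
- move=> x /= xS i; rewrite in_itv /= -ler_norml -(@expr_le1 _ 2)// real_normK ?num_real// -xS.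
  by rewrite (bigD1 i)//= lerDl sumr_ge0// => j _; exact: sqr_ge0.
Qed.

Lemma dom_compact (R : realType) (m : nat) : compact (@dom R m).
Proof.
have -> : @dom R m = sphere R m `*` `[0, 1]%classic `*` `[0, 1]%classic.
  apply/seteqP; split=> -[[om th] s] /=; first by case=> S t1 s1; rewrite !in_itv /= t1 s1.
  by move=> [[S t1] s1]; move: t1 s1; rewrite !in_itv /=.
apply: compact_setX; last exact: segment_compact.
by apply: compact_setX; [exact: sphere_compact|exact: segment_compact].
Qed.

Lemma realization_homeomorphic (R : realType) (m : nat) :
  homeomorphic (set_type (realization R (cpx m.+2)))
    (set_type (sphere R 2) * set_type (sphere R m))%type.
Proof.
(* Three pieces, the collar and two discs, each cut into [2 d] slots. *)
pose I : finType := (option bool * 'I_(m.+3.*2))%type.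
pose Z : topologicalType := set_type (@dom R m).
pose q (i : I) (z : Z) : set_type (realization R (cpx m.+2)) :=
  exist _ (qmap i.1 i.2 (val z)) (mem_set (qmap_realization i.1 (ltn_ord i.2) (set_valP z))).
have zS (z : Z) : sphere R m (val z).1.1 by have [] := set_valP z.
pose r1 (i : I) (z : Z) : set_type (sphere R 2) :=
  exist _ (rmap i.1 i.2 (val z)) (mem_set (rmap_sphere i.1 i.2 (set_valP z))).
pose r2 (z : Z) : set_type (sphere R m) := exist _ (val z).1.1 (mem_set (zS z)).
apply: (@glue_homeomorphic I Z _ _ q (fun i z => (r1 i z, r2 z))).
- by apply: compact_set_type; exact: dom_compact.
- by apply: hausdorff_set_type; apply: hausdorff_product => v; exact: Rhausdorff.
- by apply: hausdorff_pair; apply: hausdorff_set_type; exact: norm_hausdorff.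
- move=> i; apply: (@lift_continuous _ _ _ _ (qmap i.1 i.2 : _ -> {ptws ('I_m.+3 * (bool * bool))%type -> R})) => // z zD.
  exact: qmap_continuous.
- move=> i.
  have c1 : continuous (r1 i).
    apply: (@lift_continuous ('rV[R]_m.+1 * R * R)%type _ (@dom R m) _ (rmap i.1 i.2) (r1 i)) => [z zD|//].
    exact: rmap_continuous.
  have c2 : continuous r2.
    apply: (@lift_continuous ('rV[R]_m.+1 * R * R)%type _ (@dom R m) _
      (fun z : 'rV[R]_m.+1 * R * R => z.1.1) r2) => [z _|//].
    by apply: continuous_comp; exact: cvg_fst.
  by move=> z; exact: (cvg_pair (c1 z) (c2 z)).
- move=> x; have [K [k [z [kd zD E]]]] := realization_qmap (set_valP x).
  exists (K, Ordinal kd), (exist _ z (mem_set zD)); exact: val_inj.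
- move=> [v o]; have [K [k [z [kd zD om E]]]] := rmap_onto (set_valP o) (set_valP v).
  exists (K, Ordinal kd), (exist _ z (mem_set zD)); congr (_, _); exact: val_inj.
- move=> [K k] [K' k'] z z'.
  have fib := qr_fibre K K' (ltn_ord k) (ltn_ord k') (set_valP z) (set_valP z').
  split=> [/(congr1 val)/fib E|E].
    have e1 := congr1 fst E; have e2 := congr1 snd E;  congr (_, _); exact: val_inj.
  have e1 : rmap K k (val z) = rmap K' k' (val z') := congr1 (fun p => val p.1) E.
  have e2 : (val z).1.1 = (val z').1.1 := congr1 (fun p => val p.2) E.
  by apply: val_inj; apply/fib; rewrite e1 e2.
Qed.

Theorem theorem4p5 (R : realType) (d : nat) (hd : (3 <= d)%N) :
  exists (V : finType) (K : {set {set V}}),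
    [/\ simplicial_complex K,
        balanced d K,
        #|vertices K| = (4 * d)%N
      & homeomorphic (set_type (realization R K))
          (set_type (sphere R 2) * set_type (sphere R (d - 3)))%type].
Proof.
case: d hd => [|[|[|m]]] // _; rewrite !subSS subn0.
exists ('I_m.+3 * (bool * bool))%type, (cpx m.+2); split.
- exact: cpx_complex.
- exact: cpx_balanced.
- exact: cpx_vertices.
- exact: realization_homeomorphic.
Qed.
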